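(* Let $k\ge1$ be an integer, let $\lambda_1,\dots,\lambda_k>0$ and $\mu_1,\dots,\mu_k>0$, and let $0<\alpha<1$. Then the one-dimensional distributions of the generalized fractional Skellam process $\{\mathcal S^\alpha(t)\}_{t\ge0}$ with these rates are not infinitely divisible; that is, for $t>0$ the distribution of the random variable $\mathcal S^\alpha(t)$ is not infinitely divisible.
   Context: The generalized counting process (GCP) with positive rates $\lambda_1,\dots,\lambda_k$ is the counting process $\{M(t)\}_{t\ge0}$ with $M(0)=0$ that performs $k$ kinds of jumps of amplitude $1,2,\dots,k$ with rates $\lambda_1,\dots,\lambda_k$, respectively; equivalently $M(t)=\sum_{j=1}^k jN_j(t)$ in law, where $N_1,\dots,N_k$ are independent Poisson processes with intensities $\lambda_1,\dots,\lambda_k$. The generalized Skellam process (GSP) is $\mathcal S(t)=M_1(t)-M_2(t)$, where $M_1$ and $M_2$ are independent GCPs with rates $\lambda_1,\dots,\lambda_k$ and $\mu_1,\dots,\mu_k$, respectively. For $0<\alpha<1$, the stable subordinator $\{D_\alpha(t)\}_{t\ge0}$ is the non-decreasing Lévy process with $\mathbb E(e^{-sD_\alpha(t)})=e^{-ts^\alpha}$, $s>0$, and the inverse stable subordinator is $Y_\alpha(t)=\inf\{x\ge0:D_\alpha(x)>t\}$. The generalized fractional Skellam process (GFSP) is $\mathcal S^\alpha(t)=\mathcal S(Y_\alpha(t))$, with $\mathcal S$ independent of $Y_\alpha$. *)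

(* Defs.v *)
From HB Require Import structures.
From mathcomp Require Import all_boot all_order all_algebra.
From mathcomp Require Import all_classical all_reals all_analysis.

Set Implicit Arguments.
Unset Strict Implicit.
Unset Printing Implicit Defensive.

Import Order.TTheory GRing.Theory Num.Theory.
Import numFieldNormedType.Exports.

Local Open Scope classical_set_scope.
Local Open Scope ring_scope.

(* Stochastic processes are maps X : R -> T -> E, of which only the values at
   times t >= 0 matter. *)

Section Independence.
Context {d : measure_display} {T : measurableType d} {R : realType}.
Variable P : probability T R.

Definition rv_salgebra {d'} {E : measurableType d'} (Z : T -> E) : set (set T) :=
  preimage_set_system [set: T] Z measurable.

Definition process_salgebra {d'} {E : measurableType d'} (U : set R)
    (X : R -> T -> E) : set (set T) :=
  <<s \bigcup_(t in U) rv_salgebra (X t) >>.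

Definition independent2 (F G : set (set T)) : Prop :=
  forall A B, F A -> G B -> P (A `&` B) = (P A * P B)%E.

(* When each [F j] is a sigma-algebra, subfamilies are covered by taking some
   of the events [A j] to be [setT]. *)
Definition mutually_independent (J : finType) (F : J -> set (set T)) : Prop :=
  forall A : J -> set T, (forall j, F j (A j)) ->
    P (\bigcap_(j in [set: J]) A j) = (\prod_(j : J) P (A j))%E.

Definition independent_increments (X : R -> T -> R) : Prop :=
  forall s t : R, 0 <= s -> s < t ->
    independent2 (process_salgebra [set u | 0 <= u <= s] X)
                 (rv_salgebra (fun w => X t w - X s w)).

Definition stationary_increments (X : R -> T -> R) : Prop :=
  forall s t : R, 0 <= s -> s <= t -> forall B : set R, measurable B ->
    pushforward P (fun w => X t w - X s w) B = pushforward P (X (t - s)) B.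

End Independence.

Section CountingProcesses.
Context {d : measure_display} {T : measurableType d} {R : realType}.
Variable P : probability T R.

(* [nat] carries the discrete topology. *)
Record counting_process (N : R -> T -> nat) : Prop := {
  counting_measurable : forall t : R, 0 <= t -> measurable_fun [set: T] (N t);
  counting0 : forall w, N 0 w = 0%N;
  counting_nondecreasing : forall w (s t : R),
    0 <= s -> s <= t -> (N s w <= N t w)%N;
  counting_right_continuous : forall w (t : R),
    0 <= t -> N s w @[s --> t^'+] --> N t w }.

Record poisson_process (rate : R) (N : R -> T -> nat) : Prop := {
  poisson_counting : counting_process N;
  poisson_independent_increments :
    independent_increments P (fun t w => (N t w)%:R : R);
  poisson_increments : forall (s t : R) (n : nat), 0 <= s -> s < t ->
    P [set w | (N t w - N s w)%N = n] = (poisson_pmf (rate * (t - s)) n)%:E }.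

End CountingProcesses.

(* Equality of all finite-dimensional distributions. *)
Definition eq_in_law {d1 d2 d' : measure_display} {T1 : measurableType d1}
    {T2 : measurableType d2} {E : measurableType d'} {R : realType}
    (P1 : probability T1 R) (P2 : probability T2 R)
    (X1 : R -> T1 -> E) (X2 : R -> T2 -> E) : Prop :=
  forall (n : nat) (t : 'I_n -> R) (B : 'I_n -> set E),
    (forall i, 0 <= t i) -> (forall i, measurable (B i)) ->
    P1 (\bigcap_(i in [set: 'I_n]) (X1 (t i) @^-1` B i)) =
    P2 (\bigcap_(i in [set: 'I_n]) (X2 (t i) @^-1` B i)).

Section GeneralizedFractionalSkellam.
Context {d : measure_display} {T : measurableType d} {R : realType}.
Variable P : probability T R.

(* The index j : 'I_k stands for the jump amplitude j.+1. *)
Definition generalized_counting_process (k : nat) (lam : 'I_k -> R)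
    (M : R -> T -> nat) : Prop :=
  counting_process M /\
  exists (d' : measure_display) (T' : measurableType d')
         (P' : probability T' R) (N : 'I_k -> R -> T' -> nat),
    [/\ forall j, poisson_process P' (lam j) (N j),
        mutually_independent P'
          (fun j => process_salgebra [set t : R | 0 <= t] (N j))
      & eq_in_law P P' M (fun t w => (\sum_(j < k) j.+1 * N j t w)%N)].

Definition generalized_skellam_process (k : nat) (lam mu : 'I_k -> R)
    (S : R -> T -> R) : Prop :=
  exists M1 M2 : R -> T -> nat,
    [/\ generalized_counting_process lam M1,
        generalized_counting_process mu M2,
        independent2 P (process_salgebra [set t : R | 0 <= t] M1)
                       (process_salgebra [set t : R | 0 <= t] M2)
      & forall t w, 0 <= t -> S t w = (M1 t w)%:R - (M2 t w)%:R].

(* Stochastic continuity follows from the other axioms. *)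
Record levy_process (X : R -> T -> R) : Prop := {
  levy_measurable : forall t : R, 0 <= t -> measurable_fun [set: T] (X t);
  levy0 : {ae P, forall w, X 0 w = 0};
  levy_independent_increments : independent_increments P X;
  levy_stationary_increments : stationary_increments P X;
  levy_right_continuous : forall w (t : R),
    0 <= t -> X s w @[s --> t^'+] --> X t w;
  levy_left_limits : forall w (t : R), 0 < t -> cvg (X s w @[s --> t^'-]) }.

Record stable_subordinator (alpha : R) (D : R -> T -> R) : Prop := {
  subordinator_levy : levy_process D;
  subordinator_nondecreasing : forall w (s t : R),
    0 <= s -> s <= t -> D s w <= D t w;
  subordinator_laplace : forall s t : R, 0 < s -> 0 <= t ->
    ('E_P[fun w => expR (- (s * D t w))] = (expR (- (t * s `^ alpha)))%:E)%E }.

(* The set is empty only on the null event where D stays below t forever;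
   there [inf set0 = 0]. *)
Definition inverse_subordinator (D : R -> T -> R) (t : R) (w : T) : R :=
  inf [set x : R | 0 <= x /\ t < D x w].

Definition generalized_fractional_skellam_process (k : nat)
    (lam mu : 'I_k -> R) (alpha : R) (X : R -> T -> R) : Prop :=
  exists (S D : R -> T -> R),
    [/\ generalized_skellam_process lam mu S,
        stable_subordinator alpha D,
        independent2 P
          (process_salgebra [set t : R | 0 <= t] S)
          (process_salgebra [set t : R | 0 <= t] (inverse_subordinator D))
      & forall t w, 0 <= t -> X t w = S (inverse_subordinator D t w) w].

End GeneralizedFractionalSkellam.

Definition infinitely_divisible {R : realType} (nu : set R -> \bar R) : Prop :=
  forall n : nat, (0 < n)%N ->
    exists (d : measure_display) (T : measurableType d)
           (Q : probability T R) (Z : 'I_n -> {RV Q >-> R}),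
      [/\ mutually_independent Q (fun i => rv_salgebra (Z i)),
          forall (i j : 'I_n) (B : set R), measurable B ->
            distribution Q (Z i) B = distribution Q (Z j) B
        & forall B : set R, measurable B ->
            nu B = pushforward Q (fun w => \sum_(i < n) Z i w) B].

(* Main.v *)
Require Import Defs.
From HB Require Import structures.
From mathcomp Require Import all_boot all_order all_algebra.
From mathcomp Require Import ring lra zify.
From mathcomp Require Import complex.
From mathcomp Require Import all_classical all_reals all_analysis.
From mathcomp Require Import measurable_realfun.

(* Put [X = S (Y)] with [Y] the inverse subordinator, and let [kappa] be the
   Laurent polynomial with [E e^{z S(y)} = e^{y kappa(e^z)}], so that
   [E e^{zX} = E e^{kappa(e^z) Y}].  If the integer-valued [X] were infinitely
   divisible, its Levy measure would have bounded support, because [E e^{aX}]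
   grows at most like [exp (C e^{K |a|})]; hence [ln |E e^{zX}|] would equal,
   up to any prescribed error on a vertical strip,
   [r Re z + sum_{|j| <= J} p_j (Re e^{jz} - 1)].  Now sum this over
   [z = ln w_i], where [w_1, ..., w_{2k}] are all complex roots of
   [kappa (w) = - s].  On one side every term is [h s = ln E e^{- sY}].  On the
   other side, [sum_i ln |w_i|] does not depend on [s] and, by Newton's
   identities, each [sum_i w_i^j] is a polynomial in [s], of degree independent
   of the error.  So a finite difference of fixed order annihilates [h] on the
   natural numbers.  But [h s = o(s)], since [Y] is arbitrarily small with
   positive probability, so [h] is constant, [E e^{- Y} = 1] and [Y = 0] almost
   surely, which is absurd. *)

Set Implicit Arguments.
Unset Strict Implicit.
Unset Printing Implicit Defensive.
Import Order.TTheory GRing.Theory Num.Theory.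
Import numFieldNormedType.Exports.
Local Open Scope classical_set_scope.
Local Open Scope ring_scope.
Local Open Scope complex_scope.
Local Notation Re := (@complex.Re _).
Local Notation Im := (@complex.Im _).
Import ComplexField.Normc.

(** * Finite differences and power sums of roots *)

Section FiniteDifferences.
Variable R : archiRealFieldType.

(** No limiting Levy measure is ever formed. The order of the finite difference must be fixed before
    the error, so the truncation [J] may depend neither on the error nor on the width of the strip.
    This is what the growth bound provides: E e^{xY} is at most exp (C x^m) with m about 1/alpha,
    and kappa (e^a) grows like e^{k |a|}, so K is about k m. An n-th convolution root then
    contributes beyond [J] a term of order e^{K th} e^{- (th - th0) J}, which for J > K vanishes as
    th grows. Integer exponents j are available because each convolution root is, after a shift,
    supported on the integers; this rests on the existence of an atom. Taking ln of a modulus avoids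
    branches: any logarithm z of w_i serves, as only Re z = ln |w_i| and e^{jz} = w_i^j occur. All
    complex roots are taken together since power sums are polynomial in s only over the full set of
    roots. The condition alpha < 1 acts through E e^{- s D(e)} = exp (- e s^alpha), which as s tends
    to 0 forbids D(e) from being bounded. *)

Definition fdiff (u : nat -> R) (n : nat) : R := u n.+1 - u n.

Lemma eq_iter_fdiff m (u v : nat -> R) :
  u =1 v -> iter m fdiff u =1 iter m fdiff v.
Proof.
by move=> uv; elim: m => [|m IH] n //=; rewrite /fdiff !IH.
Qed.

Lemma iter_fdiffD m (u v : nat -> R) n :
  iter m fdiff (fun i => u i + v i) n = iter m fdiff u n + iter m fdiff v n.
Proof.
elim: m n => [|m IH] n //=; rewrite /fdiff !IH; ring.
Qed.

Lemma iter_fdiffZ m c (u : nat -> R) n :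
  iter m fdiff (fun i => c * u i) n = c * iter m fdiff u n.
Proof. by elim: m n => [|m IH] n //=; rewrite /fdiff !IH mulrBr. Qed.

(** Leibniz rule for multiplication by the index; it carries the induction over the Horner form of a
    polynomial in [iter_fdiff_poly]. *)
Lemma iter_fdiff_natM m (u : nat -> R) n :
  iter m.+1 fdiff (fun i => i%:R * u i) n
    = n%:R * iter m.+1 fdiff u n + m.+1%:R * iter m fdiff u n.+1.
Proof.
elim: m n => [|m IH] n; first by rewrite /= /fdiff -natr1; ring.
by rewrite iterS /fdiff !IH !iterS /fdiff -!natr1; ring.
Qed.

Lemma iter_fdiff_poly m (q : {poly R}) n :
  (size q <= m)%N -> iter m fdiff (fun i => q.[i%:R]) n = 0.
Proof.
elim/poly_ind: q m n => [|p c IH] m n.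
  move=> _; rewrite (@eq_iter_fdiff _ _ (fun i => 0 * 0)) ?iter_fdiffZ ?mul0r //.
  by move=> i; rewrite horner0 ?mulr0.
rewrite size_MXaddC; have [/= /andP[/eqP -> /eqP ->] _|_] := ifP.
  rewrite (@eq_iter_fdiff _ _ (fun i => 0 * 0)) ?iter_fdiffZ ?mul0r //.
  by move=> i; rewrite ?mul0r add0r hornerC ?mulr0.
case: m => // m; rewrite ltnS => sp.
rewrite (@eq_iter_fdiff _ _ (fun i => i%:R * p.[i%:R] + c)); last first.
  by move=> i; rewrite hornerMXaddC mulrC.
rewrite iter_fdiffD iter_fdiff_natM !IH //; last exact: leqW.
rewrite !mulr0 !add0r iterSr (@eq_iter_fdiff _ _ (fun=> 0 * 0)).
  by rewrite iter_fdiffZ mul0r.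
by move=> i; rewrite /fdiff subrr mulr0.
Qed.

(** A difference at most doubles a uniform bound. The factor 2^m is the loss when a sequence is
    known only up to an error on a window of m + 1 points. *)
Lemma iter_fdiff_norm_le m (u : nat -> R) (e : R) n :
  (forall i, (n <= i <= n + m)%N -> `|u i| <= e) ->
  `|iter m fdiff u n| <= 2 ^+ m * e.
Proof.
elim: m n => [|m IH] n ue.
  by rewrite expr0 mul1r ue // leqnn addn0 leqnn.
rewrite iterS /fdiff exprS -mulrA mulr_natl mulr2n.
apply: le_trans (ler_normB _ _) _; apply: lerD; apply: IH => i /andP[ni im].
- by apply: ue; rewrite (ltnW ni) /= -addSnnS.
- by apply: ue; rewrite ni /= addnS leqW.
Qed.

(** Induction on the order: [fdiff u] is again sublinear, hence constant, so [u] is affine, and a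
    sublinear affine sequence has slope zero. *)
Lemma sublinear_fdiff_nilpotent r (u : nat -> R) :
  (forall e, 0 < e -> exists N, forall n, (N <= n)%N -> `|u n| <= e * n%:R) ->
  (forall n, iter r.+1 fdiff u n = 0) -> forall n, u n = u 0%N.
Proof.
move=> uo ur; suff du n : fdiff u n = 0.
  by elim=> // n <-; apply/eqP; rewrite -subr_eq0; apply/eqP/du.
elim: r u uo ur n => // r IH u uo ur.
have dc : forall n, fdiff u n = fdiff u 0%N.
  suff ddu n : fdiff (fdiff u) n = 0.
    by elim=> // n <-; apply/eqP; rewrite -subr_eq0; apply/eqP/ddu.
  apply: IH n => [e e0|n]; last by rewrite -(iterSr r.+1) ur.
  (* (e / 3) (2 n + 1) <= e n as soon as n >= 1. *)
  have [N uN] := uo (e / 3) ltac:(by rewrite divr_gt0).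
  exists N.+1 => n Nn; apply: le_trans (ler_normB _ _) _.
  apply: le_trans (lerD (uN _ _) (uN _ _)) _; try by rewrite ltnW // ltnW.
  rewrite -mulrDr -mulrA ler_pM2l // -[n.+1%:R]natr1.
  have : (1 : R) <= n%:R by rewrite ler1n (leq_trans _ Nn).
  lra.
move=> n; rewrite dc; apply/eqP/contraT => c0.
set c := fdiff u 0 in c0 dc.
have un k : u k = u 0%N + c * k%:R.
  elim: k => [|k IHk]; first by rewrite mulr0 addr0.
  by rewrite -natr1 mulrDr mulr1 addrA -IHk -(dc k) /fdiff addrC subrK.
have c1 : 0 < `|c| by rewrite normr_gt0.
have [N uN] := uo (`|c| / 2) ltac:(by rewrite divr_gt0).
have [M uM] : exists M : nat, 2 * `|u 0%N| / `|c| < M%:R.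
  by eexists; apply: archi_boundP; rewrite !mulr_ge0 // invr_ge0.
have := uN (maxn N M) (leq_maxl _ _); rewrite un => h.
have : `|c * (maxn N M)%:R| <= `|c| / 2 * (maxn N M)%:R + `|u 0%N|.
  rewrite -[X in `|X|](addKr (u 0%N)) addrC.
  by apply: le_trans (ler_normB _ _) _; rewrite lerD.
rewrite normrM (ger0_norm (ler0n _ _)).
have : (M%:R : R) <= (maxn N M)%:R by rewrite ler_nat leq_maxr.
move: uM; rewrite ltr_pdivrMr // => uM MN.
have : `|c| * M%:R <= `|c| * (maxn N M)%:R by rewrite ler_pM2l.
lra.
Qed.

End FiniteDifferences.

Lemma deriv_prod (R : comNzRingType) (I : eqType) (r : seq I) (F : I -> {poly R}) :
  uniq r ->
  (\prod_(i <- r) F i)^`() = \sum_(i <- r) (F i)^`() * \prod_(j <- r | j != i) F j.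
Proof.
elim: r => [|i r IH] /=; first by rewrite !big_nil derivC.
case/andP=> ir ur; rewrite !big_cons derivM IH // eqxx /=; congr (_ * _ + _).
  rewrite [RHS]big_seq_cond big_seq; apply: eq_bigl => j.
  by have [jr|//] := boolP (j \in r); rewrite (memPn ir).
rewrite mulr_sumr !big_seq; apply: eq_bigr => j jr.
by rewrite big_cons eq_sym (memPn ir _ jr) mulrCA.
Qed.

(** * Newton's identities for the roots of a linear pencil of polynomials *)

Section PowerSums.
Variables (R C : fieldType) (phi : {rmorphism R -> C}).

(** The coefficients are taken in [R]: the roots lie in [C], but their power sums are to be
    differenced as real polynomials in the parameter. *)
Definition polyfun (u : R -> C) : Prop :=
  exists q : {poly R}, forall s, u s = phi q.[s].

Lemma eq_polyfun u v : u =1 v -> polyfun u -> polyfun v.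
Proof. by move=> uv [q uq]; exists q => s; rewrite -uv uq. Qed.

Lemma polyfun_cst c : polyfun (fun=> phi c).
Proof. by exists c%:P => s; rewrite hornerC. Qed.

Lemma polyfunD u v : polyfun u -> polyfun v -> polyfun (fun s => u s + v s).
Proof.
by move=> [p up] [q vq]; exists (p + q) => s; rewrite up vq hornerD rmorphD.
Qed.

Lemma polyfunM u v : polyfun u -> polyfun v -> polyfun (fun s => u s * v s).
Proof.
by move=> [p up] [q vq]; exists (p * q) => s; rewrite up vq hornerM rmorphM.
Qed.

Lemma polyfunN u : polyfun u -> polyfun (fun s => - u s).
Proof. by move=> [p up]; exists (- p) => s; rewrite up hornerN rmorphN. Qed.

Variables (m : nat) (A B : {poly R}) (w : R -> 'I_m -> C).
Hypotheses (m0 : (0 < m)%N) (B0 : B`_0 = 0) (A0 : A`_0 != 0)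
  (lA : lead_coef A != 0)
  (wE : forall s, map_poly phi (A + s *: B)
                  = phi (lead_coef A) *: \prod_i ('X - (w s i)%:P)).

Let p s := \prod_i ('X - (w s i)%:P).
Let q s i := \prod_(j | j != i) ('X - (w s j)%:P).

Let coefp_phi s l : (p s)`_l = phi ((A`_l + s * B`_l) / lead_coef A).
Proof.
have := congr1 (fun r : {poly C} => r`_l) (wE s).
rewrite coef_map coefZ coefD coefZ /= => E.
have lA' : phi (lead_coef A) != 0 by rewrite fmorph_eq0.
by rewrite rmorphM fmorphV /= E mulrC mulKf.
Qed.

Let polyfun_coefp l : polyfun (fun s => (p s)`_l).
Proof.
exists ((lead_coef A)^-1 *: ((A`_l)%:P + B`_l *: 'X)) => s.
rewrite coefp_phi; congr (phi _).
by rewrite hornerZ hornerD hornerZ hornerC hornerX mulrC; congr (_ * _); ring.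
Qed.

Let coefp0 s : (p s)`_0 = phi (A`_0 / lead_coef A).
Proof. by rewrite coefp_phi B0 mulr0 addr0. Qed.

Let coefp0_neq0 : phi (A`_0 / lead_coef A) != 0.
Proof. by rewrite fmorph_eq0 mulf_neq0 // invr_eq0. Qed.

(** Vieta's formula; the parameter does not enter, as [B] has no constant term. *)
Lemma prod_roots s : \prod_i w s i = (-1) ^+ m * phi (A`_0 / lead_coef A).
Proof.
rewrite -(coefp0 s) -horner_coef0 horner_prod.
under [in RHS]eq_bigr do rewrite hornerXsubC sub0r -mulN1r.
by rewrite big_split /= prodr_const card_ord mulrA -exprD addnn -muln2 exprM
  sqrr_sign mul1r.
Qed.

Lemma roots_neq0 s i : w s i != 0.
Proof.
apply/negP => /eqP wi; have := prod_roots s.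
rewrite (bigD1 i) //= wi mul0r => /esym/eqP; rewrite mulf_eq0 signr_eq0 /=.
by rewrite (negPf coefp0_neq0).
Qed.

Let pq s i : p s = ('X - (w s i)%:P) * q s i.
Proof. by rewrite /p (bigD1 i). Qed.

Let coefp_q0 s i : (p s)`_0 = - (w s i * (q s i)`_0).
Proof. by rewrite (pq s i) mulrBl coefB coefXM mul_polyC coefZ sub0r. Qed.

Let coefp_qS s i l : (p s)`_l.+1 = (q s i)`_l - w s i * (q s i)`_l.+1.
Proof. by rewrite (pq s i) mulrBl coefB coefXM mul_polyC coefZ. Qed.

Let size_q s i : size (q s i) = m.
Proof.
rewrite size_prod => [|j _]; last by rewrite polyXsubC_eq0.
under eq_bigr do rewrite size_XsubC.
rewrite sum_nat_const cardC1 card_ord.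
by case: m m0 => // n _; rewrite muln2 -addnn -addSn addnK.
Qed.

Let q_lead s i : (q s i)`_m.-1 = 1.
Proof.
rewrite -{1}(size_q s i); apply/eqP; rewrite -[_ == _]/(_ \is monic).
by apply: monic_prod => j _; exact: monicXsubC.
Qed.

Let q_ge s i l : (m <= l)%N -> (q s i)`_l = 0.
Proof. by move=> ml; rewrite nth_default // size_q. Qed.

Let T (r : int) s := \sum_i w s i ^ r.
(* The factorizations [p = ('X - w_i) q_i] make [U] climb one degree for each
   power of [w_i] (lemma [US]), while [q_i`_m.-1 = 1] turns [U m.-1] into [T] and
   [U l 0] is a coefficient of [p^`()]: these are Newton's identities. *)
Let U l (r : int) s := \sum_i (q s i)`_l * w s i ^ r.

Let US l r s : U l r s = (p s)`_l.+1 * T r s + U l.+1 (r + 1) s.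
Proof.
rewrite /U /T mulr_sumr -big_split /=; apply: eq_bigr => i _.
rewrite (coefp_qS s i) expfzDr ?roots_neq0 // expr1z; ring.
Qed.

Let U0 r s : U 0 (r + 1) s = - ((p s)`_0 * T r s).
Proof.
rewrite /U /T mulr_sumr -sumrN /=; apply: eq_bigr => i _.
rewrite (coefp_q0 s i) expfzDr ?roots_neq0 // expr1z; ring.
Qed.

Let Tlast r s : T r s = U m.-1 r s.
Proof. by apply: eq_bigr => i _; rewrite q_lead mul1r. Qed.

Let Uge l r s : (m <= l)%N -> U l r s = 0.
Proof. by move=> ml; rewrite /U big1 // => i _; rewrite q_ge // mul0r. Qed.

Let U_0 l s : U l 0 s = (p s)`_l.+1 *+ l.+1.
Proof.
rewrite -coef_deriv /p deriv_prod ?index_enum_uniq //= coef_sum; apply: eq_bigr => i _.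
by rewrite derivXsubC mul1r expr0z mulr1.
Qed.

Let TU_nat (n : nat) : polyfun (T n) /\ forall l, polyfun (U l n).
Proof.
elim: n => [|n [Tn Un]].
  have U0' l : polyfun (U l 0).
    apply: eq_polyfun (fsym (U_0 l)) _.
    apply: eq_polyfun (fun s => mulr_natl _ _) _; apply: polyfunM => //.
    by rewrite -(rmorph_nat phi); exact: polyfun_cst.
  by split => //; exact: eq_polyfun (fsym (Tlast 0)) _.
have nE : n.+1 = n + 1 :> int by rewrite -addn1 PoszD.
have Un' l : polyfun (U l n.+1).
  rewrite nE; case: l => [|l].
    apply: eq_polyfun (fsym (U0 n)) _.
    by apply: polyfunN; exact: polyfunM.
  have UE s : U l n s - (p s)`_l.+1 * T n s = U l.+1 (n + 1) s.
    by rewrite US addrAC subrr add0r.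
  apply: eq_polyfun UE _; apply: polyfunD => //.
  by apply: polyfunN; exact: polyfunM.
by split=> //; exact: eq_polyfun (fsym (Tlast n.+1)) _.
Qed.

(** The identities run backwards: [U0] is solved for [T] at exponent - (n + 1), the divisor being
    the constant coefficient of the monic polynomial, which is nonzero and free of [s]; then [US]
    gives [U] at the same exponent. *)
Let TU_neg (n : nat) : polyfun (T (- n%:Z)) /\ forall l, polyfun (U l (- n%:Z)).
Proof.
elim: n => [|n [Tn Un]]; first by rewrite oppr0; exact: TU_nat.
have nE : - n%:Z = - n.+1%:Z + 1 by rewrite -addn1 PoszD opprD subrK.
have Tn' : polyfun (T (- n.+1%:Z)).
  have TE s : - phi (A`_0 / lead_coef A)^-1 * U 0 (- n%:Z) s = T (- n.+1%:Z) s.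
    rewrite nE U0 coefp0 mulrNN mulrA -rmorphM mulVf ?rmorph1 ?mul1r //.
    by rewrite -(fmorph_eq0 phi).
  apply: eq_polyfun TE _; apply: polyfunM => //.
  by apply: polyfunN; exact: polyfun_cst.
split=> // l; have [lm|ml] := ltnP l m; last first.
  have UE s : phi 0 = U l (- n.+1%:Z) s by rewrite Uge // rmorph0.
  by apply: eq_polyfun UE _; exact: polyfun_cst.
apply: eq_polyfun (fsym (US l _)) _; apply: polyfunD; first exact: polyfunM.
by rewrite -nE.
Qed.

Lemma power_sums_polyfun (r : int) : polyfun (fun s => \sum_i w s i ^ r).
Proof. by case: (intP r) => [|n|n]; [apply: (TU_nat 0).1|apply: (TU_nat _).1|apply: (TU_neg _).1]. Qed.

End PowerSums.

(** * The complex exponential *)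

Section ComplexExponential.
Variable R : realType.
Implicit Types (z w : R[i]) (a b x : R).

(** Euler's formula is the definition; the power series, needed to sum Poisson weights, is recovered
    in [cvg_cexp_series]. *)
Definition cexp z : R[i] :=
  (expR (Re z) * cos (Im z)) +i* (expR (Re z) * sin (Im z)).

Lemma mulcE (a b a' b' : R) :
  (a +i* b) * (a' +i* b') = (a * a' - b * b') +i* (a * b' + b * a').
Proof. by []. Qed.

Lemma cexpD z w : cexp (z + w) = cexp z * cexp w.
Proof.
case: z w => [a b] [a' b']; rewrite /cexp /= expRD cosD sinD.
by apply/eqP; rewrite eq_complex /=; apply/andP; split; apply/eqP; ring.
Qed.

Lemma cexp_real x : cexp x%:C = (expR x)%:C.
Proof. by rewrite /cexp /= cos0 sin0 mulr0 mulr1. Qed.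

Lemma cexp0 : cexp 0 = 1.
Proof. by rewrite cexp_real expR0. Qed.

Lemma cexp_neq0 z : cexp z != 0.
Proof.
apply/negP => /eqP z0; have := cexpD z (- z).
by rewrite subrr cexp0 z0 mul0r => /eqP; rewrite oner_eq0.
Qed.

Lemma cexp_sum (I : Type) (r : seq I) (F : I -> R[i]) :
  cexp (\sum_(i <- r) F i) = \prod_(i <- r) cexp (F i).
Proof. by elim/big_ind2 : _ => [|? ? ? ? <- <-|//]; rewrite ?cexp0 ?cexpD. Qed.

Lemma cexpMn z n : cexp (z *+ n) = cexp z ^+ n.
Proof.
by elim: n => [|n IH]; rewrite ?mulr0n ?cexp0 // mulrS cexpD IH exprS.
Qed.

Lemma cexpN z : cexp (- z) = (cexp z)^-1.
Proof. by apply: (mulIf (cexp_neq0 z)); rewrite -cexpD addNr cexp0 mulVf ?cexp_neq0. Qed.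

Lemma cexpMz z (n : int) : cexp (z * n%:~R%:C) = cexp z ^ n.
Proof.
rewrite (_ : (n%:~R)%:C = n%:~R); last by rewrite rmorph_int.
case: n => n; first by rewrite mulr_natr cexpMn.
by rewrite NegzE mulrNz mulrN mulr_natr cexpN cexpMn.
Qed.

Lemma normc_cexp z : normc (cexp z) = expR (Re z).
Proof.
rewrite /cexp /normc !exprMn -mulrDr cos2Dsin2 mulr1.
by rewrite sqrtr_sqr ger0_norm ?expR_ge0.
Qed.

(** Polar coordinates, with argument [acos (u / rho)] up to the sign of the imaginary part [v]. *)
Lemma cexp_surj w : w != 0 -> exists z, cexp z = w.
Proof.
case: w => u v; rewrite eq_complex /= => w0.
pose rho := Num.sqrt (u ^+ 2 + v ^+ 2).
have uv0 : 0 < u ^+ 2 + v ^+ 2.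
  by rewrite lt_def paddr_eq0 ?sqr_ge0 // !sqrf_eq0 w0 addr_ge0 ?sqr_ge0.
have rho0 : 0 < rho by rewrite sqrtr_gt0.
have rho2 : rho ^+ 2 = u ^+ 2 + v ^+ 2 by rewrite sqr_sqrtr // ltW.
have ur : -1 <= u / rho <= 1.
  rewrite -ler_norml -(expr_le1 (_ : 0 < 2)%nat) // -normrX.
  rewrite ger0_norm ?sqr_ge0 // exprMn exprVn rho2 ler_pdivrMr // mul1r.
  by rewrite lerDl sqr_ge0.
have cosE : rho * cos (acos (u / rho)) = u.
  by rewrite acosK ?in_itv //= mulrC divfK // gt_eqF.
have sinE : rho * sin (acos (u / rho)) = `|v|.
  rewrite sin_acos //; have -> : 1 - (u / rho) ^+ 2 = (`|v| / rho) ^+ 2.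
    rewrite !exprMn exprVn rho2 real_normK ?num_real //.
    by field; rewrite gt_eqF.
  by rewrite sqrtr_sqr ger0_norm ?divr_ge0 // 1?ltW // mulrC divfK // gt_eqF.
have [v0|v0] := leP 0 v.
  exists (ln rho +i* acos (u / rho)).
  by rewrite /cexp /= lnK ?posrE // cosE sinE ger0_norm.
exists (ln rho +i* (- acos (u / rho))).
by rewrite /cexp /= lnK ?posrE // cosN sinN mulrN cosE sinE ltr0_norm // opprK.
Qed.

Lemma normc_ge0 z : 0 <= normc z.
Proof. by case: z => a b; exact: sqrtr_ge0. Qed.

Lemma Re_le_normc z : `|Re z| <= normc z.
Proof.
case: z => a b /=; rewrite -sqrtr_sqr ler_wsqrtr // lerDl; exact: sqr_ge0.
Qed.

Lemma Im_le_normc z : `|Im z| <= normc z.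
Proof.
case: z => a b /=; rewrite -sqrtr_sqr ler_wsqrtr // lerDr; exact: sqr_ge0.
Qed.

Lemma normcX z n : normc (z ^+ n) = normc z ^+ n.
Proof.
elim: n => [|n IH]; first by rewrite !expr0 normc1.
by rewrite !exprS normcM IH.
Qed.

(** * The power series of the complex exponential *)

Section Series.
Variable z : R[i].

Let c n : R := Re (z ^+ n) / n`!%:R.
Let d n : R := Im (z ^+ n) / n`!%:R.

Let factS_neq0 n : (n.+1%:R : R) != 0 /\ (n`!%:R : R) != 0.
Proof. by split; rewrite pnatr_eq0 -lt0n ?fact_gt0. Qed.

(** With [dd], this says that differentiating the series of z^n x^n / n! in the real variable x
    multiplies it by z. *)
Let dc : pseries_diffs c = fun n => Re z * c n - Im z * d n.
Proof.
apply/funext => n; rewrite /pseries_diffs /c /d factS natrM exprS.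
have [? ?] := factS_neq0 n; case: z (z ^+ n) => [a b] [a' b'] /=.
by field; apply/andP.
Qed.

Let dd : pseries_diffs d = fun n => Re z * d n + Im z * c n.
Proof.
apply/funext => n; rewrite /pseries_diffs /c /d factS natrM exprS.
have [? ?] := factS_neq0 n; case: z (z ^+ n) => [a b] [a' b'] /=.
by field; apply/andP.
Qed.

Let cvg_of_le (f : nat -> R) x :
  (forall n, `|f n| <= normc z ^+ n / n`!%:R) -> cvgn (pseries f x).
Proof.
move=> fle; apply: normed_cvg.
apply: series_le_cvg (is_cvg_series_exp_coeff (normc z * `|x|)).
- by move=> n; exact: normr_ge0.
- by move=> n; rewrite /exp_coeff /= divr_ge0 // exprn_ge0 // mulr_ge0 ?normc_ge0.
- by move=> n; rewrite /exp_coeff /= exprMn normrM normrX mulrAC ler_wpM2r ?exprn_ge0.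
Qed.

Let cvgc x : cvgn (pseries c x).
Proof.
apply: cvg_of_le => n; rewrite /c normrM normfV normr_nat ler_pM2r.
  by rewrite -normcX Re_le_normc.
by rewrite invr_gt0 ltr0n fact_gt0.
Qed.

Let cvgd x : cvgn (pseries d x).
Proof.
apply: cvg_of_le => n; rewrite /d normrM normfV normr_nat ler_pM2r.
  by rewrite -normcX Im_le_normc.
by rewrite invr_gt0 ltr0n fact_gt0.
Qed.

Let pseries_lin (f g : nat -> R) a b x :
  cvgn (pseries f x) -> cvgn (pseries g x) ->
  pseries (fun n => a * f n + b * g n) x @ \oo -->
    a * limn (pseries f x) + b * limn (pseries g x).
Proof.
move=> cf cg.
rewrite (_ : pseries _ x = (fun n => a * pseries f x n + b * pseries g x n)).
  by apply: cvgD; apply: cvgZ => //; exact: cvg_cst.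
apply/funext => n; rewrite /pseries /series /= !mulr_sumr -big_split /=.
by apply: eq_bigr => i _; ring.
Qed.

(** F + i G is the sum of the series of e^{zx}, and satisfies the differential equation (F + i G)' =
    z (F + i G). *)
Let F x := limn (pseries c x).
Let G x := limn (pseries d x).

Let is_derive_F x : is_derive x (1 : R) F (Re z * F x - Im z * G x).
Proof.
have dcE : pseries_diffs c = fun n => Re z * c n + (- Im z) * d n.
  by rewrite dc; apply/funext => n; rewrite mulNr.
have ddE : pseries_diffs (pseries_diffs c) =
    fun n => Re z * pseries_diffs c n + (- Im z) * pseries_diffs d n.
  by rewrite {1}dcE; apply/funext => n; rewrite /pseries_diffs; ring.
have cvgdc y : cvgn (pseries (pseries_diffs c) y).
  by rewrite dcE; apply: cvgP; exact: pseries_lin.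
have cvgdd y : cvgn (pseries (pseries_diffs d) y).
  by rewrite dd; apply: cvgP; exact: pseries_lin.
have -> : Re z * F x - Im z * G x = limn (pseries (pseries_diffs c) x).
  by apply/esym/cvg_lim => //; rewrite dcE -mulNr; exact: pseries_lin.
(* Termwise differentiation at x asks that the series and its first two formal derivatives converge
   at some point beyond |x|. *)
apply: (@pseries_snd_diffs _ _ (`|x| + 1)) => //.
- by rewrite ddE; apply: cvgP; exact: pseries_lin.
- by rewrite [ltRHS]ger0_norm// addrC -subr_gt0 addrK.
Qed.

Let is_derive_G x : is_derive x (1 : R) G (Re z * G x + Im z * F x).
Proof.
have ddE : pseries_diffs (pseries_diffs d) =
    fun n => Re z * pseries_diffs d n + Im z * pseries_diffs c n.
  by rewrite {1}dd; apply/funext => n; rewrite /pseries_diffs; ring.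
have cvgdc y : cvgn (pseries (pseries_diffs c) y).
  rewrite dc (_ : (fun n => _) = fun n => Re z * c n + (- Im z) * d n).
    by apply: cvgP; exact: pseries_lin.
  by apply/funext => n; rewrite mulNr.
have cvgdd y : cvgn (pseries (pseries_diffs d) y).
  by rewrite dd; apply: cvgP; exact: pseries_lin.
have -> : Re z * G x + Im z * F x = limn (pseries (pseries_diffs d) x).
  by apply/esym/cvg_lim => //; rewrite dd; exact: pseries_lin.
apply: (@pseries_snd_diffs _ _ (`|x| + 1)) => //.
- by rewrite ddE; apply: cvgP; exact: pseries_lin.
- by rewrite [ltRHS]ger0_norm// addrC -subr_gt0 addrK.
Qed.

Let F0 : F 0 = 1.
Proof.
apply/cvg_lim => //; rewrite -cvg_shiftS /=.
rewrite (_ : (fun n => _) = fun=> 1); first exact: cvg_cst.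
apply/funext => n; rewrite /pseries /series /= big_nat_recl //= big1.
  by rewrite /c !expr0 fact0 divr1 mulr1 addr0.
by move=> i _; rewrite expr0n mulr0.
Qed.

Let G0 : G 0 = 0.
Proof.
apply/cvg_lim => //; rewrite -cvg_shiftS /=.
rewrite (_ : (fun n => _) = fun=> 0); first exact: cvg_cst.
apply/funext => n; rewrite /pseries /series /= big_nat_recl //= big1.
  by rewrite /d !expr0 mul0r mul0r addr0.
by move=> i _; rewrite expr0n mulr0.
Qed.

(* The rotated pair [e^{-zx} (F + iG)] has zero derivative. *)
Let rotF x : expR (- Re z * x) * (cos (Im z * x) * F x + sin (Im z * x) * G x) = 1.
Proof.
set v := LHS; pattern x in v; move: @v; set f := (X in let _ := X x in _) => /=.
apply: (@eq_trans _ _ (f 0)).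
  apply: is_derive_0_is_cst => {}x.
  have dF := is_derive_F x; have dG := is_derive_G x.
  by apply: trigger_derive; rewrite /GRing.scale /=; ring.
by rewrite /f !mulr0 F0 cos0 sin0 expR0; ring.
Qed.

Let rotG x : expR (- Re z * x) * (cos (Im z * x) * G x - sin (Im z * x) * F x) = 0.
Proof.
set v := LHS; pattern x in v; move: @v; set f := (X in let _ := X x in _) => /=.
apply: (@eq_trans _ _ (f 0)).
  apply: is_derive_0_is_cst => {}x.
  have dF := is_derive_F x; have dG := is_derive_G x.
  by apply: trigger_derive; rewrite /GRing.scale /=; ring.
by rewrite /f !mulr0 G0 cos0 sin0 expR0; ring.
Qed.

Lemma cvg_cexp_series :
  (series (fun n => Re (z ^+ n) / n`!%:R) @ \oo --> Re (cexp z)) /\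
  (series (fun n => Im (z ^+ n) / n`!%:R) @ \oo --> Im (cexp z)).
Proof.
have e0 : expR (- Re z * 1) != 0 by rewrite gt_eqF ?expR_gt0.
have hF := rotF 1; have hG := rotG 1.
have := cos2Dsin2 (Im z).
rewrite !mulr1 in e0 hF hG => cs.
have {}hG : cos (Im z) * G 1 - sin (Im z) * F 1 = 0.
  by apply: (mulfI e0); rewrite hG mulr0.
have {}hF : cos (Im z) * F 1 + sin (Im z) * G 1 = expR (Re z).
  by apply: (mulfI e0); rewrite hF -expRD addNr expR0.
(* The rotation by Im z is inverted by means of cos^2 + sin^2 = 1. *)
have FE : F 1 = Re (cexp z).
  rewrite /cexp /= -hF; apply/eqP; rewrite -subr_eq0; apply/eqP.
  transitivity (F 1 * (1 - (cos (Im z) ^+ 2 + sin (Im z) ^+ 2))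
    - sin (Im z) * (cos (Im z) * G 1 - sin (Im z) * F 1)); first by ring.
  by rewrite cs hG; ring.
have GE : G 1 = Im (cexp z).
  rewrite /cexp /= -hF; apply/eqP; rewrite -subr_eq0; apply/eqP.
  transitivity (G 1 * (1 - (cos (Im z) ^+ 2 + sin (Im z) ^+ 2))
    + cos (Im z) * (cos (Im z) * G 1 - sin (Im z) * F 1)); first by ring.
  by rewrite cs hG; ring.
have pseries1 f : pseries f 1 = series f :> (R^nat).
  rewrite /pseries; congr (series _); apply/funext => n.
  by rewrite /= expr1n mulr1.
rewrite -FE -GE /F /G; split.
- by have := @cvgc 1; rewrite pseries1.
- by have := @cvgd 1; rewrite pseries1.
Qed.

End Series.

End ComplexExponential.

(** * Independence *)

Section Independence.
Context {d : measure_display} {T : measurableType d} {R : realType}.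
Variable P : probability T R.

Definition rv_of {d'} {E : measurableType d'} (U : T -> E)
  (mU : measurable_fun [set: T] U) : {mfun T >-> E} :=
  HB.pack U (isMeasurableFun.Build _ _ _ _ U mU).

Section Pair.
Context {d1 d2 : measure_display} {E1 : measurableType d1} {E2 : measurableType d2}.
Variables (U : {mfun T >-> E1}) (V : {mfun T >-> E2}).

Lemma independent2P : independent2 P (rv_salgebra U) (rv_salgebra V) <->
  forall B C, measurable B -> measurable C ->
    P (U @^-1` B `&` V @^-1` C) = (P (U @^-1` B) * P (V @^-1` C))%E.
Proof.
split=> [indep B C mB mC|indep _ _ [B mB <-] [C mC <-]]; last by rewrite !setTI indep.
by apply: indep; [exists B|exists C] => //; rewrite setTI.
Qed.

Lemma measurable_pair : measurable_fun [set: T] (fun w => (U w, V w)).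
Proof. exact: measurable_fun_pair. Qed.

(** Both sides are finite measures in E that agree on rectangles, so uniqueness of the product
    measure applies. The additional event [A] is what the induction on partial sums feeds with the
    remaining variables. *)
Lemma indep_pair_law (A : set T) (E : set (E1 * E2)) :
  measurable A -> measurable E ->
  (forall B C, measurable B -> measurable C ->
    P (U @^-1` B `&` V @^-1` C `&` A)
      = (P (U @^-1` B) * (P (V @^-1` C) * P A))%E) ->
  P ((fun w => (U w, V w)) @^-1` E `&` A)
    = ((distribution P U \x distribution P V) E * P A)%E.
Proof.
move=> mA mE indep.
have mUV := measurable_pair.
have PA : (0 <= fine (P A))%R by rewrite fine_ge0.
have PAE : (fine (P A))%:E = P A by rewrite fineK // fin_num_measure.
(* P A is absorbed into the first factor, so that a genuine product measure appears. *)
pose m1 := mscale (NngNum PA) (distribution P U).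
have -> : P ((fun w => (U w, V w)) @^-1` E `&` A)
    = pushforward (mrestr P mA) (fun w => (U w, V w)) E by [].
rewrite -(@product_measure_unique _ _ _ _ _ m1 (distribution P V)
  (pushforward (mrestr P mA) (fun w => (U w, V w)))) //; last first.
  move=> B C mB mC; transitivity (P A * P (U @^-1` B) * P (V @^-1` C))%E.
    by rewrite -muleA muleC -muleA -indep.
  by rewrite -[in LHS]PAE.
rewrite (@product_measure_unique _ _ _ _ _ m1 (distribution P V)
  (mscale (NngNum PA) (distribution P U \x distribution P V)%E)) //; last first.
  move=> B C mB mC.
  transitivity ((fine (P A))%:E * (distribution P U \x distribution P V) (B `*` C))%E => //.
  by rewrite product_measure1E // muleA.
transitivity ((fine (P A))%:E * (distribution P U \x distribution P V) E)%E => //.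
by rewrite PAE muleC.
Qed.

Hypothesis UV : independent2 P (rv_salgebra U) (rv_salgebra V).

Lemma indep_pair_distribution (E : set (E1 * E2)) : measurable E ->
  P ((fun w => (U w, V w)) @^-1` E) = ((distribution P U \x distribution P V) E)%E.
Proof.
move=> mE; rewrite -[LHS](congr1 P (setIT _)) (@indep_pair_law setT) //.
  by rewrite probability_setT mule1.
move=> B C mB mC; rewrite setIT probability_setT mule1.
exact: independent2P.1.
Qed.

Local Open Scope ereal_scope.

Lemma ge0_integral_indep (f : E1 * E2 -> \bar R) :
  measurable_fun setT f -> (forall x, 0 <= f x) ->
  \int[P]_w f (U w, V w) =
  \int[distribution P U]_u \int[distribution P V]_v f (u, v).
Proof.
move=> mf f0; rewrite -fubini_tonelli1 //.
pose UV' w : (E1 * E2)%type := (U w, V w).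
transitivity (integral (pushforward P UV') setT f).
  by rewrite ge0_integral_pushforward //; exact: measurable_pair.
apply: eq_measure_integral => [|? B mB _]; first exact: measurable_pair.
exact: indep_pair_distribution.
Qed.

Lemma ge0_integralM_indep (f : E1 -> \bar R) (g : E2 -> \bar R) :
  measurable_fun setT f -> (forall x, 0 <= f x) ->
  measurable_fun setT g -> (forall x, 0 <= g x) ->
  \int[P]_w (f (U w) * g (V w)) = \int[P]_w f (U w) * \int[P]_w g (V w).
Proof.
move=> mf f0 mg g0.
have mfg : measurable_fun setT (fun x : E1 * E2 => f x.1 * g x.2).
  by apply: emeasurable_funM; apply: measurableT_comp.
rewrite (@ge0_integral_indep (fun x => f x.1 * g x.2)) //; last first.
  by move=> x; rewrite mule_ge0.
transitivity (\int[distribution P U]_u (f u * \int[distribution P V]_v g v)).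
  by apply: eq_integral => u _; rewrite -ge0_integralZl.
rewrite ge0_integralZr //; last by rewrite integral_ge0.
by rewrite !ge0_integral_distribution.
Qed.

Lemma integralM_indep (f : E1 -> R) (g : E2 -> R) :
  measurable_fun setT f -> measurable_fun setT g ->
  P.-integrable setT (fun w => (f (U w))%:E) ->
  P.-integrable setT (fun w => (g (V w))%:E) ->
  P.-integrable setT (fun w => (f (U w) * g (V w))%:E) /\
  \int[P]_w (f (U w) * g (V w))%:E
    = \int[P]_w (f (U w))%:E * \int[P]_w (g (V w))%:E.
Proof.
move=> mf mg intf intg.
have mf' : measurable_fun setT (EFin \o f) by exact/measurable_EFinP.
have mg' : measurable_fun setT (EFin \o g) by exact/measurable_EFinP.
have mfg : measurable_fun setT (fun x : E1 * E2 => (f x.1 * g x.2)%:E).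
  by apply/measurable_EFinP; apply: measurable_funM; apply: measurableT_comp.
have mUV := measurable_pair.
have intfg : P.-integrable setT (fun w => (f (U w) * g (V w))%:E).
  apply/integrableP; split; first exact: (measurableT_comp mfg mUV).
  under eq_integral do rewrite /= normrM EFinM.
  move/integrableP : intf => [_ intf]; move/integrableP : intg => [_ intg].
  rewrite (@ge0_integralM_indep (fun x => `|f x|%:E) (fun x => `|g x|%:E)) //.
  - by rewrite lte_mul_pinfty // ?integral_ge0 // ge0_fin_numE // integral_ge0.
  - by apply/measurable_EFinP; exact: measurableT_comp.
  - by apply/measurable_EFinP; exact: measurableT_comp.
split=> //.
have intm : (distribution P U \x distribution P V).-integrable setT
    (fun x => (f x.1 * g x.2)%:E).
  apply/integrableP; split=> //; move/integrableP: intfg => [_].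
  rewrite (@ge0_integral_indep (fun x => `|(f x.1 * g x.2)%:E|)) //.
    by rewrite fubini_tonelli1 //; exact: measurableT_comp.
  exact: measurableT_comp.
pose UV' w : (E1 * E2)%type := (U w, V w).
transitivity (integral (pushforward P UV') setT (fun x => (f x.1 * g x.2)%:E)).
  by rewrite integral_pushforward.
transitivity (\int[distribution P U \x distribution P V]_x (f x.1 * g x.2)%:E).
  apply: eq_measure_integral => B mB _.
  exact: indep_pair_distribution.
rewrite -integral12_prod_meas1 // /fubini_F /=.
have gD : (distribution P V).-integrable setT (EFin \o g).
  exact: (@integrable_pushforward _ _ _ _ _ V).
have fD : (distribution P U).-integrable setT (EFin \o f).
  exact: (@integrable_pushforward _ _ _ _ _ U).
have gfin : \int[distribution P V]_y (g y)%:E \is a fin_num.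
  exact: integrable_fin_num.
transitivity (\int[distribution P U]_u
    ((f u)%:E * (fine (\int[distribution P V]_v (g v)%:E))%:E)).
  apply: eq_integral => u _; rewrite fineK // -integralZl //.
rewrite integralZr //= fineK //.
by rewrite (@integral_distribution _ _ _ _ _ _ U (EFin \o f)) //
  (@integral_distribution _ _ _ _ _ _ V (EFin \o g)).
Qed.

End Pair.

Section Sums.
Variables (n : nat) (Z : 'I_n -> {mfun T >-> R}).
Hypothesis indepZ : mutually_independent P (fun i => rv_salgebra (Z i)).

Lemma mutually_independent_preimage (B : 'I_n -> set R) :
  (forall i, measurable (B i)) ->
  P (\bigcap_(i in [set: 'I_n]) (Z i @^-1` B i))
    = (\prod_(i < n) P (Z i @^-1` B i))%E.
Proof.
by move=> mB; apply: indepZ => i; exists (B i) => //; rewrite setTI.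
Qed.

Definition partial_sum (l : nat) (w : T) : R := \sum_(i < n | (i < l)%N) Z i w.

Lemma measurable_partial_sum l : measurable_fun setT (partial_sum l).
Proof.
have -> : partial_sum l = fun w => \sum_(i < n) (if (i < l)%N then Z i w else 0).
  by apply/funext => w; rewrite /partial_sum big_mkcond.
by apply: measurable_sum => i; case: (i < l)%N; [exact: measurable_funP|exact: measurable_cst].
Qed.

Definition rv_partial_sum l : {mfun T >-> R} := rv_of (measurable_partial_sum l).

Lemma partial_sum0 w : partial_sum 0 w = 0.
Proof. by rewrite /partial_sum big_pred0. Qed.

Lemma partial_sum_size w : partial_sum n w = \sum_(i < n) Z i w.
Proof. by apply: eq_bigl => i; rewrite ltn_ord. Qed.

Lemma partial_sumS (i : 'I_n) w : partial_sum i.+1 w = partial_sum i w + Z i w.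
Proof.
rewrite /partial_sum (bigD1 i) //= addrC; congr (_ + _).
by apply: eq_bigl => j; rewrite ltnS [in RHS]ltn_neqAle andbC.
Qed.

Let measurable_bigcap (B : 'I_n -> set R) : (forall i, measurable (B i)) ->
  measurable (\bigcap_(i in [set: 'I_n]) (Z i @^-1` B i)).
Proof.
move=> mB; apply: fin_bigcap_measurable => // i _.
by rewrite -[X in measurable X]setTI; exact: measurable_funP.
Qed.

(** Mutual independence concerns events on single variables, so grouping them goes by induction:
    with index l of [B] free, an arbitrary event on Z_l is inserted there, the hypothesis at l makes
    the pair (S_l, Z_l) independent of the tail event, and S_{l+1} is a function of this pair. *)
Let partial_sum_indep_tail l (B : 'I_n -> set R) (C : set R) :
  (forall i, measurable (B i)) -> (forall i : 'I_n, (i < l)%N -> B i = setT) ->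
  measurable C ->
  P (partial_sum l @^-1` C `&` \bigcap_(i in [set: 'I_n]) (Z i @^-1` B i))
    = (P (partial_sum l @^-1` C)
       * P (\bigcap_(i in [set: 'I_n]) (Z i @^-1` B i)))%E.
Proof.
elim: l B C => [|l IH] B C mB BT mC.
  have [C0|C0] := pselect (C 0).
    have -> : partial_sum 0 @^-1` C = setT.
      by rewrite -subTset => w _ /=; rewrite partial_sum0.
    by rewrite setTI probability_setT mul1e.
  have -> : partial_sum 0 @^-1` C = set0.
    by rewrite -subset0 => w /=; rewrite partial_sum0.
  by rewrite set0I measure0 mul0e.
have [ln|nl] := ltnP l n; last first.
  have -> : partial_sum l.+1 = partial_sum l.
    apply/funext => w; apply: eq_bigl => i.
    by rewrite ltnS (leq_trans (ltn_ord i) nl) ltnW // (leq_trans (ltn_ord i) nl).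
  by apply: IH => // i il; apply: BT; rewrite ltnW.
pose i0 := Ordinal ln.
pose B' C' i := if i == i0 then C' else B i.
have mB' C' : measurable C' -> forall i, measurable (B' C' i).
  by move=> mC' i; rewrite /B'; case: ifP.
have capB' C' : \bigcap_(i in [set: 'I_n]) (Z i @^-1` B' C' i) =
    Z i0 @^-1` C' `&` \bigcap_(i in [set: 'I_n]) (Z i @^-1` B i).
  apply/seteqP; split => [w cap|w [C'w cap] i _ /=].
    split; first by have := cap i0 I; rewrite /B' eqxx.
    move=> i _; have := cap i I; rewrite /B' /=; case: eqP => // -> _.
    by rewrite BT.
  by rewrite /B'; case: eqP => [->//|_]; exact: cap.
have PB' C' : measurable C' ->
    P (Z i0 @^-1` C' `&` \bigcap_(i in [set: 'I_n]) (Z i @^-1` B i)) =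
    (P (Z i0 @^-1` C') * P (\bigcap_(i in [set: 'I_n]) (Z i @^-1` B i)))%E.
  move=> mC'; rewrite -capB' !mutually_independent_preimage //; last exact: mB'.
  rewrite (bigD1 i0) //= [in RHS](bigD1 i0) //= /B' eqxx BT // preimage_setT.
  rewrite probability_setT mul1e; congr (_ * _)%E.
  by apply: eq_bigr => i /negPf ->.
have mE : measurable [set x : R * R | C (x.1 + x.2)].
  rewrite -[X in measurable X]setTI.
  exact: (measurable_funD (@measurable_fst _ _ _ _) (@measurable_snd _ _ _ _)).
have sumE A : partial_sum l.+1 @^-1` C `&` A =
    (fun w => (rv_partial_sum l w, Z i0 w)) @^-1` [set x : R * R | C (x.1 + x.2)] `&` A.
  by congr (_ `&` _); apply/funext => w /=; rewrite (partial_sumS i0).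
rewrite sumE (@indep_pair_law _ _ _ _ (rv_partial_sum l)) //; first last.
- move=> D C' mD mC'; rewrite -setIA -capB' IH //; first by rewrite capB' PB'.
    exact: mB'.
  move=> i il; rewrite /B'; case: eqP => [ii0|_]; last by apply: BT; rewrite ltnW.
  by move: il; rewrite ii0 ltnn.
- exact: measurable_bigcap.
(* A second use, with the trivial tail event, identifies the product law of {x + y in C} with the
   law of the partial sum. *)
congr (_ * _)%E; rewrite -[in RHS](setIT (_ @^-1` _)) sumE.
rewrite (@indep_pair_law _ _ _ _ (rv_partial_sum l)) // ?probability_setT ?mule1 //.
move=> D C' mD mC'; rewrite setIT mule1.
pose BT' C' i := if i == i0 then C' else [set: R].
have capBT : \bigcap_(i in [set: 'I_n]) (Z i @^-1` BT' C' i) = Z i0 @^-1` C'.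
  apply/seteqP; split => [w cap|w C'w i _ /=].
    by have := cap i0 I; rewrite /BT' eqxx.
  by rewrite /BT'; case: eqP => [->//|_].
rewrite -capBT -IH // => i; rewrite /BT'; first by case: ifP.
by case: eqP => // ->; rewrite ltnn.
Qed.

Lemma partial_sum_indep (i : 'I_n) :
  independent2 P (rv_salgebra (rv_partial_sum i)) (rv_salgebra (Z i)).
Proof.
apply/independent2P => C D mC mD.
pose B j := if j == i then D else [set: R].
have capB : \bigcap_(j in [set: 'I_n]) (Z j @^-1` B j) = Z i @^-1` D.
  apply/seteqP; split => [w cap|w Dw j _ /=].
    by have := cap i I; rewrite /B eqxx.
  by rewrite /B; case: eqP => [->//|_].
rewrite -capB partial_sum_indep_tail // => j; rewrite /B; first by case: ifP.
by case: eqP => // ->; rewrite ltnn.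
Qed.

End Sums.

End Independence.

(** * Complex moment generating functions *)

Section EqualLaws.
Context {d1 d2 d' : measure_display} {T1 : measurableType d1}
  {T2 : measurableType d2} {E : measurableType d'} {R : realType}.
Variables (P1 : {measure set T1 -> \bar R}) (P2 : {measure set T2 -> \bar R}).
Variables (U1 : T1 -> E) (U2 : T2 -> E).
Hypotheses (mU1 : measurable_fun setT U1) (mU2 : measurable_fun setT U2).
Hypothesis law : forall B, measurable B -> P1 (U1 @^-1` B) = P2 (U2 @^-1` B).
Local Open Scope ereal_scope.

Lemma eq_law_ge0_integral (f : E -> \bar R) :
  measurable_fun setT f -> (forall x, 0 <= f x) ->
  \int[P1]_w f (U1 w) = \int[P2]_w f (U2 w).
Proof.
move=> mf f0.
transitivity (\int[pushforward P1 U1]_x f x).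
  by rewrite ge0_integral_pushforward.
transitivity (\int[pushforward P2 U2]_x f x).
  by apply: eq_measure_integral => B mB _; exact: law.
by rewrite ge0_integral_pushforward.
Qed.

Lemma eq_law_integral (f : E -> \bar R) : measurable_fun setT f ->
  \int[P1]_w f (U1 w) = \int[P2]_w f (U2 w).
Proof.
move=> mf; rewrite integralE [RHS]integralE; congr (_ - _).
  rewrite (funepos_comp f U1) (funepos_comp f U2).
  by rewrite (@eq_law_ge0_integral (f^\+)) //; exact: measurable_funepos.
rewrite (funeneg_comp f U1) (funeneg_comp f U2).
by rewrite (@eq_law_ge0_integral (f^\-)) //; exact: measurable_funeneg.
Qed.

Lemma eq_law_integrable (f : E -> \bar R) : measurable_fun setT f ->
  P1.-integrable setT (fun w => f (U1 w)) ->
  P2.-integrable setT (fun w => f (U2 w)).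
Proof.
move=> mf /integrableP[_ fi]; apply/integrableP; split.
  exact: (measurableT_comp mf mU2).
rewrite -(@eq_law_ge0_integral (fun x => `|f x|)) //.
exact: measurableT_comp.
Qed.

End EqualLaws.

Section Cmgf.
Context {d : measure_display} {T : measurableType d} {R : realType}.
Variable P : probability T R.
Implicit Types (U V : T -> R) (z : R[i]) (a x : R).

Lemma cexpZ z x : cexp (z * x%:C) =
  (expR (Re z * x) * cos (Im z * x)) +i* (expR (Re z * x) * sin (Im z * x)).
Proof.
by case: z => a b; rewrite /cexp /= !mulr0 subr0 add0r.
Qed.

Lemma measurable_Re_cexp z : measurable_fun setT (fun x : R => Re (cexp (z * x%:C))).
Proof.
under eq_fun do rewrite cexpZ /=.
apply: measurable_funM.
  by apply: measurableT_comp => //; exact: measurable_funM.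
apply: measurableT_comp; last exact: measurable_funM.
by apply: continuous_measurable_fun; exact: continuous_cos.
Qed.

Lemma measurable_Im_cexp z : measurable_fun setT (fun x : R => Im (cexp (z * x%:C))).
Proof.
under eq_fun do rewrite cexpZ /=.
apply: measurable_funM.
  by apply: measurableT_comp => //; exact: measurable_funM.
apply: measurableT_comp; last exact: measurable_funM.
by apply: continuous_measurable_fun; exact: continuous_sin.
Qed.

Lemma measurable_expRM a : measurable_fun setT (fun x : R => expR (a * x)).
Proof. by apply: measurableT_comp => //; exact: measurable_funM. Qed.

Lemma Re_cexp_le z x : `|Re (cexp (z * x%:C))| <= expR (Re z * x).
Proof.
rewrite cexpZ /= normrM (ger0_norm (expR_ge0 _)) ler_piMr ?expR_ge0 //.
exact: cos_max.
Qed.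

Lemma Im_cexp_le z x : `|Im (cexp (z * x%:C))| <= expR (Re z * x).
Proof.
rewrite cexpZ /= normrM (ger0_norm (expR_ge0 _)) ler_piMr ?expR_ge0 //.
exact: sin_max.
Qed.

Definition exp_integrable U a : Prop :=
  P.-integrable setT (fun w => (expR (a * U w))%:E).

(** E e^{zU}, taken coordinatewise. Real-valued integrals take a default value when the extended one
    is infinite, so [exp_integrable U (Re z)] accompanies most uses. *)
Definition cmgf U z : R[i] :=
  (\int[P]_w Re (cexp (z * (U w)%:C))) +i* (\int[P]_w Im (cexp (z * (U w)%:C))).

Section Integrability.
Variables (U : T -> R) (z : R[i]).
Hypotheses (mU : measurable_fun setT U) (eU : exp_integrable U (Re z)).

Lemma integrable_Re_cexp :
  P.-integrable setT (fun w => (Re (cexp (z * (U w)%:C)))%:E).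
Proof.
apply: le_integrable eU => //.
  by apply/measurable_EFinP; exact: (measurableT_comp (measurable_Re_cexp z)).
by move=> w _ /=; rewrite lee_fin (ger0_norm (expR_ge0 _)) Re_cexp_le.
Qed.

Lemma integrable_Im_cexp :
  P.-integrable setT (fun w => (Im (cexp (z * (U w)%:C)))%:E).
Proof.
apply: le_integrable eU => //.
  by apply/measurable_EFinP; exact: (measurableT_comp (measurable_Im_cexp z)).
by move=> w _ /=; rewrite lee_fin (ger0_norm (expR_ge0 _)) Im_cexp_le.
Qed.

End Integrability.

Lemma cmgf_real U a : cmgf U a%:C = (\int[P]_w expR (a * U w))%:C.
Proof.
rewrite /cmgf -complexr0; congr (_ +i* _).
  by apply: eq_Rintegral => w _; rewrite cexpZ /= mul0r cos0 mulr1.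
rewrite (@eq_Rintegral _ _ _ _ _ (fun=> 0)); first by rewrite Rintegral_cst // mul0r.
by move=> w _; rewrite cexpZ /= mul0r sin0 mulr0.
Qed.

Lemma cmgf0 z : cmgf (cst 0) z = 1.
Proof.
rewrite /cmgf -[RHS]/(1 +i* 0); congr (_ +i* _).
  rewrite (@eq_Rintegral _ _ _ _ _ (fun=> 1)).
    by rewrite Rintegral_cst // mul1r [X in fine X](@probability_setT _ _ _ P).
  by move=> w _; rewrite cexpZ !mulr0 /= expR0 cos0 mulr1.
rewrite (@eq_Rintegral _ _ _ _ _ (fun=> 0)); first by rewrite Rintegral_cst // mul0r.
by move=> w _; rewrite cexpZ !mulr0 /= sin0 mulr0.
Qed.

Lemma cmgf_shift U c z : measurable_fun setT U -> exp_integrable U (Re z) ->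
  cmgf (fun w => U w + c) z = cexp (z * c%:C) * cmgf U z.
Proof.
move=> mU eU; have iR := integrable_Re_cexp mU eU; have iI := integrable_Im_cexp mU eU.
have zE w : cexp (z * (U w + c)%:C) = cexp (z * c%:C) * cexp (z * (U w)%:C).
  by rewrite rmorphD mulrDr addrC cexpD.
rewrite /cmgf; case cE : (cexp (z * c%:C)) => [u v].
rewrite mulcE; congr (_ +i* _).
- rewrite -RintegralZl // -RintegralZl // -RintegralB //.
  + by apply: eq_Rintegral => w _; rewrite zE cE; case: (cexp _).
  + exact: (integrableZl measurableT _ iR).
  + exact: (integrableZl measurableT _ iI).
- rewrite -RintegralZl // -RintegralZl // -RintegralD //.
  + by apply: eq_Rintegral => w _; rewrite zE cE; case: (cexp _) => * /=.
  + exact: (integrableZl measurableT _ iI).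
  + exact: (integrableZl measurableT _ iR).
Qed.

Lemma cmgf_indep (U V : {mfun T >-> R}) z :
  independent2 P (rv_salgebra U) (rv_salgebra V) ->
  exp_integrable U (Re z) -> exp_integrable V (Re z) ->
  exp_integrable (fun w => U w + V w) (Re z) /\
  cmgf (fun w => U w + V w) z = cmgf U z * cmgf V z.
Proof.
move=> UV eU eV.
have mU : measurable_fun setT U by exact: measurable_funP.
have mV : measurable_fun setT V by exact: measurable_funP.
have mR := measurable_Re_cexp z; have mI := measurable_Im_cexp z.
have [iRU iIU] := (integrable_Re_cexp mU eU, integrable_Im_cexp mU eU).
have [iRV iIV] := (integrable_Re_cexp mV eV, integrable_Im_cexp mV eV).
have [iRR RR] := integralM_indep UV mR mR iRU iRV.
have [iRI RI] := integralM_indep UV mR mI iRU iIV.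
have [iIR IR] := integralM_indep UV mI mR iIU iRV.
have [iII II] := integralM_indep UV mI mI iIU iIV.
split.
  have me := measurable_expRM (Re z).
  have [+ _] := integralM_indep UV me me eU eV.
  by apply: eq_integrable => // w _ /=; rewrite -expRD -mulrDr.
cbv beta in RR, RI, IR, II, iRR, iRI, iIR, iII.
have fineM (f g : T -> R) : P.-integrable setT (EFin \o f) ->
    P.-integrable setT (EFin \o g) ->
    fine ((\int[P]_w (f w)%:E) * (\int[P]_w (g w)%:E))%E
      = (\int[P]_w f w) * (\int[P]_w g w).
  by move=> fi gi; rewrite fineM // integrable_fin_num.
have zE w : cexp (z * (U w + V w)%:C) = cexp (z * (U w)%:C) * cexp (z * (V w)%:C).
  by rewrite rmorphD mulrDr cexpD.
rewrite /cmgf mulcE; congr (_ +i* _).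
- rewrite -!fineM // -RR -II -RintegralB //.
  by apply: eq_Rintegral => w _; rewrite zE; case: (cexp _) (cexp _) => [? ?] [? ?].
- rewrite -!fineM // -RI -IR -RintegralD //.
  by apply: eq_Rintegral => w _; rewrite zE; case: (cexp _) (cexp _) => [? ?] [? ?].
Qed.

Section Sum.
Variables (n : nat) (Z : 'I_n -> {mfun T >-> R}).
Hypothesis indepZ : mutually_independent P (fun i => rv_salgebra (Z i)).

Lemma cmgf_sum z : (forall i, exp_integrable (Z i) (Re z)) ->
  exp_integrable (fun w => \sum_(i < n) Z i w) (Re z) /\
  cmgf (fun w => \sum_(i < n) Z i w) z = \prod_(i < n) cmgf (Z i) z.
Proof.
move=> eZ.
suff H l : (l <= n)%N -> exp_integrable (partial_sum Z l) (Re z) /\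
    cmgf (partial_sum Z l) z = \prod_(i < n | (i < l)%N) cmgf (Z i) z.
  have [e c] := H n (leqnn n).
  have sE : partial_sum Z n = fun w => \sum_(i < n) Z i w.
    by apply/funext => w; exact: partial_sum_size.
  by rewrite sE in e c; split => //; rewrite c; apply: eq_bigl => i; rewrite ltn_ord.
elim: l => [_|l IH ln].
  have -> : partial_sum Z 0 = cst 0 by apply/funext => w; exact: partial_sum0.
  split.
    rewrite /exp_integrable; under eq_fun do rewrite mulr0.
    exact: finite_measure_integrable_cst.
  by rewrite big_pred0 // cmgf0.
have [e c] := IH (ltnW ln); pose i := Ordinal ln.
have [] := cmgf_indep (@partial_sum_indep _ _ _ P _ _ indepZ i) e (eZ i).
have -> : (fun w => rv_partial_sum Z i w + Z i w) = partial_sum Z l.+1.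
  by apply/funext => w; rewrite -[l]/(val i) partial_sumS.
move=> eS cS; split=> //; rewrite cS c [in RHS](bigD1 i) //= mulrC; congr (_ * _).
by apply: eq_bigl => j; rewrite ltnS [in LHS]ltn_neqAle andbC.
Qed.

(** Stated in the extended reals and without integrability, in order to deduce exponential moments
    of the summands from those of the sum. *)
Lemma mgf_sum a :
  (\int[P]_w (expR (a * \sum_(i < n) Z i w))%:E
    = \prod_(i < n) \int[P]_w (expR (a * Z i w))%:E)%E.
Proof.
suff H l : (l <= n)%N -> (\int[P]_w (expR (a * partial_sum Z l w))%:E
    = \prod_(i < n | (i < l)%N) \int[P]_w (expR (a * Z i w))%:E)%E.
  have := H n (leqnn n).
  under eq_integral do rewrite partial_sum_size.
  by move=> ->; apply: eq_bigl => i; rewrite ltn_ord.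
elim: l => [_|l IH ln].
  under eq_integral do rewrite partial_sum0 mulr0 expR0.
  rewrite integral_cst // [X in (_ * X)%E](@probability_setT _ _ _ P).
  by rewrite mule1 big_pred0.
pose i := Ordinal ln.
have me : measurable_fun setT (fun x : R => (expR (a * x))%:E).
  by apply/measurable_EFinP; exact: measurable_expRM.
have e0 x : (0 <= (expR (a * x))%:E)%E by rewrite lee_fin expR_ge0.
have := ge0_integralM_indep (@partial_sum_indep _ _ _ P _ _ indepZ i) me e0 me e0.
under eq_integral do rewrite -EFinM -expRD -mulrDr -[_ + Z i _](partial_sumS Z i).
move=> ->; rewrite IH ?(ltnW ln) // [in RHS](bigD1 i) //= muleC; congr (_ * _)%E.
by apply: eq_bigl => j; rewrite ltnS [in LHS]ltn_neqAle andbC.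
Qed.

End Sum.

End Cmgf.

Section CmgfLaw.
Context {d1 d2 : measure_display} {T1 : measurableType d1}
  {T2 : measurableType d2} {R : realType}.
Variables (P1 : probability T1 R) (P2 : probability T2 R).
Variables (U1 : T1 -> R) (U2 : T2 -> R).
Hypotheses (mU1 : measurable_fun setT U1) (mU2 : measurable_fun setT U2).
Hypothesis law : forall B, measurable B -> P1 (U1 @^-1` B) = P2 (U2 @^-1` B).

Lemma eq_law_exp_integrable a :
  exp_integrable P1 U1 a -> exp_integrable P2 U2 a.
Proof.
apply: (eq_law_integrable mU1 mU2 law (f := fun x => (expR (a * x))%:E)).
by apply/measurable_EFinP; exact: measurable_expRM.
Qed.

Lemma eq_law_cmgf z : cmgf P1 U1 z = cmgf P2 U2 z.
Proof.
rewrite /cmgf /Rintegral.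
rewrite (eq_law_integral mU1 mU2 law (f := fun x => (Re (cexp (z * x%:C)))%:E)).
  rewrite (eq_law_integral mU1 mU2 law (f := fun x => (Im (cexp (z * x%:C)))%:E)) //.
  by apply/measurable_EFinP; exact: measurable_Im_cexp.
by apply/measurable_EFinP; exact: measurable_Re_cexp.
Qed.

End CmgfLaw.

(** * Lattice variables near an atom *)

Lemma int_ball_ord (k : int) (J : nat) : - J%:Z <= k -> k <= J%:Z ->
  exists i : 'I_J.*2.+1, k = i%:Z - J%:Z.
Proof.
move=> k1 k2; have ik : (absz (k + J%:Z)%R < J.*2.+1)%N by rewrite ltnS -addnn; lia.
by exists (Ordinal ik) => /=; lia.
Qed.

Section RealEstimates.
Context {R : realType}.
Implicit Types (x y t : R) (z : R[i]).

Definition cosh x : R := (expR x + expR (- x)) / 2.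

Lemma coshN x : cosh (- x) = cosh x.
Proof. by rewrite /cosh opprK addrC. Qed.

Lemma cosh_norm x : cosh `|x| = cosh x.
Proof. by case: (ger0P x) => // _; rewrite coshN. Qed.

Lemma cosh0 : cosh 0 = 1 :> R.
Proof. by rewrite /cosh oppr0 expR0; lra. Qed.

Lemma cosh_ge1 x : 1 <= cosh x.
Proof.
have uv : expR (x / 2) * expR (- (x / 2)) = 1 by rewrite -expRD subrr expR0.
have -> : cosh x = (expR (x / 2) ^+ 2 + expR (- (x / 2)) ^+ 2) / 2.
  by rewrite /cosh -!expRM_natl; congr ((expR _ + expR _) / 2); field.
by have := sqr_ge0 (expR (x / 2) - expR (- (x / 2))); nra.
Qed.

Lemma expR_norm_le_cosh x : expR `|x| <= 2 * cosh x.
Proof.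
rewrite -cosh_norm /cosh mulrC divfK // lerDl; exact: expR_ge0.
Qed.

(** cosh x - 1 = (u - v)^2 / 2 with u = e^{|x|/2} >= 3/2 and v = 1/u <= 2/3, hence at least 25/72.
    On nonzero integers this gap lets cosh - 1 dominate the indicator and all exponentials. *)
Lemma cosh_sub1_ge x : 1 <= `|x| -> 1 / 3 <= cosh x - 1.
Proof.
rewrite -cosh_norm; move: `|x| => {}x x1.
have uv : expR (x / 2) * expR (- (x / 2)) = 1 by rewrite -expRD subrr expR0.
have u32 : 3 / 2 <= expR (x / 2) by apply: le_trans (expR_ge1Dx _); lra.
have v0 := expR_gt0 (- (x / 2)).
have v23 : expR (- (x / 2)) <= 2 / 3 by nra.
have -> : cosh x = (expR (x / 2) ^+ 2 + expR (- (x / 2)) ^+ 2) / 2.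
  by rewrite /cosh -!expRM_natl; congr ((expR _ + expR _) / 2); field.
by nra.
Qed.

(** The logarithm is ln (1 + u) / 2 with u = 2 x + x^2 + y^2, and u - (8/3) u^2 <= ln (1 + u) <= u.
    Since |u| <= 5 t / 2, the error is at most (4/3) (25/4) t^2 = (25/3) t^2. *)
Lemma ln_normc_le x y t : `|x| <= t -> `|y| <= t -> t <= 1 / 4 ->
  `|ln (normc ((1 + x) +i* y)) - x| <= 9 * t ^+ 2.
Proof.
rewrite !ler_norml => /andP[x1 x2] /andP[y1 y2] t4.
pose u := 2 * x + x ^+ 2 + y ^+ 2.
have xt : x ^+ 2 <= t ^+ 2 by nra.
have yt : y ^+ 2 <= t ^+ 2 by nra.
have [x20 y20] := (sqr_ge0 x, sqr_ge0 y).
have u1 : 3 / 8 <= 1 + u by rewrite /u; nra.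
have S : normc ((1 + x) +i* y) ^+ 2 = 1 + u.
  by rewrite /normc sqr_sqrtr ?addr_ge0 ?sqr_ge0 //; rewrite /u; ring.
have n0 : 0 < normc ((1 + x) +i* y).
  by rewrite /normc sqrtr_gt0; move: S; rewrite /normc sqr_sqrtr ?addr_ge0 ?sqr_ge0 //; lra.
have L : ln (normc ((1 + x) +i* y)) = ln (1 + u) / 2.
  by rewrite -S lnXn // -mulr_natl; field.
have up : ln (1 + u) <= u by apply: le_ln1Dx; lra.
have lo : u / (1 + u) <= ln (1 + u).
  rewrite -lerN2 -lnV ?posrE; last by lra.
  have -> : ln (1 + u)^-1 = ln (1 + (- (u / (1 + u)))) by congr ln; field; lra.
  by apply: le_ln1Dx; rewrite ltrN2 ltr_pdivrMr; lra.
have lo2 : u - u ^+ 2 * (8 / 3) <= u / (1 + u).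
  rewrite ler_pdivlMr; last by lra.
  have : 0 <= u ^+ 2 * (1 + u - 3 / 8) by rewrite mulr_ge0 ?sqr_ge0 // subr_ge0.
  by move: u1; clearbody u => u1; nra.
have t0 : 0 <= t by lra.
have tt : t ^+ 2 <= t / 4 by nra.
have uu : u ^+ 2 <= (25 / 4) * t ^+ 2.
  have : 0 <= (5 / 2 * t - u) * (5 / 2 * t + u).
    by rewrite mulr_ge0 //; rewrite /u; lra.
  by clearbody u; nra.
have uE : u = 2 * x + x ^+ 2 + y ^+ 2 by [].
rewrite {}L; move: (ln (1 + u)) up lo => l up lo.
by apply/andP; split; lra.
Qed.

End RealEstimates.

Section PointwiseEstimates.
Context {R : realType}.
Implicit Types (x y t : R) (z : R[i]) (k : int).

Lemma expR_norm_le_cosh_sub1 x : 1 <= `|x| -> expR `|x| <= 8 * (cosh x - 1).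
Proof.
by move=> x1; have := cosh_sub1_ge x1; have := expR_norm_le_cosh x; lra.
Qed.

Lemma intr_norm_ge1 k : k != 0 -> 1 <= `|k%:~R : R|.
Proof. by move=> k0; rewrite -intr_norm -[1]/(1%:~R) ler_int -gtz0_ge1 normr_gt0. Qed.

Lemma norm_cexp_le_exp z th k : 0 <= th -> `|Re z| <= th ->
  `|Re (cexp (z * k%:~R%:C))| <= expR (th * `|k%:~R|) /\
  `|Im (cexp (z * k%:~R%:C))| <= expR (th * `|k%:~R|).
Proof.
move=> th0 zth; have e : expR (Re z * k%:~R) <= expR (th * `|k%:~R|).
  rewrite ler_expR; apply: le_trans (ler_norm _) _.
  by rewrite normrM ler_wpM2r.
by split; [apply: le_trans (Re_cexp_le _ _) _|apply: le_trans (Im_cexp_le _ _) _].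
Qed.

(** Integrality of k is the point: both sides vanish at k = 0, and otherwise |th k| >= 1, so e^{th
    |k|} and 1 are each at most 8 (cosh (th k) - 1). *)
Lemma cexp_sub1_le z th k : 1 <= th -> `|Re z| <= th ->
  `|Re (cexp (z * k%:~R%:C)) - 1| <= 16 * (cosh (th * k%:~R) - 1) /\
  `|Im (cexp (z * k%:~R%:C))| <= 16 * (cosh (th * k%:~R) - 1).
Proof.
move=> th1 zth; have [->|k0] := eqVneq k 0.
  rewrite !mulr0 cexp0 cosh0 /= subrr normr0; lra.
have th0 : 0 <= th by lra.
have [eR eI] := norm_cexp_le_exp k th0 zth.
have k1 := intr_norm_ge1 k0.
have thk : 1 <= `|th * k%:~R| by rewrite normrM (ger0_norm th0); nra.
have := expR_norm_le_cosh_sub1 thk; rewrite normrM (ger0_norm th0) => le8.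
have e1 : 1 <= expR (th * `|k%:~R|) by rewrite -expR0 ler_expR mulr_ge0.
split; last by lra.
by apply: le_trans (ler_normB _ _) _; rewrite normr1; lra.
Qed.

(** A Chernoff bound: for |k| > J, passing from e^{th0 |k|} to e^{th |k|} gains the factor e^{- (th
    - th0) J}. *)
Lemma cexp_tail_le z th0 th k (J : nat) : 1 <= th0 -> th0 <= th -> `|Re z| <= th0 ->
  J%:R < `|k%:~R : R| ->
  `|Re (cexp (z * k%:~R%:C)) - 1|
    <= 16 * expR (- ((th - th0) * J%:R)) * (cosh (th * k%:~R) - 1).
Proof.
move=> th1 th0th zth Jk.
have k0 : k != 0.
  by apply/eqP => k0; move: Jk; rewrite k0 normr0 ltNge ler0n.
have th00 : 0 <= th0 by lra.
have [eR _] := norm_cexp_le_exp k th00 zth.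
have k1 := intr_norm_ge1 k0.
have thk : 1 <= `|th * k%:~R| by rewrite normrM (@ger0_norm _ th) //; nra.
have := expR_norm_le_cosh_sub1 thk; rewrite normrM (@ger0_norm _ th); last by lra.
move=> le8.
have e1 : 1 <= expR (th0 * `|k%:~R|) by rewrite -expR0 ler_expR mulr_ge0.
have split_e : expR (th0 * `|k%:~R|) <=
    expR (- ((th - th0) * J%:R)) * expR (th * `|k%:~R|).
  by rewrite -expRD ler_expR; nra.
apply: le_trans (ler_normB _ _) _; rewrite normr1.
have := ler_wpM2l (expR_ge0 (- ((th - th0) * J%:R))) le8.
lra.
Qed.

End PointwiseEstimates.

Section LatticeEstimate.
Context {d : measure_display} {T : measurableType d} {R : realType}.
Variables (P : probability T R) (V : T -> R).
Hypotheses (mV : measurable_fun setT V)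
  (intV : forall w, exists k : int, V w = k%:~R)
  (eV : forall a, exp_integrable P V a).

Lemma Rintegral_sum (I : Type) (s : seq I) (f : I -> T -> R) :
  (forall i, P.-integrable setT (fun w => (f i w)%:E)) ->
  \int[P]_w (\sum_(i <- s) f i w) = \sum_(i <- s) \int[P]_w f i w.
Proof.
move=> fi; elim: s => [|i s IH].
  rewrite big_nil; under eq_Rintegral do rewrite big_nil.
  by rewrite Rintegral_cst // mul0r.
rewrite big_cons -IH; under eq_Rintegral do rewrite big_cons.
rewrite RintegralD //; first exact: fi.
have := integrable_sum measurableT s (P := predT) (h := fun i w => (f i w)%:E)
  (fun i _ => fi i).
by apply: eq_integrable => // w _ /=; rewrite sumEFin.
Qed.

Lemma integrable_cst (c : R) : P.-integrable setT (fun=> c%:E).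
Proof. exact: finite_measure_integrable_cst. Qed.

Lemma integrable_cosh th : P.-integrable setT (fun w => (cosh (th * V w))%:E).
Proof.
have := integrableZl measurableT (1 / 2) (integrableD measurableT (eV th) (eV (- th))).
by apply: eq_integrable => // w _ /=; rewrite /cosh mulNr -EFinD -EFinM; congr EFin; field.
Qed.

(** A symmetric measure of the distance of [V] to 0: for integer [V] it bounds both P (V != 0) and E
    e^{zV} - 1 on a strip, and it is of order 1/n for centered n-th convolution roots. *)
Definition cosh_excess th : R := \int[P]_w (cosh (th * V w) - 1).

Lemma integrable_cosh_sub1 th :
  P.-integrable setT (fun w => (cosh (th * V w) - 1)%:E).
Proof.
exact: (integrableB measurableT (integrable_cosh th) (integrable_cst 1)).
Qed.

Let Rintegral_le (f : T -> R) c th : P.-integrable setT (fun w => (f w)%:E) ->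
  (forall w, `|f w| <= c * (cosh (th * V w) - 1)) ->
  `|\int[P]_w f w| <= c * cosh_excess th.
Proof.
move=> fi fle; apply: le_trans (le_normr_Rintegral measurableT fi) _.
rewrite /cosh_excess -RintegralZl //; last exact: integrable_cosh_sub1.
apply: le_Rintegral => //; first exact: integrable_norm.
by have := integrableZl measurableT c (integrable_cosh_sub1 th).
Qed.

Lemma cmgf_sub1_le z th : 1 <= th -> `|Re z| <= th ->
  `|Re (cmgf P V z) - 1| <= 16 * cosh_excess th /\
  `|Im (cmgf P V z)| <= 16 * cosh_excess th.
Proof.
move=> th1 zth; have iR := integrable_Re_cexp mV (eV (Re z)).
have iI := integrable_Im_cexp mV (eV (Re z)).
split.
  have -> : Re (cmgf P V z) - 1 = \int[P]_w (Re (cexp (z * (V w)%:C)) - 1).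
    rewrite RintegralB //; last exact: integrable_cst.
    by rewrite Rintegral_cst // [X in fine X](@probability_setT _ _ _ P) mulr1.
  apply: Rintegral_le; first exact: (integrableB measurableT iR (integrable_cst 1)).
  by move=> w; have [k ->] := intV w; exact: (cexp_sub1_le k th1 zth).1.
apply: Rintegral_le => // w.
by have [k ->] := intV w; exact: (cexp_sub1_le k th1 zth).2.
Qed.

(** The numbers n P (V = j) play the role of a Levy measure. Two errors add up: t = 16 b0 / n <= 1/4
    bounds the coordinates of E e^{zV} - 1, so replacing the logarithm by Re (E e^{zV} - 1) costs n
    times 9 t^2, which is 2304 b0^2 / n; dropping the atoms beyond [J] costs the second term. *)
Lemma lattice_estimate z th0 th (J n : nat) b0 b1 :
  1 <= th0 -> th0 <= th -> `|Re z| <= th0 -> (0 < n)%N ->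
  n%:R * cosh_excess th0 <= b0 -> n%:R * cosh_excess th <= b1 ->
  64 * b0 <= n%:R ->
  `|n%:R * ln (normc (cmgf P V z))
    - \sum_(i < J.*2.+1) n%:R * fine (P (V @^-1` [set i%:R - J%:R]))
        * (Re (cexp (z * (i%:R - J%:R)%:C)) - 1)|
  <= 2304 * b0 ^+ 2 / n%:R + 16 * expR (- ((th - th0) * J%:R)) * b1.
Proof.
move=> th1 th0th zth n0 b0P b1P nb.
have n0R : (0 : R) < n%:R by rewrite ltr0n.
pose x := Re (cmgf P V z) - 1.
have [hx hy] := cmgf_sub1_le th1 zth.
pose t := 16 * b0 / n%:R.
have ht : 16 * cosh_excess th0 <= t by rewrite /t ler_pdivlMr //; lra.
have t4 : t <= 1 / 4 by rewrite /t ler_pdivrMr //; lra.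
have := ln_normc_le (le_trans hx ht) (le_trans hy ht) t4.
have -> : (1 + (Re (cmgf P V z) - 1)) +i* Im (cmgf P V z) = cmgf P V z.
  by case: (cmgf P V z) => a b /=; congr (_ +i* _); ring.
rewrite -/x => lnx.
pose ph y := Re (cexp (z * y%:C)) - 1.
pose e (i : 'I_J.*2.+1) : R := i%:R - J%:R.
have mE i : measurable (V @^-1` [set e i]).
  by rewrite -[X in measurable X]setTI; apply: mV.
have iR := integrable_Re_cexp mV (eV (Re z)).
have iph : P.-integrable setT (fun w => (ph (V w))%:E).
  exact: (integrableB measurableT iR (integrable_cst 1)).
have iind i : P.-integrable setT (fun w => (ph (e i) * \1_(V @^-1` [set e i]) w)%:E).
  by have := integrableZl measurableT (ph (e i)) (integrable_indic P (mE i)).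
have xE : x = \int[P]_w ph (V w).
  rewrite /ph RintegralB //; last exact: integrable_cst.
  by rewrite Rintegral_cst // [X in fine X](@probability_setT _ _ _ P) mulr1.
have tailE : x - \sum_i fine (P (V @^-1` [set e i])) * ph (e i) =
    \int[P]_w (ph (V w) - \sum_i ph (e i) * \1_(V @^-1` [set e i]) w).
  rewrite RintegralB //; last first.
    have := integrable_sum measurableT (index_enum 'I_J.*2.+1) (P := predT)
      (h := fun i w => (ph (e i) * \1_(V @^-1` [set e i]) w)%:E) (fun i _ => iind i).
    by apply: eq_integrable => // w _ /=; rewrite sumEFin.
  rewrite xE Rintegral_sum //; congr (_ - _); apply: eq_bigr => i _.
  rewrite RintegralZl //; last exact: integrable_indic.
  by rewrite mulrC; congr (_ * _); rewrite /Rintegral integral_indic // setIT.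
have tail : `|x - \sum_i fine (P (V @^-1` [set e i])) * ph (e i)|
    <= 16 * expR (- ((th - th0) * J%:R)) * cosh_excess th.
  rewrite tailE; apply: Rintegral_le.
    have := integrable_sum measurableT (index_enum 'I_J.*2.+1) (P := predT)
      (h := fun i w => (ph (e i) * \1_(V @^-1` [set e i]) w)%:E) (fun i _ => iind i).
    move=> /(integrableB measurableT iph).
    by apply: eq_integrable => // w _ /=; rewrite sumEFin.
  move=> w; have [k Vk] := intV w.
  (* Beyond [J] every indicator vanishes and the tail bound applies; within [J] exactly one
     indicator is 1 and the difference is zero. *)
  have [Jk|kJ] := ltP J%:R `|k%:~R : R|.
    rewrite big1 ?subr0; last first.
      move=> i _; rewrite indicE; case: (boolP (w \in _)); last by rewrite mulr0.
      rewrite inE /= Vk => ki; move: Jk; rewrite ki /e ltNge.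
      have i2J : (i%:R : R) <= J%:R + J%:R.
        by rewrite -natrD addnn ler_nat -ltnS ltn_ord.
      by case/negP; rewrite ler_norml; have := ler0n R i; lra.
    by rewrite Vk; exact: cexp_tail_le.
  have [i iE] : exists i : 'I_J.*2.+1, V w = e i.
    move: kJ; rewrite ler_norml -[J%:R]/(J%:Z%:~R) -mulrNz !ler_int => /andP[k1 k2].
    have [i kE] := int_ball_ord k1 k2.
    by exists i; rewrite Vk kE /e intrB.
  rewrite (bigD1 i) //= big1 ?addr0; last first.
    move=> j ji; rewrite indicE; case: (boolP (w \in _)); last by rewrite mulr0.
    rewrite inE /= iE => /addIr/eqP; rewrite eqr_nat => /eqP ij.
    by move: ji; rewrite -(inj_eq val_inj) /= ij eqxx.
  rewrite indicE mem_set // mulr1 iE subrr normr0 !mulr_ge0 ?expR_ge0 //.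
  by rewrite subr_ge0 cosh_ge1.
have -> : \sum_(i < J.*2.+1) n%:R * fine (P (V @^-1` [set i%:R - J%:R]))
    * (Re (cexp (z * (i%:R - J%:R)%:C)) - 1)
    = n%:R * \sum_i fine (P (V @^-1` [set e i])) * ph (e i).
  by rewrite mulr_sumr; apply: eq_bigr => i _; rewrite mulrA.
set S := \sum_i _ in tail *.
have -> : n%:R * ln (normc (cmgf P V z)) - n%:R * S
    = n%:R * (ln (normc (cmgf P V z)) - x) + n%:R * (x - S) by ring.
apply: le_trans (ler_normD _ _) _; rewrite !normrM (ger0_norm (ler0n _ _)).
apply: lerD.
  apply: le_trans (ler_wpM2l (ler0n _ _) lnx) _.
  by rewrite le_eqVlt; apply/orP; left; apply/eqP; rewrite /t; field; rewrite gt_eqF.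
apply: le_trans (ler_wpM2l (ler0n _ _) tail) _.
by rewrite mulrCA ler_wpM2l // mulr_ge0 // expR_ge0.
Qed.

End LatticeEstimate.

(** * Convolution roots of an infinitely divisible lattice law *)

Section Centering.
Context {d : measure_display} {T : measurableType d} {R : realType}.
Variables (P : probability T R) (U : T -> R).
Hypotheses (mU : measurable_fun setT U)
  (intU : forall w, exists k : int, U w = k%:~R)
  (eU : forall a, exp_integrable P U a).

Let mgf a : R := \int[P]_w expR (a * U w).

(* [mgf a * mgf (- a)] is the moment generating function of the difference of
   two independent copies of [U]. *)
Let shifted_cosh th y : R :=
  (expR (- (th * y)) * mgf th + expR (th * y) * mgf (- th)) / 2.

Let shifted_coshE th y : \int[P]_w cosh (th * (U w - y)) = shifted_cosh th y.
Proof.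
have e1 := integrableZl measurableT (expR (- (th * y)) / 2) (eU th).
have e2 := integrableZl measurableT (expR (th * y) / 2) (eU (- th)).
transitivity (\int[P]_w (expR (- (th * y)) / 2 * expR (th * U w)
    + expR (th * y) / 2 * expR (- th * U w))).
  by apply: eq_Rintegral => w _; rewrite /cosh !mulrBr opprB !expRD mulNr; field.
rewrite RintegralD // RintegralZl ?RintegralZl //; first last.
- exact: eU.
- exact: eU.
- by rewrite -/(mgf th) -/(mgf (- th)) /shifted_cosh; field.
Qed.

Let integrable_shifted_cosh th :
  P.-integrable setT (fun w => (shifted_cosh th (U w))%:E).
Proof.
have e1 := integrableZl measurableT (mgf th / 2) (eU (- th)).
have e2 := integrableZl measurableT (mgf (- th) / 2) (eU th).
apply: eq_integrable (integrableD measurableT e1 e2) => // w _ /=.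
by rewrite /shifted_cosh mulNr -!EFinM -EFinD; congr EFin; field.
Qed.

Let Rintegral_shifted_cosh th :
  \int[P]_w shifted_cosh th (U w) = mgf th * mgf (- th).
Proof.
have e1 := integrableZl measurableT (mgf th / 2) (eU (- th)).
have e2 := integrableZl measurableT (mgf (- th) / 2) (eU th).
transitivity (\int[P]_w (mgf th / 2 * expR (- th * U w)
    + mgf (- th) / 2 * expR (th * U w))).
  by apply: eq_Rintegral => w _; rewrite /shifted_cosh mulNr; field.
rewrite RintegralD // RintegralZl ?RintegralZl //; first last.
- exact: eU.
- exact: eU.
- by rewrite -/(mgf th) -/(mgf (- th)); field.
Qed.

Let exp_integrable_shift y a : exp_integrable P (fun w => U w - y) a.
Proof.
have := integrableZl measurableT (expR (- (a * y))) (eU a).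
apply: eq_integrable => // w _ /=.
by rewrite -EFinM -expRD; congr ((expR _)%:E); ring.
Qed.

Let excessE th y : cosh_excess P (fun w => U w - y) th = shifted_cosh th y - 1.
Proof.
rewrite /cosh_excess RintegralB //; last exact: integrable_cst.
  by rewrite shifted_coshE Rintegral_cst // [X in fine X](@probability_setT _ _ _ P) mulr1.
by apply: integrable_cosh => // a; exact: exp_integrable_shift.
Qed.

Let shifted_cosh_ge1 th y : 1 <= shifted_cosh th y.
Proof.
rewrite -subr_ge0 -excessE; apply: Rintegral_ge0 => w _.
by rewrite subr_ge0 cosh_ge1.
Qed.

(* Averaging over [y = U] yields an integer [k] with [E (cosh (U - k)) <= 7/6],
   hence [P (U = k) >= 1/2]; averaging again over the event [U = k] bounds the
   excess around [k] for every [th]. *)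
Lemma exists_center : mgf 1 * mgf (- 1) <= 13 / 12 ->
  exists k : int, forall th, cosh_excess P (fun w => U w - k%:~R) th
    <= 2 * (mgf th * mgf (- th) - 1).
Proof.
move=> G1.
(* Otherwise the average over [U], at most 13/12, would be at least 7/6. *)
have [k Fk] : exists k : int, shifted_cosh 1 k%:~R <= 7 / 6.
  apply: contrapT => /forallNP H.
  have : \int[P]_w (7 / 6) <= \int[P]_w shifted_cosh 1 (U w).
    apply: le_Rintegral => //.
    - exact: integrable_cst.
    - exact: integrable_shifted_cosh.
    move=> w _; have [k ->] := intU w.
    by have /negP := H k; rewrite -ltNge => /ltW.
  rewrite Rintegral_shifted_cosh Rintegral_cst //.
  rewrite [X in fine X](@probability_setT _ _ _ P) mulr1; lra.
exists k => th; rewrite excessE.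
have mk : measurable (U @^-1` [set k%:~R]).
  by rewrite -[X in measurable X]setTI; apply: mU.
pose p : R := fine (P (U @^-1` [set k%:~R])).
have iind := integrable_indic P mk.
have RI : \int[P]_w \1_(U @^-1` [set k%:~R]) w = p.
  by rewrite /Rintegral integral_indic // setIT.
(* (1 - p) / 3 <= E cosh (U - k) - 1 <= 1/6, as U - k is an integer. *)
have p2 : 1 / 2 <= p.
  have H : \int[P]_w (1 / 3 * (1 - \1_(U @^-1` [set k%:~R]) w))
      <= \int[P]_w (cosh (1 * (U w - k%:~R)) - 1).
    apply: le_Rintegral => //.
    - exact: (integrableZl measurableT (1 / 3)
        (integrableB measurableT (integrable_cst P 1) iind)).
    - by apply: integrable_cosh_sub1 => // a; exact: exp_integrable_shift.
    - move=> w _; rewrite indicE; have [wk|/negP wk] := boolP (w \in _).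
        by rewrite subrr mulr0 subr_ge0 cosh_ge1.
      rewrite subr0 mulr1; apply: cosh_sub1_ge; rewrite mul1r.
      have [j Uj] := intU w; rewrite Uj -intrB; apply: intr_norm_ge1.
      by rewrite subr_eq0; apply/eqP => jk; apply: wk; rewrite inE /= Uj jk.
  have := excessE 1 k%:~R; rewrite /cosh_excess => E; move: H.
  rewrite E RintegralZl //; last first.
    exact: (integrableB measurableT (integrable_cst P 1) iind).
  rewrite RintegralB //; last exact: integrable_cst.
  rewrite RI Rintegral_cst // [X in fine X](@probability_setT _ _ _ P) mulr1; lra.
(* The average of a nonnegative excess dominates its part on {U = k}, of probability p >= 1/2; this
   is the factor 2 of the conclusion. *)
have H : \int[P]_w ((shifted_cosh th k%:~R - 1) * \1_(U @^-1` [set k%:~R]) w)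
    <= \int[P]_w (shifted_cosh th (U w) - 1).
  apply: le_Rintegral => //.
  - exact: (integrableZl measurableT _ iind).
  - exact: (integrableB measurableT (integrable_shifted_cosh th) (integrable_cst P 1)).
  - move=> w _; rewrite indicE; case: (boolP (w \in _)).
      by rewrite inE /= => ->; rewrite mulr1.
    by rewrite mulr0 subr_ge0 shifted_cosh_ge1.
move: H; rewrite RintegralZl // RI RintegralB //; last 2 first.
- exact: integrable_shifted_cosh.
- exact: integrable_cst.
rewrite Rintegral_shifted_cosh Rintegral_cst //.
rewrite [X in fine X](@probability_setT _ _ _ P).
rewrite mulr1; have := shifted_cosh_ge1 th k%:~R; nra.
Qed.

End Centering.

Section Lattice.
Context {R : realType}.

Definition integers : set R := range (fun k : int => k%:~R).

Lemma countable_integers : countable integers.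
Proof. exact: card_le_trans (card_image_le _ _) (countableP _). Qed.

Lemma measurable_countable_set (A : set R) : countable A -> measurable A.
Proof. by move=> cA; apply: countable_measurable => // t; exact: measurable_set1. Qed.

Lemma measurable_integers : measurable integers.
Proof. by apply: measurable_countable_set; exact: countable_integers. Qed.

Lemma integersB (x y : R) : integers x -> integers y -> integers (x - y).
Proof. by move=> [j _ <-] [k _ <-]; exists (j - k) => //; rewrite intrB. Qed.

End Lattice.

(** * Atoms of sums of independent variables *)

Section Atoms.
Context {d : measure_display} {T : measurableType d} {R : realType}.
Variable P : probability T R.

Lemma exists_integer_atom (X : T -> R) : measurable_fun setT X ->
  P (X @^-1` integers) = 1%E -> exists x, P (X @^-1` [set x]) != 0%E.
Proof.
move=> mX PX; apply: contrapT => /forallNP H.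
have X0 x : P.-negligible (X @^-1` [set x]).
  apply/negligibleP; first by rewrite -[X in measurable X]setTI; apply: mX.
  by apply/eqP/negPn/negP; exact: H.
have : P.-negligible (X @^-1` integers).
  have -> : integers = \bigcup_n ([set n%:R] `|` [set - n%:R : R]).
    apply/seteqP; split => [_ [k _ <-]|x [n _ [->|->]]].
    - exists (absz k) => //=; case: k => n; first by left.
      by right; rewrite NegzE mulrNz.
    - by exists n%:Z.
    - by exists (- n%:Z) => //; rewrite mulrNz.
  rewrite preimage_bigcup; apply: negligible_bigcup => n.
  by rewrite preimage_setU; apply: negligibleU; exact: X0.
have mP : measurable (X @^-1` integers).
  by rewrite -[X in measurable X]setTI; apply: mX => //; exact: measurable_integers.
by move=> /(negligibleP _ mP) P0; move: (etrans (esym PX) P0) => -[/eqP]; rewrite oner_eq0.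
Qed.

(** By Fubini, P (U + V = x) is the integral of P (V = x - u) over the law of [U], which vanishes if
    [V] has no atom. *)
Lemma indep_sum_atom (U V : {mfun T >-> R}) x :
  independent2 P (rv_salgebra U) (rv_salgebra V) ->
  P ((fun w => U w + V w) @^-1` [set x]) != 0%E ->
  exists v, P (V @^-1` [set v]) != 0%E.
Proof.
move=> UV Px; apply: contrapT => /forallNP H.
have V0 v : P (V @^-1` [set v]) = 0%E by apply/eqP/negPn/negP; exact: H.
move/eqP: Px; apply.
have mE : measurable [set y : R * R | y.1 + y.2 = x].
  rewrite -[X in measurable X]setTI.
  exact: (measurable_funD (@measurable_fst _ _ _ _) (@measurable_snd _ _ _ _)
    measurableT (measurable_set1 x)).
have := indep_pair_distribution UV mE.
rewrite [P _](_ : _ = P ((fun w => U w + V w) @^-1` [set x])) // => ->.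
rewrite /product_measure1 integral0_eq // => u _ /=.
rewrite (_ : xsection _ u = [set x - u]); first exact: V0.
apply/seteqP; split => [v|_ ->]; rewrite /xsection /= inE /=.
  by move=> <-; rewrite addrAC subrr add0r.
by rewrite addrC subrK.
Qed.

End Atoms.

Lemma probability_setI_full {d} {T : measurableType d} {R : realType}
    (P : probability T R) (A S : set T) :
  measurable S -> P S = 1%E -> measurable A -> P A = P (A `&` S).
Proof.
move=> mS PS mA; rewrite [LHS](measureDI P mA mS) [X in (X + _)%E](_ : _ = 0%E) ?add0e //.
apply/eqP; rewrite -measure_le0.
have <- : P (~` S) = 0%E by rewrite probability_setC // PS subee.
apply: le_measure; rewrite ?inE; [exact: measurableD|exact: measurableC|by move=> w []].
Qed.

Section Roots.
Context {d : measure_display} {T : measurableType d} {R : realType}.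
Variables (P : probability T R) (X : T -> R).
Hypotheses (mX : measurable_fun setT X)
  (intX : forall w, exists k : int, X w = k%:~R)
  (eX : forall a, exp_integrable P X a).

Section Summands.
Context {d' : measure_display} {T' : measurableType d'}.
Variables (Q : probability T' R) (n : nat) (Z : 'I_n.+1 -> {mfun T' >-> R}).
Hypotheses (indepZ : mutually_independent Q (fun i => rv_salgebra (Z i)))
  (lawZ : forall i j B, measurable B -> distribution Q (Z i) B = distribution Q (Z j) B)
  (lawX : forall B, measurable B ->
    P (X @^-1` B) = Q ((fun w => \sum_(i < n.+1) Z i w) @^-1` B)).

Let mZ i : measurable_fun setT (Z i). Proof. exact: measurable_funP. Qed.

Let mS : measurable_fun setT (fun w => \sum_(i < n.+1) Z i w).
Proof. by apply: measurable_sum. Qed.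

Let preimageZ i (B : set R) : measurable B -> measurable (Z i @^-1` B).
Proof. by move=> mB; rewrite -[X in measurable X]setTI; exact: mZ. Qed.

(** The n + 1 equal factors E e^{a Z_j} multiply to the finite E e^{aX}; were they infinite, so
    would be the product. *)
Lemma summand_exp_integrable i a : exp_integrable Q (Z i) a.
Proof.
have me : measurable_fun setT (fun x : R => (expR (a * x))%:E).
  by apply/measurable_EFinP; exact: measurable_expRM.
pose M := (\int[Q]_w (expR (a * Z ord0 w))%:E)%E.
have ME j : (\int[Q]_w (expR (a * Z j w))%:E = M)%E.
  by apply: (eq_law_integral (mZ j) (mZ ord0)) me => B mB; exact: lawZ.
have SE : (\int[Q]_w (expR (a * \sum_(i < n.+1) Z i w))%:E < +oo)%E.
  have /integrableP[_] := eq_law_exp_integrable mX mS lawX (eX a).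
  by under eq_integral do rewrite /= (ger0_norm (expR_ge0 _)).
apply/integrableP; split; first exact: (measurableT_comp me (mZ i)).
under eq_integral do rewrite /= (ger0_norm (expR_ge0 _)).
rewrite ME ltey; apply/eqP => My.
move: SE; rewrite (mgf_sum indepZ).
under eq_bigr do rewrite ME My.
rewrite big_const_ord ltey => /eqP; apply.
have iter_gt0 m : (0 < iter m ( *%E +oo) (1 : \bar R))%E.
  by elim: m => [|m IH] /=; rewrite ?lte01 // gt0_mulye.
by rewrite /= gt0_mulye.
Qed.

Lemma cmgf_summand z : cmgf P X z = cmgf Q (Z ord0) z ^+ n.+1.
Proof.
rewrite (eq_law_cmgf mX mS lawX z).
have [_ ->] := cmgf_sum indepZ (fun i => summand_exp_integrable i (Re z)).
rewrite -[in RHS](card_ord n.+1) -prodr_const; apply: eq_bigr => i _.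
by apply: (eq_law_cmgf (mZ i) (mZ ord0)) => B mB; exact: lawZ.
Qed.

Let sum_integer : Q ((fun w => \sum_(i < n.+1) Z i w) @^-1` integers) = 1%E.
Proof.
rewrite -lawX; last exact: measurable_integers.
rewrite (_ : _ @^-1` _ = setT) ?probability_setT // -subTset => w _ /=.
by have [k ->] := intX w; exists k.
Qed.

Lemma summand_atom : exists c, Q (Z ord0 @^-1` [set c]) != 0%E.
Proof.
have [x Qx] := exists_integer_atom mS sum_integer.
have [] := @indep_sum_atom _ _ _ Q (rv_partial_sum Z n) (Z ord_max) x.
- exact: (@partial_sum_indep _ _ _ Q _ _ indepZ ord_max).
- rewrite [X in X @^-1` _](_ : _ = fun w => \sum_(i < n.+1) Z i w) //.
  by apply/funext => w; rewrite -(partial_sum_size Z) (partial_sumS Z ord_max).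
move=> c Qc; exists c.
by rewrite -[Q _]/(distribution Q (Z ord0) [set c]) (lawZ _ ord_max).
Qed.

(** The other n summands all equal [c] with positive probability, independently of Z_0, so Z_0 + n c
    is almost surely an integer. As [c] is an atom of Z_0, c + n c is an integer as well, and the
    difference Z_0 - c is one. *)
Lemma summand_lattice c : Q (Z ord0 @^-1` [set c]) != 0%E ->
  Q (Z ord0 @^-1` [set x | integers (x - c)]) = 1%E.
Proof.
move=> Qc.
have mI : measurable (integers : set R) by exact: measurable_integers.
have mI' y : measurable [set x : R | integers (x - y)].
  rewrite -[X in measurable X]setTI.
  exact: (measurable_funB (@measurable_id _ _ setT) (measurable_cst y) measurableT mI).
pose D : set R := ~` [set x | integers (x - (- (n%:R * c)))].
have mD : measurable D by exact: measurableC.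
pose B (i : 'I_n.+1) := if i == ord0 then D else [set c].
have mB i : measurable (B i) by rewrite /B; case: ifP.
have QD : Q (Z ord0 @^-1` D) = 0%E.
  have : Q (\bigcap_(i in [set: 'I_n.+1]) (Z i @^-1` B i)) = 0%E.
    apply/eqP; rewrite -measure_le0.
    have <- : Q (~` ((fun w => \sum_(i < n.+1) Z i w) @^-1` integers)) = 0%E.
      rewrite probability_setC ?sum_integer ?subee //.
      by rewrite -[X in measurable X]setTI; exact: mS.
    apply: le_measure; rewrite ?inE.
    - by apply: fin_bigcap_measurable => // i _; exact: preimageZ.
    - by apply: measurableC; rewrite -[X in measurable X]setTI; exact: mS.
    move=> w cap /=; have := cap ord0 I; rewrite /B eqxx /D /= opprK => H.
    rewrite big_ord_recl (eq_bigr (fun=> c)); last first.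
      by move=> i _; have := cap (lift ord0 i) I; rewrite /B /= => ->.
    by rewrite sumr_const card_ord -mulr_natl.
  rewrite (mutually_independent_preimage indepZ) // big_ord_recl => /eqP.
  rewrite mule_eq0 => /orP[/eqP|/eqP P0]; first by rewrite /B eqxx.
  exfalso; move: P0; apply/eqP.
  rewrite gt_eqF //; elim/big_ind : _ => [|x y x0 y0|i _]; rewrite ?lte01 //.
    exact: mule_gt0.
  rewrite /B /= -[Q _]/(distribution Q _ _) (lawZ _ ord0) //.
  by rewrite lt0e Qc measure_ge0.
have nDc : ~ D c.
  move=> Dc; move/eqP: Qc; apply; apply/eqP; rewrite -measure_le0 -QD.
  by apply: le_measure; rewrite ?inE; [exact: preimageZ|exact: preimageZ|move=> w /= ->].
have := @probability_setC _ _ _ Q _ (preimageZ ord0 mD); rewrite QD sube0 => QCD.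
apply/eqP; rewrite eq_le probability_le1 /=; last exact: preimageZ.
rewrite -QCD; apply: le_measure; rewrite ?inE; try exact: preimageZ.
  by apply: measurableC; exact: preimageZ.
move=> w /contrapT /= H; move/contrapT : nDc => /= H0.
have := integersB H H0; congr integers; ring.
Qed.

End Summands.

(** [U] is the first summand minus an atom [c], reset to 0 on the null event where this is not an
    integer, so that integrality holds at every point. *)
Lemma infinitely_divisible_root (n : nat) : (0 < n)%N ->
  infinitely_divisible (pushforward P X) ->
  exists (d' : measure_display) (T' : measurableType d') (Q : probability T' R)
    (U : T' -> R) (c : R),
  [/\ measurable_fun setT U, forall w, exists k : int, U w = k%:~R,
      forall a, exp_integrable Q U a
    & forall z, cmgf P X z = (cexp (z * c%:C) * cmgf Q U z) ^+ n].
Proof.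
case: n => // n _ /(_ n.+1 isT) [d' [T' [Q [Z [indepZ lawZ lawX]]]]].
have [c Qc] := summand_atom indepZ lawZ lawX.
have Q1 := summand_lattice indepZ lawZ lawX Qc.
exists d', T', Q.
pose S : set R := [set x | integers (x - c)].
have mS : measurable S.
  rewrite -[X in measurable X]setTI.
  exact: (measurable_funB (@measurable_id _ _ setT) (measurable_cst c) measurableT
    measurable_integers).
pose r (x : R) := (x - c) * \1_S x.
have mr : measurable_fun setT r.
  by apply: measurable_funM; [exact: measurable_funB|exact: measurable_indic].
exists (r \o Z ord0), c.
have mU : measurable_fun setT (r \o Z ord0) by exact: measurableT_comp.
have mUc : measurable_fun setT (fun w => (r \o Z ord0) w + c) by exact: measurable_funD.
have mZS : measurable (Z ord0 @^-1` S).
  by rewrite -[X in measurable X]setTI; exact: measurable_funP.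
have rE w : S (Z ord0 w) -> (r \o Z ord0) w + c = Z ord0 w.
  by move=> Sw; rewrite /r /= indicE mem_set // mulr1 subrK.
have lawU B : measurable B ->
    Q (Z ord0 @^-1` B) = Q ((fun w => (r \o Z ord0) w + c) @^-1` B).
  move=> mB; rewrite (probability_setI_full mZS Q1); last first.
    by rewrite -[X in measurable X]setTI; exact: measurable_funP.
  rewrite [RHS](probability_setI_full mZS Q1); last first.
    by rewrite -[X in measurable X]setTI; exact: mUc.
  congr (Q _); apply/seteqP; split => w [Bw Sw]; split => //; move: Bw => /=.
    by rewrite rE.
  by rewrite rE.
have mZ : measurable_fun setT (Z ord0) by exact: measurable_funP.
have eUc a : exp_integrable Q (fun w => (r \o Z ord0) w + c) a.
  apply: (eq_law_exp_integrable mZ mUc lawU).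
  exact: (summand_exp_integrable indepZ lawZ lawX).
have eU a : exp_integrable Q (r \o Z ord0) a.
  have := integrableZl measurableT (expR (- (a * c))) (eUc a).
  apply: eq_integrable => // w _ /=.
  by rewrite -EFinM -expRD; congr ((expR _)%:E); ring.
split => // [w|z].
  rewrite /r /= indicE; case: (boolP (_ \in _)) => [|_].
    by rewrite inE /= => -[k _ <-]; exists k; rewrite mulr1.
  by exists 0; rewrite mulr0.
rewrite (cmgf_summand indepZ lawZ lawX); congr (_ ^+ _).
by rewrite (eq_law_cmgf mZ mUc lawU) cmgf_shift.
Qed.

End Roots.

Lemma expR_le1D2x (R : realType) (x : R) : 0 <= x -> x <= 1 / 2 -> expR x <= 1 + 2 * x.
Proof.
move=> x0 x2; have h : 1 - x <= expR (- x) by have := expR_ge1Dx (- x); lra.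
have := expR_gt0 (- x); rewrite -[expR x]invrK -expRN => e0.
by rewrite -[(expR (- x))^-1]mul1r ler_pdivrMr //; nra.
Qed.

Lemma exists_nat_ge (R : archiRealFieldType) (s : seq R) :
  exists2 n : nat, (0 < n)%N & forall x, x \in s -> x <= n%:R.
Proof.
elim: s => [|x s [n n0 nP]]; first by exists 1%N.
exists (maxn n (Num.bound `|x|)); first by rewrite leq_max n0.
move=> y; rewrite inE => /predU1P[->|/nP yn].
  apply: le_trans (ler_norm x) _; apply: le_trans (ltW (archi_boundP (normr_ge0 x))) _.
  by rewrite ler_nat leq_maxr.
by apply: le_trans yn _; rewrite ler_nat leq_maxl.
Qed.

(** * An approximate Levy-Khintchine formula with bounded support *)

Section LevyKhintchine.
Context {d : measure_display} {T : measurableType d} {R : realType}.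
Variables (P : probability T R) (X : T -> R) (C K : R).
Hypotheses (mX : measurable_fun setT X)
  (intX : forall w, exists k : int, X w = k%:~R)
  (eX : forall a, exp_integrable P X a)
  (C0 : 0 <= C)
  (mgf_le : forall th, 0 <= th ->
    (\int[P]_w expR (th * X w)) * (\int[P]_w expR (- th * X w))
      <= expR (C * expR (K * th)))
  (idX : infinitely_divisible (pushforward P X)).

Let B th : R := C * expR (K * th).

Let B0 th : 0 <= B th. Proof. by rewrite mulr_ge0 ?expR_ge0. Qed.

(** The product E e^{th X} E e^{- th X} ignores shifts, so its n-th root bounds the same product for
    the uncentered root: at most e^{B/n} <= 1 + 2 B/n. At th = 1 the condition 24 B <= n makes this
    13/12, as [exists_center] requires; the excess is then at most twice 2 B/n. *)
Lemma exists_centered_root (n : nat) : (0 < n)%N -> 24 * B 1 <= n%:R ->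
  exists (d' : measure_display) (T' : measurableType d') (Q : probability T' R)
    (V : T' -> R) (c : R),
  [/\ measurable_fun setT V, forall w, exists k : int, V w = k%:~R,
      forall a, exp_integrable Q V a,
      forall z, cmgf P X z = (cexp (z * c%:C) * cmgf Q V z) ^+ n
    & forall th, 0 <= th -> 2 * B th <= n%:R ->
        n%:R * cosh_excess Q V th <= 4 * B th].
Proof.
move=> n0 nB.
have [d' [T' [Q [U [c [mU intU eU cmgfU]]]]]] :=
  infinitely_divisible_root mX intX eX n0 idX.
pose mgf a : R := \int[Q]_w expR (a * U w).
have n0R : (0 : R) < n%:R by rewrite ltr0n.
have mgf_ge0 a : 0 <= mgf a by apply: Rintegral_ge0 => w _; exact: expR_ge0.
have mgfX a : \int[P]_w expR (a * X w) = (expR (a * c) * mgf a) ^+ n.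
  have := cmgfU a%:C; rewrite !cmgf_real -rmorphM cexp_real -rmorphM -rmorphXn.
  by case.
have G_le th : 0 <= th -> mgf th * mgf (- th) <= expR (B th / n%:R).
  move=> th0; rewrite -(@ler_pXn2r _ n) ?nnegrE ?expR_ge0 ?mulr_ge0 //.
  have -> : expR (B th / n%:R) ^+ n = expR (B th).
    by rewrite -expRM_natr divfK // gt_eqF.
  have := mgf_le th0; rewrite !mgfX -exprMn mulrACA -expRD mulNr subrr expR0.
  by rewrite mul1r.
have G_le2 th : 0 <= th -> 2 * B th <= n%:R ->
    mgf th * mgf (- th) <= 1 + 2 * (B th / n%:R).
  move=> th0 Bn; apply: le_trans (G_le _ th0) (expR_le1D2x _ _).
    by rewrite divr_ge0.
  by rewrite ler_pdivrMr //; lra.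
have [|k kP] := exists_center mU intU eU.
  apply: le_trans (G_le2 1 _ _) _ => //; first by have := B0 1; lra.
  have : B 1 / n%:R <= 1 / 24 by rewrite ler_pdivrMr //; lra.
  lra.
exists d', T', Q, (fun w => U w - k%:~R), (c + k%:~R); split.
- exact: measurable_funB.
- by move=> w; have [j ->] := intU w; exists (j - k); rewrite intrB.
- move=> a; have := integrableZl measurableT (expR (- (a * k%:~R))) (eU a).
  apply: eq_integrable => // w _ /=.
  by rewrite -EFinM -expRD; congr ((expR _)%:E); ring.
- move=> z; rewrite cmgfU (@cmgf_shift _ _ _ _ U (- k%:~R)) //.
  rewrite mulrA -cexpD -mulrDr -rmorphD /=; congr ((cexp (_ * _%:C) * _) ^+ _).
  ring.
- move=> th th0 Bn; have := kP th; have := G_le2 th th0 Bn.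
  move=> h1 h2; have : cosh_excess Q (fun w => U w - k%:~R) th <= 4 * B th / n%:R.
    rewrite -[4 * B th / _]mulrA; move: h1 h2; set q := B th / n%:R.
    by rewrite -/(mgf th) -/(mgf (- th)) => h1 h2; lra.
  by rewrite ler_pdivlMr // mulrC.
Qed.

(* The [n]-th convolution roots [V] satisfy [n E (cosh (th V) - 1) <= 4 C e^{K th}].
   Choosing [J >= K + 1] and [th] large makes the contribution of [|V| > J]
   negligible, uniformly in [n]; then [n] large makes
   [n ln (E e^{zV})] close to [n (E e^{zV} - 1)]. *)
Lemma approximate_levy_khintchine : exists J : nat, forall th0 e : R, 0 < e ->
  exists (r : R) (p : nat -> R), forall z, `|Re z| <= th0 ->
  `|ln (normc (cmgf P X z)) - (r * Re z
      + \sum_(i < J.*2.+1) p i * (Re (cexp (z * (i%:R - J%:R)%:C)) - 1))| <= e.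
Proof.
have [J JK] : exists J : nat, K + 1 <= J%:R.
  exists (Num.bound (`|K| + 1)); apply: le_trans (ltW (archi_boundP _)).
    by rewrite lerD2r ler_norm.
  by rewrite addr_ge0.
exists J => th0' e e0.
pose th0 := 1 + `|th0'|.
have th01 : 1 <= th0 by rewrite lerDl.
pose E0 := expR (th0 * J%:R).
(* As J - K >= 1, the tail term is at most 64 C E0 e^{- th}, and e^{th} >= 1 + th >= 128 C E0 / e
   makes it at most e / 2. *)
pose th := th0 + 128 * C * E0 / e.
have th0th : th0 <= th by rewrite lerDl divr_ge0 ?(ltW e0) // !mulr_ge0 ?expR_ge0.
pose b0 := 4 * B th0; pose b1 := 4 * B th.
have b00 : 0 <= b0 by rewrite mulr_ge0.
have tail_le : 16 * expR (- ((th - th0) * J%:R)) * b1 <= e / 2.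
  have -> : 16 * expR (- ((th - th0) * J%:R)) * b1 =
      64 * C * (E0 * expR ((K - J%:R) * th)).
    rewrite /b1 /B /E0 -expRD.
    transitivity (64 * C * (expR (- ((th - th0) * J%:R)) * expR (K * th))); first by ring.
    by rewrite -expRD; congr (_ * expR _); ring.
  have h1 : expR ((K - J%:R) * th) <= expR (- th) by rewrite ler_expR; nra.
  have h2 : 128 * C * E0 / e <= expR th.
    by apply: le_trans (expR_ge1Dx _); rewrite /th; lra.
  have h3 : 128 * C * E0 * expR (- th) <= e.
    by move: h2; rewrite expRN ler_pdivrMr // [_ * (expR th)^-1]/(_ / _) ler_pdivrMr ?expR_gt0 // [e * _]mulrC.
  have CE : 0 <= C * E0 by rewrite mulr_ge0 ?expR_ge0.
  have := ler_wpM2l CE h1; rewrite -!mulrA in h3 *; lra.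
have [n [n0 [nB1 nB0 [nB nb0 nbb]]]] : exists n : nat, [/\ (0 < n)%N,
    24 * B 1 <= n%:R, 2 * B th0 <= n%:R &
    [/\ 2 * B th <= n%:R, 64 * b0 <= n%:R & 2304 * b0 ^+ 2 / n%:R <= e / 2]].
  have [n n0 nP] := exists_nat_ge [:: 24 * B 1; 2 * B th0; 2 * B th; 64 * b0;
    4608 * b0 ^+ 2 / e].
  have n0R : (0 : R) < n%:R by rewrite ltr0n.
  exists n; split; [by []|by apply: nP; rewrite !inE eqxx ?orbT..|].
  split; [by apply: nP; rewrite !inE eqxx ?orbT..|].
  have : 4608 * b0 ^+ 2 / e <= n%:R by apply: nP; rewrite !inE eqxx ?orbT.
  rewrite !ler_pdivrMr //; lra.
have [d' [T' [Q [V [c [mV intV eV cmgfV exV]]]]]] := exists_centered_root n0 nB1.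
exists (n%:R * c), (fun i => n%:R * fine (Q (V @^-1` [set i%:R - J%:R]))) => z zth.
have zth0 : `|Re z| <= th0 by rewrite /th0; have := ler_norm th0'; lra.
have ex0 := exV th0 (le_trans ler01 th01) nB0.
have ex1 := exV th (le_trans ler01 (le_trans th01 th0th)) nB.
have est := @lattice_estimate _ _ _ Q V mV intV eV z th0 th J n _ _ th01 th0th zth0 n0 ex0 ex1 nb0.
(* The excess is at most 1/64, so Re (E e^{zV}) is within 1/4 of 1; the logarithm of the n-th power
   is then n times the logarithm. *)
have Vn0 : 0 < normc (cmgf Q V z).
  apply: lt_le_trans (Re_le_normc _).
  have [h _] := cmgf_sub1_le mV intV eV th01 zth0.
  have n0R : (0 : R) < n%:R by rewrite ltr0n.
  have h2 : cosh_excess Q V th0 <= 1 / 64.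
    by rewrite -(ler_pM2l n0R); apply: le_trans ex0 _; rewrite -/b0; lra.
  by rewrite normr_gt0; apply/eqP => Re0; move: h; rewrite Re0 sub0r normrN normr1; lra.
have -> : ln (normc (cmgf P X z)) = n%:R * c * Re z + n%:R * ln (normc (cmgf Q V z)).
  rewrite cmgfV normcX normcM normc_cexp lnXn; last by rewrite mulr_gt0 ?expR_gt0.
  rewrite lnM ?posrE ?expR_gt0 // expRK -mulr_natl.
  by case: z {zth zth0 est Vn0} => a b /=; ring.
rewrite opprD addrACA subrr add0r; apply: le_trans est _.
by rewrite -/b0 -/b1; lra.
Qed.

End LevyKhintchine.

(** * Skellam processes *)

Section DiscreteExpectation.
Context {d : measure_display} {T : measurableType d} {R : realType}.
Variables (P : probability T R) (N : T -> nat).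
Hypothesis mN : measurable_fun setT N.

Let F n := N @^-1` [set n].

Let mF n : measurable (F n).
Proof. by rewrite /F -[X in measurable X]setTI; exact: mN. Qed.

Let tF : trivIset setT F.
Proof. by apply/trivIsetP => i j _ _ ij; rewrite -subset0 => w [/= Fi Fj]; move: ij; rewrite -Fi -Fj eqxx. Qed.

Let UF : \bigcup_n F n = setT.
Proof. by rewrite -subTset => w _; exists (N w). Qed.

Let integralF (psi : nat -> R) n :
  (\int[P]_(w in F n) (psi (N w))%:E = (psi n)%:E * P (F n))%E.
Proof.
rewrite -integral_cst //; apply: eq_integral => w; rewrite inE => wn.
by congr (psi _)%:E.
Qed.

Lemma ge0_integral_nat (psi : nat -> R) : (forall n, 0 <= psi n) ->
  (\int[P]_w (psi (N w))%:E = \sum_(0 <= n <oo) (psi n)%:E * P (N @^-1` [set n]))%E.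
Proof.
move=> psi0; rewrite -[in LHS]UF ge0_integral_bigcup //.
- by apply: eq_eseriesr => n _; exact: integralF.
- apply/measurable_EFinP; rewrite UF.
  exact: (measurableT_comp (f := psi)).
- by move=> w _; rewrite lee_fin.
Qed.

Lemma integral_nat (psi : nat -> R) :
  P.-integrable setT (fun w => (psi (N w))%:E) ->
  (\int[P]_w (psi (N w))%:E = \sum_(0 <= n <oo) (psi n)%:E * P (N @^-1` [set n]))%E.
Proof.
move=> ipsi; rewrite -[in LHS]UF integral_bigcup //; last by rewrite UF.
by apply: eq_eseriesr => n _; exact: integralF.
Qed.

End DiscreteExpectation.

Section Poisson.
Context {d : measure_display} {T : measurableType d} {R : realType}.
Variables (P : probability T R) (N : T -> nat) (rate : R).
Hypotheses (mN : measurable_fun setT N) (rate0 : 0 < rate)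
  (lawN : forall n, P (N @^-1` [set n]) = (poisson_pmf rate n)%:E).

Implicit Type z : R[i].

Let U w : R := (N w)%:R.

Lemma Re_realM (x : R) (w : R[i]) : Re (x%:C * w) = x * Re w.
Proof. by case: w => a b /=; rewrite mul0r subr0. Qed.

Lemma Im_realM (x : R) (w : R[i]) : Im (x%:C * w) = x * Im w.
Proof. by case: w => a b /=; rewrite mul0r addr0. Qed.

Let cexp_nat z (n : nat) : cexp (z * n%:R%:C) = cexp z ^+ n.
Proof. by rewrite rmorph_nat mulr_natr cexpMn. Qed.

Let lim_eseries (x : nat -> R) (l : R) :
  series x @ \oo --> l -> (\sum_(0 <= n <oo) (x n)%:E = l%:E)%E.
Proof.
move=> xl; apply/cvg_lim => //.
have -> : (fun n => \sum_(0 <= i < n) (x i)%:E)%E = EFin \o series x.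
  by apply/funext => n /=; rewrite sumEFin.
by apply: cvg_EFin => //; exact: nearW.
Qed.

Let scale_series (c : R) (x : nat -> R) (l : R) :
  series x @ \oo --> l -> series (fun n => c * x n) @ \oo --> c * l.
Proof.
move=> xl; rewrite (_ : series _ = fun n => c * series x n).
  by apply: cvgM => //; exact: cvg_cst.
by apply/funext => n; rewrite /series /= mulr_sumr.
Qed.

Let pmf_Re z n : Re (cexp (z * n%:R%:C)) * poisson_pmf rate n
  = expR (- rate) * (Re ((rate%:C * cexp z) ^+ n) / n`!%:R).
Proof.
rewrite /poisson_pmf rate0 cexp_nat exprMn -rmorphXn Re_realM; ring.
Qed.

Let pmf_Im z n : Im (cexp (z * n%:R%:C)) * poisson_pmf rate n
  = expR (- rate) * (Im ((rate%:C * cexp z) ^+ n) / n`!%:R).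
Proof.
rewrite /poisson_pmf rate0 cexp_nat exprMn -rmorphXn Im_realM; ring.
Qed.

Let cexp_poisson z : cexp (rate%:C * (cexp z - 1))
  = (expR (- rate))%:C * cexp (rate%:C * cexp z).
Proof. by rewrite mulrBr mulr1 addrC cexpD -rmorphN cexp_real. Qed.

Let eseries_Re z :
  (\sum_(0 <= n <oo) (Re (cexp (z * n%:R%:C)))%:E * P (N @^-1` [set n])
    = (Re (cexp (rate%:C * (cexp z - 1))))%:E)%E.
Proof.
rewrite cexp_poisson Re_realM; under eq_eseriesr do rewrite lawN -EFinM pmf_Re.
apply: lim_eseries; apply: scale_series.
exact: (cvg_cexp_series (rate%:C * cexp z)).1.
Qed.

Let eseries_Im z :
  (\sum_(0 <= n <oo) (Im (cexp (z * n%:R%:C)))%:E * P (N @^-1` [set n])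
    = (Im (cexp (rate%:C * (cexp z - 1))))%:E)%E.
Proof.
rewrite cexp_poisson Im_realM; under eq_eseriesr do rewrite lawN -EFinM pmf_Im.
apply: lim_eseries; apply: scale_series.
exact: (cvg_cexp_series (rate%:C * cexp z)).2.
Qed.

Let mU : measurable_fun setT U.
Proof. exact: (measurableT_comp (f := fun n : nat => n%:R : R)). Qed.

(** At real argument the terms are nonnegative, and the series for E e^{zU} has a finite sum. *)
Lemma poisson_exp_integrable a : exp_integrable P U a.
Proof.
have eE n : Re (cexp (a%:C * n%:R%:C)) = expR (a * n%:R).
  by rewrite -rmorphM cexp_real.
apply/integrableP; split.
  by apply/measurable_EFinP; exact: (measurableT_comp (measurable_expRM a)).
under eq_integral do rewrite /= (ger0_norm (expR_ge0 _)).
rewrite (@ge0_integral_nat _ _ _ P _ mN (fun n => expR (a * n%:R))) //.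
by under eq_eseriesr do rewrite -eE; rewrite eseries_Re ltry.
Qed.

Lemma poisson_cmgf z : cmgf P U z = cexp (rate%:C * (cexp z - 1)).
Proof.
have eU := poisson_exp_integrable (Re z).
rewrite /cmgf /Rintegral.
rewrite (@integral_nat _ _ _ P _ mN (fun n => Re (cexp (z * n%:R%:C)))); last first.
  exact: integrable_Re_cexp.
rewrite (@integral_nat _ _ _ P _ mN (fun n => Im (cexp (z * n%:R%:C)))); last first.
  exact: integrable_Im_cexp.
by rewrite eseries_Re eseries_Im; case: (cexp (_ * (_ - _))) => ? ?.
Qed.

End Poisson.

Section Scale.
Context {d : measure_display} {T : measurableType d} {R : realType}.
Variable P : probability T R.

Lemma cmgf_scale (U : T -> R) c z :
  cmgf P (fun w => c * U w) z = cmgf P U (z * c%:C).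
Proof.
by rewrite /cmgf; congr (_ +i* _); apply: eq_Rintegral => w _; rewrite rmorphM mulrA.
Qed.

Lemma exp_integrable_scale (U : T -> R) c a :
  exp_integrable P U (a * c) -> exp_integrable P (fun w => c * U w) a.
Proof. by apply: eq_integrable => // w _ /=; rewrite mulrA. Qed.

End Scale.

Section GeneralizedCounting.
Context {d : measure_display} {T : measurableType d} {R : realType}.
Variable P : probability T R.

(** The Laplace exponent of the generalized counting process, in the variable w = e^z. *)
Definition jump_exponent (k : nat) (lam : 'I_k -> R) (w : R[i]) : R[i] :=
  \sum_(j < k) (lam j)%:C * (w ^+ j.+1 - 1).

Lemma gcp_cmgf (k : nat) (lam : 'I_k -> R) (M : R -> T -> nat) t :
  (forall j, 0 < lam j) -> generalized_counting_process P lam M -> 0 < t ->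
  forall z, exp_integrable P (fun w => (M t w)%:R) (Re z) /\
    cmgf P (fun w => (M t w)%:R) z = cexp (t%:C * jump_exponent lam (cexp z)).
Proof.
move=> lam0 [cM [d' [T' [P' [N [pN indepN law]]]]]] t0 z.
have t0' := ltW t0.
have mM : measurable_fun setT (M t) by exact: (counting_measurable cM).
have mN j : measurable_fun setT (N j t).
  exact: (counting_measurable (poisson_counting (pN j))).
have natR d0 (T0 : measurableType d0) (V : T0 -> nat) :
    measurable_fun setT V -> measurable_fun setT (fun w => (V w)%:R : R).
  by move=> mV; exact: (measurableT_comp (f := fun n : nat => n%:R : R)).
have mZ (j : 'I_k) : measurable_fun setT (fun w : T' => j.+1%:R * (N j t w)%:R : R).
  by apply: measurable_funM => //; exact: natR.
pose Z (j : 'I_k) : {mfun T' >-> R} := rv_of (mZ j).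
have indepZ : mutually_independent P' (fun j => rv_salgebra (Z j)).
  move=> A AZ; apply: indepN => j; apply: sub_gen_smallest.
  exists t => //; have [B mB <-] := AZ j.
  by exists [set n : nat | B (j.+1%:R * n%:R)].
have lawS B : measurable B ->
    P ((fun w => (M t w)%:R : R) @^-1` B) = P' ((fun w => \sum_(j < k) Z j w) @^-1` B).
  move=> mB; have := law 1%N (fun=> t) (fun=> [set n : nat | B n%:R]) (fun=> t0') (fun=> I).
  have capI (d0 : measure_display) (T0 : measurableType d0) (A : set T0) :
    \bigcap_(i in [set: 'I_1]) A = A by rewrite bigcap_const //; exists ord0.
  rewrite !capI /preimage /= => ->; congr (P' _); apply/funext => w /=.
  congr B; rewrite natr_sum; apply: eq_bigr => j _; by rewrite natrM.
have lawN j n : P' (N j t @^-1` [set n]) = (poisson_pmf (lam j * t) n)%:E.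
  have := poisson_increments (pN j) n (lexx 0) t0.
  rewrite subr0 => <-; congr (P' _); apply/funext => w /=.
  by rewrite (counting0 (poisson_counting (pN j))) subn0.
have lt0 j : 0 < lam j * t by rewrite mulr_gt0.
have eZ j : exp_integrable P' (Z j) (Re z).
  by apply: exp_integrable_scale; exact: (poisson_exp_integrable (mN j) (lt0 j) (lawN j)).
have cZ j : cmgf P' (Z j) z = cexp ((lam j * t)%:C * (cexp z ^+ j.+1 - 1)).
  rewrite cmgf_scale (poisson_cmgf (mN j) (lt0 j) (lawN j)).
  by rewrite rmorph_nat mulr_natr cexpMn.
have [eS cS] := cmgf_sum indepZ eZ.
have mS : measurable_fun setT (fun w => \sum_(j < k) Z j w).
  by apply: measurable_sum => j; exact: measurable_funP.
have mMR := natR _ _ _ mM.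
split.
  by apply: (eq_law_exp_integrable mS mMR) eS => B mB; rewrite lawS.
rewrite (eq_law_cmgf mMR mS lawS) cS /jump_exponent mulr_sumr cexp_sum.
by apply: eq_bigr => j _; rewrite cZ rmorphM mulrA [t%:C * _]mulrC.
Qed.

End GeneralizedCounting.

Section Skellam.
Context {d : measure_display} {T : measurableType d} {R : realType}.
Variables (P : probability T R) (k : nat) (lam mu : 'I_k -> R) (S : R -> T -> R).
Hypotheses (lam0 : forall j, 0 < lam j) (mu0 : forall j, 0 < mu j)
  (gS : generalized_skellam_process P lam mu S).

Definition skellam_exponent (w : R[i]) : R[i] :=
  jump_exponent lam w + jump_exponent mu w^-1.

Lemma skellam_measurable t : 0 <= t -> measurable_fun setT (S t).
Proof.
move=> t0; have [M1 [M2 [[c1 _] [c2 _] _ SE]]] := gS.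
have -> : S t = fun w => (M1 t w)%:R - (M2 t w)%:R.
  by apply/funext => w; rewrite SE.
by apply: measurable_funB; apply: (measurableT_comp (f := fun n : nat => n%:R : R)) => //;
  [exact: (counting_measurable c1)|exact: (counting_measurable c2)].
Qed.

Lemma skellam_integer t w : 0 <= t -> exists k : int, S t w = k%:~R.
Proof.
move=> t0; have [M1 [M2 [_ _ _ SE]]] := gS.
by exists ((M1 t w)%:Z - (M2 t w)%:Z); rewrite SE // intrB.
Qed.

(** Right continuity into a discrete space. It is the path property behind the joint measurability
    of [S] in time and chance. *)
Lemma skellam_right_constant w t : 0 <= t -> \forall s \near t^'+, S s w = S t w.
Proof.
move=> t0; have [M1 [M2 [[c1 _] [c2 _] _ SE]]] := gS.
have r1 := @counting_right_continuous _ _ _ _ c1 w t t0.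
have r2 := @counting_right_continuous _ _ _ _ c2 w t t0.
have n1 : nbhs (M1 t w) [set M1 t w] by exact: discrete_set1.
have n2 : nbhs (M2 t w) [set M2 t w] by exact: discrete_set1.
near=> s.
have s0 : 0 <= s by apply: le_trans t0 _; near: s; exact: nbhs_right_ge.
rewrite !SE //; congr (_%:R - _%:R).
  by near: s; exact: (r1 _ n1).
by near: s; exact: (r2 _ n2).
Unshelve. all: by end_near. Qed.

Lemma skellam_cmgf t z : 0 <= t ->
  exp_integrable P (S t) (Re z) /\
  cmgf P (S t) z = cexp (t%:C * skellam_exponent (cexp z)).
Proof.
have [M1 [M2 [g1 g2 indep SE]]] := gS.
rewrite le_eqVlt => /predU1P[<-|t0].
  have S0 : S 0 = cst 0.
    have [[c1 _] [c2 _]] := (g1, g2).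
    by apply/funext => w; rewrite SE // (counting0 c1) (counting0 c2) subrr.
  rewrite S0 mul0r cexp0; split.
    rewrite /exp_integrable; under eq_fun do rewrite mulr0.
    exact: integrable_cst.
  exact: cmgf0.
have [e1 C1] := gcp_cmgf lam0 g1 t0 z.
have [e2 C2] := gcp_cmgf mu0 g2 t0 (- z).
have [[c1 _] [c2 _]] := (g1, g2); have t0' := ltW t0.
have m1 : measurable_fun setT (fun w => (M1 t w)%:R : R).
  apply: (measurableT_comp (f := fun n : nat => n%:R : R)) => //.
  exact: (counting_measurable c1).
have m2 : measurable_fun setT (fun w => -1 * (M2 t w)%:R : R).
  apply: (measurableT_comp (f := fun n : nat => -1 * n%:R : R)) => //.
  exact: (counting_measurable c2).
have U12 : independent2 P (rv_salgebra (rv_of m1)) (rv_salgebra (rv_of m2)).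
  move=> A B [A' mA <-] [B' mB <-]; apply: indep; apply: sub_gen_smallest; exists t => //.
    by exists [set n : nat | A' n%:R].
  by exists [set n : nat | B' (-1 * n%:R)].
have e2' : exp_integrable P (rv_of m2) (Re z).
  apply: exp_integrable_scale; rewrite mulrN1.
  by move: e2; case: (z).
have [] := cmgf_indep U12 e1 e2'.
have -> : (fun w => rv_of m1 w + rv_of m2 w) = S t.
  by apply/funext => w; rewrite SE //= mulN1r.
move=> eS ->; split=> //; rewrite C1 /rv_of /= cmgf_scale.
have -> : z * (-1)%:C = - z by rewrite rmorphN rmorph1 mulrN1.
by rewrite C2 -cexpD -mulrDr cexpN.
Qed.

End Skellam.

(** * The inverse stable subordinator *)

(** The grid point lies strictly to the right of x, as limits from the right demand, even when x is
    itself on the grid. *)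
Lemma grid_right (R : archiRealFieldType) (x : R) (n : nat) : 0 <= x ->
  let y := (Num.truncn (x * n.+1%:R)).+1%:R / n.+1%:R in
  x < y /\ y <= x + n.+1%:R^-1.
Proof.
move=> x0 /=; have n0 : (0 : R) < n.+1%:R by rewrite ltr0n.
have /truncn_itv/andP[h1 h2] : 0 <= x * n.+1%:R by rewrite mulr_ge0 // ltW.
split; first by rewrite ltr_pdivlMr.
rewrite ler_pdivrMr // mulrDl mulVf ?gt_eqF // -natr1 lerD2r.
exact: h1.
Qed.

Section Subordinator.
Context {d : measure_display} {T : measurableType d} {R : realType}.
Variables (P : probability T R) (alpha t : R) (D : R -> T -> R).
Hypotheses (alpha0 : 0 < alpha) (alpha1 : alpha < 1)
  (sD : stable_subordinator P alpha D) (t0 : 0 < t).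

Local Notation Y := (inverse_subordinator D t).

Let mD x : 0 <= x -> measurable_fun setT (D x).
Proof. exact: (levy_measurable (subordinator_levy sD)). Qed.

Let D_le w x y : 0 <= x -> x <= y -> D x w <= D y w.
Proof. exact: subordinator_nondecreasing sD w x y. Qed.

Let passage w : set R := [set x | 0 <= x /\ t < D x w].

Let passage_lb w : lbound (passage w) 0. Proof. by move=> x []. Qed.

Lemma inverse_subordinator_ge0 w : 0 <= Y w.
Proof.
rewrite /inverse_subordinator -/(passage w).
have [->|E0] := eqVneq (passage w) set0; first by rewrite inf0.
by apply: lb_le_inf; [exact/set0P|exact: passage_lb].
Qed.

Lemma subordinator_before_inverse x w : 0 <= x -> x < Y w -> D x w <= t.
Proof.
move=> x0 xY; rewrite leNgt; apply/negP => tD.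
have := ge_inf (ex_intro _ 0 (@passage_lb w)) (conj x0 tD : passage w x).
by rewrite leNgt xY.
Qed.

Lemma inverse_subordinator_le x w : 0 <= x -> t < D x w -> Y w <= x.
Proof.
by move=> x0 tD; exact: (ge_inf (ex_intro _ 0 (@passage_lb w)) (conj x0 tD : passage w x)).
Qed.

(** Expresses {Y < y} by countably many events on [D]: monotonicity moves a passage point to a grid
    point still below y, and the second alternative is the absence of passage, where the infimum is
    0. *)
Let inverse_lt y w : 0 < y -> Y w < y <->
  (exists n k : nat, k%:R / n.+1%:R < y /\ t < D (k%:R / n.+1%:R) w) \/
  (forall n : nat, D n%:R w <= t).
Proof.
move=> y0; split.
  have [E0 _|/set0P E0 Yy] := eqVneq (passage w) set0.
    right=> n; rewrite leNgt; apply/negP => tD.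
    by have : passage w n%:R by []; rewrite E0.
  have [x [x0 tD] xy] := inf_lt E0 Yy.
  have [n nxy] : exists n : nat, n.+1%:R^-1 < y - x.
    exists (Num.bound (y - x)^-1); rewrite invf_plt ?posrE ?subr_gt0 //.
    apply: lt_le_trans (archi_boundP _) _; last by rewrite ler_nat.
    by rewrite invr_ge0 subr_ge0 ltW.
  have [xg gx] := grid_right n x0.
  left; exists n, (Num.truncn (x * n.+1%:R)).+1; split.
    by apply: le_lt_trans gx _; rewrite -ltrBrDl.
  by apply: lt_le_trans tD _; apply: D_le => //; exact: ltW.
move=> [[n [k [ky tD]]]|H].
  by apply: le_lt_trans ky; apply: inverse_subordinator_le.
rewrite /inverse_subordinator -/(passage w).
suff -> : passage w = set0 by rewrite inf0.
rewrite -subset0 => x [x0 tD]; have := H (Num.bound x); rewrite leNgt => /negP; apply.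
by apply: lt_le_trans tD _; apply: D_le => //; apply: ltW; exact: archi_boundP.
Qed.

Lemma measurable_inverse_subordinator : measurable_fun setT Y.
Proof.
move=> mT; apply: (measurability _ (RGenInftyO.measurableE R)) => //.
move=> _ [_ [y ->] <-]; rewrite setTI.
have [y0|y0] := ltP 0 y; last first.
  rewrite (_ : _ @^-1` _ = set0) // -subset0 => w /=; rewrite in_itv /=.
  by rewrite ltNge (le_trans y0 (inverse_subordinator_ge0 w)).
have mset x : 0 <= x -> measurable [set w | t < D x w].
  move=> x0; rewrite (_ : mkset _ = D x @^-1` `]t, +oo[%classic).
    by rewrite -[X in measurable X]setTI; apply: mD.
  by apply/seteqP; split => w /=; rewrite in_itv /= andbT.
rewrite (_ : _ @^-1` _ =
  (\bigcup_n \bigcup_(k in [set k : nat | (k%:R / n.+1%:R : R) < y])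
      [set w | t < D (k%:R / n.+1%:R) w])
  `|` \bigcap_n ~` [set w | t < D n%:R w]).
  apply: measurableU.
    by apply: bigcup_measurable => n _; apply: bigcup_measurable => k _; apply: mset.
  by apply: bigcapT_measurable => n; apply: measurableC; apply: mset.
apply/seteqP; split => w /=; rewrite in_itv /=.
  move=> /(inverse_lt w y0) [[n [k [ky tD]]]|H].
    by left; exists n => //; exists k.
  by right=> n _ /=; rewrite ltNge H.
move=> H; apply/(inverse_lt w y0); case: H => [[n _ [k /= ky tD]]|H].
  by left; exists n, k.
by right=> n; have /= := H n I; rewrite leNgt => /negP.
Qed.

Let expRD_laplace s x : 0 < s -> 0 <= x ->
  (\int[P]_w (expR (- (s * D x w)))%:E = (expR (- (x * s `^ alpha)))%:E)%E.
Proof.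
move=> s0 x0; have := subordinator_laplace sD s0 x0.
by rewrite expectation.unlock.
Qed.

Let measurable_exp (c s x : R) : 0 <= x ->
  measurable_fun setT (fun w => (c * expR (- (s * D x w)))%:E).
Proof.
move=> x0; apply/measurable_EFinP; apply: measurable_funM => //.
apply: measurableT_comp => //; apply: measurableT_comp => //.
by apply: measurable_funM => //; exact: mD.
Qed.

Let integral_exp (c s x : R) : 0 < s -> 0 <= x -> 0 <= c ->
  (\int[P]_w (c * expR (- (s * D x w)))%:E = (c * expR (- (x * s `^ alpha)))%:E)%E.
Proof.
move=> s0 x0 c0; under eq_integral do rewrite EFinM.
rewrite ge0_integralZl //; first by rewrite expRD_laplace.
by have := measurable_exp 1 s x0; under eq_fun do rewrite mul1r.
Qed.

Let mY := measurable_inverse_subordinator.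

Let eseries_geometric (a q : R) : 0 <= q -> q < 1 ->
  (\sum_(0 <= i <oo) (a * q ^+ i)%:E = (a * (1 - q)^-1)%:E)%E.
Proof.
move=> q0 q1; apply/cvg_lim => //.
have -> : (fun n => \sum_(0 <= i < n) (a * q ^+ i)%:E)%E = EFin \o series (geometric a q).
  by apply/funext => n /=; rewrite sumEFin.
apply: cvg_EFin; first exact: nearW.
by apply: cvg_geometric_series; rewrite ger0_norm.
Qed.

(* On [i < Y <= i + 1] one has [D i <= t], so [e^{xY}] is at most
   [e^{x(i+1)} e^{s(t - D i)}]. *)
Let exp_inverse_le x s w : 0 <= x -> 0 < s ->
  ((expR (x * Y w))%:E <= 1 + \sum_(0 <= i <oo)
    (expR (x * i.+1%:R + s * t) * expR (- (s * D i%:R w)))%:E)%E.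
Proof.
move=> x0 s0.
have term_ge0 i : (0 <= (expR (x * i.+1%:R + s * t) * expR (- (s * D i%:R w)))%:E)%E.
  by rewrite lee_fin mulr_ge0 ?expR_ge0.
have := inverse_subordinator_ge0 w; rewrite le_eqVlt => /predU1P[<-|Y0].
  by rewrite mulr0 expR0 leeDl // nneseries_ge0.
have [i iY Yi] : exists2 i : nat, i%:R < Y w & Y w <= i.+1%:R.
  have H : exists i : nat, Y w <= i%:R.
    by exists (Num.bound (Y w)); apply: ltW; apply: archi_boundP; exact: ltW.
  case: (ex_minnP H) => -[|i] Yi imin; first by rewrite leNgt Y0 in Yi.
  exists i => //; rewrite ltNge; apply/negP => /imin; by rewrite ltnn.
have Di := subordinator_before_inverse (ler0n R i) iY.
apply: (@le_trans _ _ (expR (x * i.+1%:R + s * t) * expR (- (s * D i%:R w)))%:E).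
  rewrite lee_fin -expRD ler_expR.
  have : x * Y w <= x * i.+1%:R by rewrite ler_wpM2l.
  have : s * D i%:R w <= s * t by rewrite ler_pM2l.
  lra.
apply: (@le_trans _ _ (\sum_(0 <= j < i.+1)
    (expR (x * j.+1%:R + s * t) * expR (- (s * D j%:R w)))%:E)%E).
  by rewrite big_nat_recr //= leeDr // sume_ge0.
apply: (le_trans (nneseries_lim_ge _ _)) => //.
by rewrite leeDr.
Qed.

(** Integrating [exp_inverse_le] yields a geometric series of ratio e^{x - s^alpha} <= e^{- x} <=
    1/2, hence the bound 1 + 2 e^{x + s t}. *)
Lemma inverse_subordinator_mgf_le x s : 1 <= x -> 0 < s -> 2 * x <= s `^ alpha ->
  (\int[P]_w (expR (x * Y w))%:E <= (3 * expR (x + s * t))%:E)%E.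
Proof.
move=> x1 s0 xs; have x0 : 0 <= x by lra.
pose f (i : nat) w := (expR (x * i.+1%:R + s * t) * expR (- (s * D i%:R w)))%:E.
have f0 i w : (0 <= f i w)%E by rewrite lee_fin mulr_ge0 ?expR_ge0.
have mf i : measurable_fun setT (f i) by exact: measurable_exp.
have mS : measurable_fun setT (fun w => \sum_(0 <= i <oo) f i w)%E.
  by apply: ge0_emeasurable_sum => // i w _ _; exact: f0.
have h1 : (\int[P]_w (expR (x * Y w))%:E <= \int[P]_w (1 + \sum_(0 <= i <oo) f i w))%E.
  apply: ge0_le_integral => //.
  - apply/measurable_EFinP; apply: measurableT_comp => //.
    by apply: measurable_funM => //; exact: mY.
  - by apply: emeasurable_funD.
  - by move=> w _; exact: exp_inverse_le.
apply: le_trans h1 _; rewrite ge0_integralD //; last first.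
  by move=> w _; apply: nneseries_ge0.
rewrite integral_cst // [X in (_ * X)%E](@probability_setT _ _ _ P) mul1e.
rewrite integral_nneseries //.
pose q := expR (x - s `^ alpha).
have q2 : q <= 1 / 2.
  apply: (@le_trans _ _ (expR (- x))); first by rewrite ler_expR; lra.
  rewrite expRN -div1r ler_pdivrMr ?expR_gt0 //.
  by have := expR_ge1Dx x; lra.
have q0 : 0 <= q by exact: expR_ge0.
rewrite (@eq_eseriesr _ _ (fun i => (expR (x + s * t) * q ^+ i)%:E)); last first.
  move=> i _; rewrite integral_exp ?expR_ge0 // /q -expRM_natl -!expRD.
  by congr ((expR _)%:E); rewrite -natr1; ring.
rewrite eseries_geometric //; last by lra.
rewrite -EFinD lee_fin.
have e1 : 1 <= expR (x + s * t).
  by rewrite -expR0 ler_expR addr_ge0 // mulr_ge0 // ltW.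
have : (1 - q)^-1 <= 2.
  by rewrite -div1r ler_pdivrMr; lra.
have := expR_gt0 (x + s * t); nra.
Qed.

Lemma inverse_subordinator_exp_integrable a : exp_integrable P Y a.
Proof.
pose x := 1 + `|a|; pose s := (2 * x) `^ alpha^-1.
have x1 : 1 <= x by rewrite lerDl.
have s0 : 0 < s by rewrite powR_gt0; lra.
have xs : 2 * x <= s `^ alpha by rewrite /s -powRrM mulVf ?gt_eqF // powRr1 //; lra.
have mea b : measurable_fun setT (fun w => (expR (b * Y w))%:E).
  apply/measurable_EFinP; apply: measurableT_comp => //.
  by apply: measurable_funM => //; exact: mY.
apply/integrableP; split; first exact: mea.
apply: (@le_lt_trans _ _ (\int[P]_w (expR (x * Y w))%:E)%E); last first.
  by apply: le_lt_trans (inverse_subordinator_mgf_le x1 s0 xs) _; rewrite ltry.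
apply: ge0_le_integral => //.
- by apply: measurableT_comp => //; exact: mea.
- by move=> w _ /=; rewrite (ger0_norm (expR_ge0 _)) lee_fin ler_expR ler_wpM2r
    ?inverse_subordinator_ge0 // (le_trans (ler_norm a)) // lerDr.
Qed.

(** With alpha (m + 1) >= 1, the choice s = (2 x)^{m+1} satisfies s^alpha >= 2 x. The constant 3 in
    C comes from 3 <= e^2 and 2 + x <= 3 x^{m+1}, the rest from s t. *)
Lemma inverse_subordinator_mgf_growth : exists (C : R) (m : nat),
  0 <= C /\ forall x, 1 <= x -> \int[P]_w expR (x * Y w) <= expR (C * x ^+ m).
Proof.
have [m am] : exists m : nat, 1 <= alpha * m.+1%:R.
  exists (Num.bound alpha^-1); rewrite mulrC -ler_pdivrMr //  div1r.
  apply: le_trans (ltW (archi_boundP _)) _; first by rewrite invr_ge0 ltW.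
  by rewrite ler_nat.
exists (3 + 2 ^+ m.+1 * t), m.+1; split.
  by rewrite addr_ge0 // mulr_ge0 ?exprn_ge0 // ltW.
move=> x x1; pose s := (2 * x) ^+ m.+1.
have s0 : 0 < s by rewrite exprn_gt0 //; lra.
have xs : 2 * x <= s `^ alpha.
  rewrite /s -powR_mulrn; last by lra.
  rewrite -powRrM -[leLHS]powRr1; last by lra.
  by rewrite ler_powR; lra.
have := inverse_subordinator_mgf_le x1 s0 xs.
have fin : (\int[P]_w (expR (x * Y w))%:E)%E \is a fin_num.
  by apply: integrable_fin_num => //; exact: inverse_subordinator_exp_integrable.
rewrite -[X in (X <= _)%E]fineK // lee_fin => H; apply: le_trans H _.
have e3 : 3 <= expR 2 :> R by apply: le_trans (expR_ge1Dx 2); lra.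
apply: (@le_trans _ _ (expR 2 * expR (x + s * t))).
  by rewrite ler_wpM2r ?expR_ge0.
have xm : x <= x ^+ m.+1 by rewrite exprS ler_peMr ?exprn_ege1 //; lra.
rewrite -expRD ler_expR /s exprMn.
have -> : 2 + (x + 2 ^+ m.+1 * x ^+ m.+1 * t)
  = (2 + x) + 2 ^+ m.+1 * t * x ^+ m.+1 by ring.
by rewrite mulrDl lerD2r; lra.
Qed.

Let measurable_gtD x : 0 <= x -> measurable [set w | t < D x w].
Proof.
move=> x0; rewrite (_ : mkset _ = D x @^-1` `]t, +oo[%classic).
  by rewrite -[X in measurable X]setTI; apply: mD.
by apply/seteqP; split => w /=; rewrite in_itv /= andbT.
Qed.

Let measurable_leD x : 0 <= x -> measurable [set w | D x w <= t].
Proof.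
move=> x0; rewrite (_ : mkset _ = ~` [set w | t < D x w]).
  by apply: measurableC; exact: measurable_gtD.
by apply/seteqP; split => w /=; rewrite leNgt => /negP.
Qed.

Let prob (A : set T) : R := fine (P A).

Let prob_ge0 A : 0 <= prob A. Proof. exact: fine_ge0. Qed.

Let prob_eq0 A : measurable A -> prob A = 0 -> P A = 0%E.
Proof. by move=> mA A0; rewrite -[LHS]fineK ?fin_num_measure // -/(prob A) A0. Qed.

Let Rintegral_indic A : measurable A -> \int[P]_w \1_A w = prob A.
Proof. by move=> mA; rewrite /Rintegral integral_indic // setIT. Qed.

Let integrable_expD s x : 0 < s -> 0 <= x ->
  P.-integrable setT (fun w => (expR (- (s * D x w)))%:E).
Proof.
move=> s0 x0; apply/integrableP; split.
  by have := measurable_exp 1 s x0; under eq_fun do rewrite mul1r.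
under eq_integral do rewrite /= (ger0_norm (expR_ge0 _)).
by rewrite expRD_laplace // ltry.
Qed.

Let Rlaplace s x : 0 < s -> 0 <= x ->
  \int[P]_w expR (- (s * D x w)) = expR (- (x * s `^ alpha)).
Proof. by move=> s0 x0; rewrite /Rintegral expRD_laplace. Qed.

(** Markov's inequality for e^{- s D(x)}. *)
Let prob_leD x s : 0 < s -> 0 <= x ->
  expR (- (s * t)) * prob [set w | D x w <= t] <= expR (- (x * s `^ alpha)).
Proof.
move=> s0 x0; have mA := measurable_leD x0.
have iA := integrable_indic P mA.
rewrite -Rlaplace // -Rintegral_indic // -RintegralZl //.
apply: le_Rintegral => //.
- exact: (integrableZl measurableT (expR (- (s * t))) iA).
- exact: integrable_expD.
- move=> w _; rewrite indicE; case: (boolP (w \in _)) => [|_].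
    by rewrite inE /= mulr1 ler_expR lerN2 ler_pM2l.
  by rewrite mulr0 expR_ge0.
Qed.

(** Otherwise D(e) <= t almost surely, so e s^alpha <= s t for every s > 0. This fails for small s
    because alpha < 1; the s chosen has s t = s^alpha e / 2. *)
Lemma inverse_subordinator_small_prob e : 0 < e -> (0 < P [set w | (Y w <= e)%R])%E.
Proof.
move=> e0; have mA := measurable_leD (ltW e0).
have mYe : measurable [set w | Y w <= e].
  rewrite (_ : mkset _ = Y @^-1` `]-oo, e]%classic).
    by rewrite -[X in measurable X]setTI; apply: mY.
  by apply/seteqP; split => w /=; rewrite in_itv.
rewrite lt0e measure_ge0 andbT; apply/eqP => PY.
have PA : prob [set w | D e w <= t] = 1.
  have := @probability_setC _ _ _ P _ (measurable_gtD (ltW e0)).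
  have -> : P [set w | t < D e w] = 0%E.
    apply/eqP; rewrite -measure_le0 -PY; apply: le_measure; rewrite ?inE //.
      exact: measurable_gtD (ltW e0).
    by move=> w /= tD; apply: inverse_subordinator_le => //; exact: ltW.
  rewrite sube0.
  rewrite (_ : ~` _ = [set w | D e w <= t]); first by rewrite /prob => ->.
  by apply/seteqP; split => w /=; rewrite leNgt => /negP.
pose s := (e / (2 * t)) `^ (1 - alpha)^-1.
have et0 : 0 < e / (2 * t) by rewrite divr_gt0 // mulr_gt0.
have s0 : 0 < s by rewrite powR_gt0.
have sE : s = s `^ alpha * (e / (2 * t)).
  have -> : e / (2 * t) = s `^ (1 - alpha).
    by rewrite /s -powRrM mulVf ?powRr1 ?(ltW et0) // subr_eq0 gt_eqF.
  rewrite -powRD; last by rewrite (gt_eqF s0) implybT.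
  by rewrite addrC subrK powRr1 // ltW.
have := prob_leD s0 (ltW e0); rewrite PA mulr1 ler_expR lerN2.
have -> : s * t = s `^ alpha * (e / 2).
  by rewrite {1}sE; field; rewrite gt_eqF.
have : 0 < s `^ alpha * e by rewrite mulr_gt0 ?powR_gt0.
lra.
Qed.

(** If E e^{- Y} = 1 then Y = 0 almost surely, so [D] exceeds t immediately after time 0, against
    its Laplace transform. *)
Lemma inverse_subordinator_laplace_neq1 : \int[P]_w expR (- 1 * Y w) != 1.
Proof.
apply/eqP => Y1.
have iY := inverse_subordinator_exp_integrable (- 1).
have PY dlt : 0 < dlt -> prob [set w | dlt <= Y w] = 0.
  move=> d0.
  have mA : measurable [set w | dlt <= Y w].
    rewrite (_ : mkset _ = Y @^-1` `[dlt, +oo[%classic).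
      by rewrite -[X in measurable X]setTI; apply: mY.
    by apply/seteqP; split => w /=; rewrite in_itv /= andbT.
  have iA := integrable_indic P mA.
  have e1 : 0 < 1 - expR (- dlt) by rewrite subr_gt0 expR_lt1 oppr_lt0.
  have : (1 - expR (- dlt)) * prob [set w | dlt <= Y w] <= 0.
    have -> : (0 : R) = \int[P]_w (1 - expR (- 1 * Y w)).
      rewrite RintegralB //; last exact: integrable_cst.
      by rewrite Y1 Rintegral_cst // [X in fine X](@probability_setT _ _ _ P) mulr1 subrr.
    rewrite -Rintegral_indic // -RintegralZl //; apply: le_Rintegral => //.
    - exact: (integrableZl measurableT _ iA).
    - exact: (integrableB measurableT (integrable_cst P 1) iY).
    - move=> w _; rewrite indicE mulN1r; case: (boolP (w \in _)) => [|_].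
        by rewrite inE /= => dY; rewrite mulr1 lerD2l lerN2 ler_expR lerN2.
      by rewrite mulr0 subr_ge0 expR_le1 oppr_le0 inverse_subordinator_ge0.
  by rewrite pmulr_rle0 // => h; apply/eqP; rewrite eq_le h prob_ge0.
have PD dlt : 0 < dlt -> prob [set w | D dlt w <= t] = 0.
  move=> d0.
  have mA : measurable [set w | dlt <= Y w].
    rewrite (_ : mkset _ = Y @^-1` `[dlt, +oo[%classic).
      by rewrite -[X in measurable X]setTI; apply: mY.
    by apply/seteqP; split => w /=; rewrite in_itv /= andbT.
  have PYd : P [set w | dlt <= Y w] = 0%E by apply: prob_eq0 => //; exact: PY.
  (* Almost surely Y < dlt, which gives D(dlt) > t unless [D] never exceeds t and [Y] takes the
     default value 0. The latter event lies in {D(n) <= t}, of probability at most e^{t - n}. *)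
  have le_n (n : nat) : prob [set w | D dlt w <= t] <= expR (t - n%:R).
    have mB := measurable_leD (ler0n R n).
    have : prob [set w | D n%:R w <= t] <= expR (t - n%:R).
      have := prob_leD ltr01 (ler0n R n); rewrite powR1 mul1r mulr1.
      by rewrite expRD !expRN mulrC ler_pdivrMr ?expR_gt0 // mulrC.
    apply: le_trans; apply: fine_le; rewrite ?fin_num_measure //.
      exact: measurable_leD (ltW d0).
    apply: (@le_trans _ _ (P ([set w | (dlt <= Y w)%R] `|` [set w | (D n%:R w <= t)%R]))%E).
      apply: le_measure; rewrite ?inE //.
      - exact: measurable_leD (ltW d0).
      - exact: measurableU.
      move=> w /= Dd; have [E0|/set0P E0] := eqVneq (passage w) set0.
        right; rewrite leNgt; apply/negP => tD.
        by have : passage w n%:R by []; rewrite E0.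
      left; apply: lb_le_inf => // x [x0 tD]; rewrite leNgt; apply/negP => xd.
      by have := D_le w x0 (ltW xd); rewrite leNgt (le_lt_trans Dd tD).
    apply: (@le_trans _ _ (P [set w | (dlt <= Y w)%R] + P [set w | (D n%:R w <= t)%R])%E).
      exact: measureU2.
    by rewrite PYd add0e.
  apply/eqP; rewrite eq_le prob_ge0 andbT; apply/ler_addgt0Pl => e e0; rewrite addr0.
  have [n n1 ne] : exists2 n : nat, True & t - ln e <= n%:R.
    exists (Num.bound `|t - ln e|) => //.
    by apply: le_trans (ler_norm _) (ltW (archi_boundP _)).
  apply: le_trans (le_n n) _; rewrite -[leRHS]lnK ?posrE // ler_expR; lra.
(* D(t/2) > t almost surely would give E e^{- D(t/2)} <= e^{- t}, whereas the Laplace transform at s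
   = 1 is e^{- t/2}. *)
have th0 : 0 < t / 2 by rewrite divr_gt0.
pose N := [set w | D (t / 2) w <= t].
have mN : measurable N by exact: measurable_leD (ltW th0).
have : \int[P]_w expR (- (1 * D (t / 2) w)) <= expR (- t).
  have iD := integrable_expD ltr01 (ltW th0).
  rewrite /Rintegral (negligible_integral mN) //; last exact: prob_eq0 (PD _ th0).
  rewrite -[leRHS]/(fine (expR (- t))%:E).
  have mNC : measurable (setT `\` N).
    by rewrite setTD; exact: measurableC.
  have cst_le : (\int[P]_(x in setT `\` N)
      (expR (- t))%:E <= (expR (- t))%:E)%E.
    rewrite integral_cst // -[leRHS]mule1 lee_wpmul2l ?lee_fin ?expR_ge0 //.
    exact: probability_le1.
  have le_int : (\int[P]_(x in setT `\` N)
      (expR (- (1 * D (t / 2) x)))%:E <= (expR (- t))%:E)%E.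
    apply: le_trans cst_le; apply: ge0_le_integral => //.
    - by apply: measurable_funTS; exact: (measurable_int _ iD).
    - by move=> w [_ /= /negP]; rewrite -ltNge => /ltW tD; rewrite lee_fin ler_expR lerN2 mul1r.
  apply: fine_le => //; rewrite ge0_fin_numE; first exact: le_lt_trans le_int (ltry _).
  by apply: integral_ge0 => w _; rewrite lee_fin expR_ge0.
rewrite Rlaplace ?ltr01 ?(ltW th0) // powR1 mulr1 ler_expR lerN2; lra.
Qed.

End Subordinator.

(** * Subordination *)

Section IndependentIntegral.
Context {d d1 d2 : measure_display} {T : measurableType d}
  {E1 : measurableType d1} {E2 : measurableType d2} {R : realType}.
Variables (P : probability T R) (U : {mfun T >-> E1}) (V : {mfun T >-> E2}).
Hypothesis UV : independent2 P (rv_salgebra U) (rv_salgebra V).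
Local Open Scope ereal_scope.

Lemma integral_indep (f : E1 * E2 -> \bar R) :
  measurable_fun setT f -> P.-integrable setT (fun w => f (U w, V w)) ->
  \int[P]_w f (U w, V w) =
  \int[distribution P V]_v \int[distribution P U]_u f (u, v).
Proof.
move=> mf intf; have mUV := measurable_pair U V.
have intm : (distribution P U \x distribution P V).-integrable setT f.
  apply/integrableP; split=> //; move/integrableP: intf => [_].
  rewrite (@ge0_integral_indep _ _ _ P _ _ _ _ _ _ UV (fun x => `|f x|)) //.
    by rewrite fubini_tonelli1 //; exact: measurableT_comp.
  exact: measurableT_comp.
pose UV' w : (E1 * E2)%type := (U w, V w).
transitivity (integral (pushforward P UV') setT f).
  by rewrite integral_pushforward.
transitivity (\int[distribution P U \x distribution P V]_x f x).
  by apply: eq_measure_integral => B mB _; exact: indep_pair_distribution.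
by rewrite -integral21_prod_meas1.
Qed.

End IndependentIntegral.

Section Subordination.
Context {d : measure_display} {T : measurableType d} {R : realType}.
Variables (P : probability T R) (S : R -> T -> R) (Y : T -> R).
Hypotheses (mS : forall y, 0 <= y -> measurable_fun setT (S y))
  (rcS : forall w y, 0 <= y -> \forall s \near y^'+, S s w = S y w)
  (mY : measurable_fun setT Y) (Y0 : forall w, 0 <= Y w)
  (indep : independent2 P (process_salgebra [set t : R | 0 <= t] S) (rv_salgebra Y)).

Let gen := \bigcup_(t in [set t : R | 0 <= t]) rv_salgebra (S t).

(* [T] equipped with the events determined by [S] only: the identity of [T], seen
   as a map to [path], and [Y] form an independent pair, to which Fubini's theorem
   applies. *)
Let path := g_sigma_algebraType gen.

Let to_path (w : T) : path := w.

Let measurable_to_path : measurable_fun setT to_path.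
Proof.
move=> _ B; rewrite setTI -[to_path @^-1` B]/B.
apply: smallest_sub; first exact: sigma_algebra_measurable.
move=> _ [t /= t0 [C mC <-]]; exact: mS.
Qed.

Let U : {mfun T >-> path} := rv_of measurable_to_path.
Let V : {mfun T >-> R} := rv_of mY.

Let indepUV : independent2 P (rv_salgebra U) (rv_salgebra V).
Proof. by move=> _ B [A mA <-] VB; rewrite setTI; apply: indep. Qed.

Let measurable_S_path y : 0 <= y -> measurable_fun setT (S y : path -> R).
Proof.
move=> y0 _ B mB; apply: sub_gen_smallest; exists y => //; exists B => //.
Qed.

(** The absolute value makes the map meaningful on all of R, since [S] is controlled at nonnegative
    times only. *)
Let joint (p : path * R) : R := S `|p.2| p.1.

Let grid n (y : R) : R := (Num.truncn (`|y| * n.+1%:R)).+1%:R / n.+1%:R.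

Let joint_grid n (p : path * R) : R := S (grid n p.2) p.1.

Let measurable_joint_grid n : measurable_fun setT (joint_grid n).
Proof.
move=> _ B mB; rewrite setTI.
rewrite (_ : _ @^-1` _ = \bigcup_k
  ((S (k.+1%:R / n.+1%:R) @^-1` B) `*`
   [set y : R | k%:R <= `|y| * n.+1%:R < k.+1%:R])).
  apply: bigcup_measurable => k _; apply: measurableX.
    by rewrite -[X in measurable X]setTI; apply: measurable_S_path.
  rewrite (_ : mkset _ = (fun y : R => `|y| * n.+1%:R) @^-1` `[k%:R, k.+1%:R[%classic).
    by rewrite -[X in measurable X]setTI; apply: measurable_funM => //; exact: normr_measurable.
  by apply/seteqP; split => y /=; rewrite in_itv.
apply/seteqP; split => [[w y] /= Bw|[w y] [k _ [/= Bw ky]]].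
  exists (Num.truncn (`|y| * n.+1%:R)) => //; split => //=.
  by apply: truncn_itv; rewrite mulr_ge0.
by rewrite /joint_grid /grid /= (truncn_def ky).
Qed.

(** The grid points tend to the time from the strict right, where paths are locally constant, so the
    approximations are eventually equal to the limit. *)
Let measurable_joint : measurable_fun setT joint.
Proof.
apply: (measurable_fun_cvg measurable_joint_grid) => -[w y] _.
apply: cvg_near_cst.
have /nbhs_ballP[e /= e0 He] := rcS w (normr_ge0 y).
have [n0 _ Hn] := near_infty_natSinv_lt (PosNum e0).
exists n0 => // n /= n0n; have [y1 y2] := grid_right n (normr_ge0 y).
rewrite /joint_grid /joint /=; apply: He; last exact: y1.
rewrite /ball /= distrC ger0_norm ?subr_ge0 ?(ltW y1) //.
rewrite ltrBlDl; apply: le_lt_trans y2 _; rewrite ltrD2l; exact: Hn.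
Qed.

Lemma subordination_measurable : measurable_fun setT (fun w => S (Y w) w).
Proof.
rewrite (_ : (fun w => _) = joint \o (fun w => (U w, V w))).
  by apply: (measurableT_comp measurable_joint); exact: measurable_pair.
by apply/funext => w; rewrite /joint /= ger0_norm.
Qed.

Let pathE (f : R -> \bar R) y : measurable_fun setT f -> 0 <= y ->
  (\int[distribution P U]_u f (S y u) = \int[P]_w f (S y w))%E.
Proof.
move=> mf y0; have mfS : measurable_fun setT (f \o S y : path -> \bar R).
  by apply: measurableT_comp => //; exact: measurable_S_path.
apply: (@eq_law_integral _ _ _ path T path R (distribution P U) P id U _ _ _
  (f \o S y : path -> \bar R)) => //.
Qed.

Let VE (f : R -> \bar R) : measurable_fun setT f ->
  (\int[distribution P V]_v f v = \int[P]_w f (Y w))%E.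
Proof.
by move=> mf; apply: (@eq_law_integral _ _ _ R T R R (distribution P V) P id V).
Qed.

Lemma subordination_ge0_integral (f : R -> \bar R) (phi : R -> \bar R) :
  measurable_fun setT f -> (forall x, 0 <= f x)%E -> measurable_fun setT phi ->
  (forall y, 0 <= y -> (\int[P]_w f (S y w) = phi y)%E) ->
  (\int[P]_w f (S (Y w) w) = \int[P]_w phi (Y w))%E.
Proof.
move=> mf f0 mphi fphi.
have mfj : measurable_fun setT (f \o joint) by exact: measurableT_comp mf measurable_joint.
transitivity (\int[P]_w (f \o joint) (U w, V w))%E.
  by apply: eq_integral => w _; rewrite /joint /= ger0_norm.
rewrite (ge0_integral_indep indepUV) //; last by move=> x; exact: f0.
rewrite fubini_tonelli //; last by move=> x; exact: f0.
transitivity (\int[distribution P V]_v phi `|v|%R)%E.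
  by apply: eq_integral => v _; rewrite /joint /= pathE // fphi.
rewrite (VE (f := fun v => phi `|v|)).
  by apply: eq_integral => w _; rewrite ger0_norm.
by apply: measurableT_comp mphi _; exact: normr_measurable.
Qed.

Lemma subordination_integral (f : R -> \bar R) (phi : R -> \bar R) :
  measurable_fun setT f -> P.-integrable setT (fun w => f (S (Y w) w)) ->
  measurable_fun setT phi ->
  (forall y, 0 <= y -> (\int[P]_w f (S y w) = phi y)%E) ->
  (\int[P]_w f (S (Y w) w) = \int[P]_w phi (Y w))%E.
Proof.
move=> mf intf mphi fphi.
have mfj : measurable_fun setT (f \o joint) by exact: measurableT_comp mf measurable_joint.
have jE w : (f \o joint) (U w, V w) = f (S (Y w) w) by rewrite /joint /= ger0_norm.
transitivity (\int[P]_w (f \o joint) (U w, V w))%E.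
  by apply: eq_integral => w _; rewrite jE.
rewrite (integral_indep indepUV) //; last by under eq_fun do rewrite jE.
transitivity (\int[distribution P V]_v phi `|v|%R)%E.
  by apply: eq_integral => v _; rewrite /joint /= pathE // fphi.
rewrite (VE (f := fun v => phi `|v|)).
  by apply: eq_integral => w _; rewrite ger0_norm.
by apply: measurableT_comp mphi _; exact: normr_measurable.
Qed.

Section Transform.
Variable kappa : R[i] -> R[i].
Hypotheses
  (expS : forall y z, 0 <= y -> exp_integrable P (S y) (Re z) /\
    cmgf P (S y) z = cexp (y%:C * kappa z))
  (expY : forall a, exp_integrable P Y a).

Let mgf_S a y : 0 <= y ->
  (\int[P]_w (expR (a * S y w))%:E = (Re (cexp (kappa a%:C * y%:C)))%:E)%E.
Proof.
move=> y0; have [eS cS] := expS a%:C y0; rewrite cmgf_real in cS.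
rewrite [kappa _ * _]mulrC -cS /= /Rintegral fineK //.
by apply: integrable_fin_num.
Qed.

(** Tonelli's theorem gives the value of E e^{aX}, finite by the exponential moments of [Y]; only
    then does Fubini's theorem apply to complex arguments. *)
Lemma subordination_exp_integrable a :
  exp_integrable P (fun w => S (Y w) w) a.
Proof.
have me : measurable_fun setT (fun x : R => (expR (a * x))%:E).
  by apply/measurable_EFinP; exact: measurable_expRM.
have mr : measurable_fun setT (fun y : R => (Re (cexp (kappa a%:C * y%:C)))%:E).
  by apply/measurable_EFinP; exact: measurable_Re_cexp.
apply/integrableP; split.
  exact: (measurableT_comp me subordination_measurable).
under eq_integral do rewrite /= (ger0_norm (expR_ge0 _)).
rewrite (subordination_ge0_integral me _ mr) //; last first.
- by move=> y y0; exact: mgf_S.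
have := integrable_Re_cexp mY (expY (Re (kappa a%:C))).
by move=> /(integrable_fin_num measurableT); rewrite fin_numE ltey => /andP[].
Qed.

Lemma subordination_cmgf z :
  cmgf P (fun w => S (Y w) w) z = cmgf P Y (kappa z).
Proof.
have eX := subordination_exp_integrable (Re z).
have mX := subordination_measurable.
have cE y : 0 <= y -> cmgf P (S y) z = cexp (kappa z * y%:C).
  by move=> y0; rewrite mulrC; exact: (expS z y0).2.
have fS y : 0 <= y -> exp_integrable P (S y) (Re z) by move=> y0; exact: (expS z y0).1.
rewrite /cmgf /Rintegral; congr (fine _ +i* fine _).
- apply: (@subordination_integral (fun x => (Re (cexp (z * x%:C)))%:E)
    (fun y => (Re (cexp (kappa z * y%:C)))%:E)).
  + by apply/measurable_EFinP; exact: measurable_Re_cexp.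
  + exact: integrable_Re_cexp.
  + by apply/measurable_EFinP; exact: measurable_Re_cexp.
  move=> y y0; rewrite -cE // /= fineK //; apply: integrable_fin_num => //.
  by apply: integrable_Re_cexp => //; [exact: mS|exact: fS].
- apply: (@subordination_integral (fun x => (Im (cexp (z * x%:C)))%:E)
    (fun y => (Im (cexp (kappa z * y%:C)))%:E)).
  + by apply/measurable_EFinP; exact: measurable_Im_cexp.
  + exact: integrable_Im_cexp.
  + by apply/measurable_EFinP; exact: measurable_Im_cexp.
  move=> y y0; rewrite -cE // /= fineK //; apply: integrable_fin_num => //.
  by apply: integrable_Im_cexp => //; [exact: mS|exact: fS].
Qed.

End Transform.

End Subordination.

(** * Roots of the Skellam exponent *)

Section SkellamRoots.
Context {R : realType} (k : nat) (lam mu : 'I_k.+1 -> R).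
Hypotheses (lam0 : forall j, 0 < lam j) (mu0 : forall j, 0 < mu j).

Local Notation m := (k.+1.*2).

(** One amplitude of w^{k+1} kappa (w), the factor clearing negative powers; there are k + 1
    amplitudes, so [k - j] is (k + 1) - (j + 1). *)
Let jump (j : 'I_k.+1) : {poly R} := lam j *: ('X^(k.+1 + j.+1) - 'X^(k.+1))
  + mu j *: ('X^(k - j) - 'X^(k.+1)).

Definition skellam_poly : {poly R} := \sum_(j < k.+1) jump j.

Lemma skellam_polyE (s : R) (w : R[i]) : w != 0 ->
  (map_poly (real_complex R) (skellam_poly + s *: 'X^(k.+1))).[w]
    = w ^+ k.+1 * (skellam_exponent lam mu w + s%:C).
Proof.
move=> w0; rewrite rmorphD /= hornerD map_polyZ map_polyXn hornerZ hornerXn.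
rewrite mulrDr [s%:C * _]mulrC; congr (_ + _).
rewrite /skellam_poly rmorph_sum horner_sum /skellam_exponent /jump_exponent.
rewrite -big_split mulr_sumr /=; apply: eq_bigr => j _.
rewrite /jump rmorphD /= !map_polyZ !rmorphB /= !map_polyXn hornerD !hornerZ !hornerD.
rewrite !hornerN !hornerXn.
have e2 : w ^+ (k - j) = w ^+ k.+1 * w^-1 ^+ j.+1.
  have jk : (j <= k)%N by rewrite -ltnS.
  have -> : w ^+ k.+1 = w ^+ (k - j) * w ^+ j.+1 by rewrite -exprD addnS subnK.
  by rewrite exprVn mulfK // expf_neq0.
by rewrite e2 exprD; ring.
Qed.

Let coef_skellam i : skellam_poly`_i = \sum_(j < k.+1)
  (lam j * ((i == k.+1 + j.+1)%N%:R - (i == k.+1)%N%:R)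
   + mu j * ((i == k - j)%N%:R - (i == k.+1)%N%:R)).
Proof.
rewrite /skellam_poly coef_sum; apply: eq_bigr => j _.
by rewrite /jump coefD !coefZ !coefB !coefXn.
Qed.

Lemma skellam_poly0 : skellam_poly`_0 = mu ord_max.
Proof.
rewrite coef_skellam (bigD1 ord_max) //= big1 => [|j jk].
  by rewrite subnn eqxx /= !subr0; ring.
have jk' : (j < k)%N by rewrite ltn_neqAle -ltnS ltn_ord andbT; exact: jk.
rewrite [(0 == k - j)%N]eq_sym subn_eq0 leqNgt jk' /=; ring.
Qed.

Let skellam_poly_top : skellam_poly`_m = lam ord_max.
Proof.
rewrite coef_skellam (bigD1 ord_max) //= big1 => [|j jk].
  rewrite -addnn eqxx subnn.
  rewrite (_ : (k.+1 + k.+1 == k.+1)%N = false) //; last by lia.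
  by rewrite (_ : (k.+1 + k.+1 == 0)%N = false) //=; ring.
have jk' : (j < k)%N by rewrite ltn_neqAle -ltnS ltn_ord andbT; exact: jk.
rewrite -addnn (_ : (k.+1 + k.+1 == k.+1 + j.+1)%N = false); last by lia.
rewrite (_ : (k.+1 + k.+1 == k.+1)%N = false); last by lia.
rewrite (_ : (k.+1 + k.+1 == k - j)%N = false); last by lia.
by ring.
Qed.

Lemma size_skellam_poly : size skellam_poly = m.+1.
Proof.
apply/eqP; rewrite eqn_leq; apply/andP; split.
  apply/leq_sizeP => i mi; rewrite coef_skellam big1 // => j _.
  have jk := ltn_ord j.
  rewrite (_ : (i == k.+1 + j.+1)%N = false); last by lia.
  rewrite (_ : (i == k.+1)%N = false); last by lia.
  rewrite (_ : (i == k - j)%N = false); last by lia.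
  by ring.
rewrite ltnNge; apply/negP => /leq_sizeP/(_ m (leqnn _)).
by rewrite skellam_poly_top => /eqP; rewrite gt_eqF.
Qed.

Lemma lead_coef_skellam : lead_coef skellam_poly != 0.
Proof. by rewrite /lead_coef size_skellam_poly skellam_poly_top gt_eqF. Qed.

(** The parameter multiplies the middle power, strictly below the top degree 2 (k + 1), so neither
    the leading coefficient nor the number of roots varies with [s]. *)
Lemma skellam_roots : exists w : R -> 'I_m -> R[i], forall s,
  map_poly (real_complex R) (skellam_poly + s *: 'X^(k.+1))
    = (real_complex R) (lead_coef skellam_poly) *: \prod_i ('X - (w s i)%:P).
Proof.
pose p s := map_poly (real_complex R) (skellam_poly + s *: 'X^(k.+1)).
pose r s := sval (closed_field_poly_normal (p s)).
have rE s : p s = lead_coef (p s) *: \prod_(z <- r s) ('X - z%:P).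
  exact: (svalP (closed_field_poly_normal (p s))).
have sizeB s : (size (s *: ('X^(k.+1) : {poly R})) < size skellam_poly)%N.
  rewrite size_skellam_poly; apply: (leq_ltn_trans (size_scale_leq _ _)).
  by rewrite size_polyXn; lia.
have leadE s : lead_coef (p s) = (lead_coef skellam_poly)%:C.
  by rewrite /p lead_coef_map lead_coefDl.
have sizer s : size (r s) = m.
  have := congr1 (fun q : {poly R[i]} => size q) (rE s); rewrite /= size_scale.
    rewrite size_prod_XsubC /p size_map_poly size_polyDl // size_skellam_poly.
    by case.
  by rewrite leadE fmorph_eq0 lead_coef_skellam.
exists (fun s i => (r s)`_i) => s; rewrite -/(p s) [LHS]rE leadE.
by congr (_ *: _); rewrite (big_nth 0) sizer big_mkord.
Qed.

End SkellamRoots.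

(** * The fractional Skellam process *)

Section FractionalSkellam.
Context {d : measure_display} {T : measurableType d} {R : realType}.
Variables (P : probability T R) (k : nat) (lam mu : 'I_k.+1 -> R) (alpha t : R).
Variables (S D : R -> T -> R).
Hypotheses (lam0 : forall j, 0 < lam j) (mu0 : forall j, 0 < mu j)
  (alpha0 : 0 < alpha) (alpha1 : alpha < 1) (t0 : 0 < t)
  (gS : generalized_skellam_process P lam mu S)
  (sD : stable_subordinator P alpha D)
  (indepSD : independent2 P
     (process_salgebra [set t : R | 0 <= t] S)
     (process_salgebra [set t : R | 0 <= t] (inverse_subordinator D))).

Local Notation Y := (inverse_subordinator D t).
Let X w := S (Y w) w.
Local Notation kappa := (skellam_exponent lam mu).

Let mY : measurable_fun setT Y.
Proof. exact: (measurable_inverse_subordinator _ sD). Qed.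

Let Y0 w : 0 <= Y w. Proof. exact: inverse_subordinator_ge0. Qed.

Let expY a : exp_integrable P Y a.
Proof. exact: (inverse_subordinator_exp_integrable alpha0 sD t0). Qed.

Let indepSY : independent2 P (process_salgebra [set t : R | 0 <= t] S) (rv_salgebra Y).
Proof.
move=> A B SA YB; apply: indepSD => //; apply: sub_gen_smallest.
by exists t => //; exact: ltW.
Qed.

Let mS y : 0 <= y -> measurable_fun setT (S y).
Proof. exact: (skellam_measurable gS). Qed.

Let rcS w y : 0 <= y -> \forall s \near y^'+, S s w = S y w.
Proof. exact: (skellam_right_constant gS). Qed.

Let expS y z : 0 <= y -> exp_integrable P (S y) (Re z) /\
  cmgf P (S y) z = cexp (y%:C * kappa (cexp z)).
Proof. exact: (skellam_cmgf lam0 mu0 gS). Qed.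

Let mX : measurable_fun setT X.
Proof. exact: (subordination_measurable mS rcS mY Y0). Qed.

Let intX w : exists j : int, X w = j%:~R.
Proof. exact: (skellam_integer gS). Qed.

Let eX a : exp_integrable P X a.
Proof. exact: (subordination_exp_integrable mS rcS mY Y0 indepSY (fun y z => expS z) expY). Qed.

Let cmgfX z : cmgf P X z = cmgf P Y (kappa (cexp z)).
Proof. exact: (subordination_cmgf mS rcS mY Y0 indepSY (fun y z => expS z) expY). Qed.

Let real_kappa a : R := \sum_(j < k.+1)
  (lam j * (expR (a * j.+1%:R) - 1) + mu j * (expR (- a * j.+1%:R) - 1)).

Let kappa_real a : kappa (cexp a%:C) = (real_kappa a)%:C.
Proof.
rewrite /skellam_exponent /jump_exponent -big_split rmorph_sum; apply: eq_bigr => j _.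
have eE b : cexp b%:C ^+ j.+1 = (expR (b * j.+1%:R))%:C.
  by rewrite cexp_real -rmorphXn -expRM_natr.
have eN : (cexp a%:C)^-1 ^+ j.+1 = (expR (- a * j.+1%:R))%:C.
  by rewrite -eE -cexpN rmorphN.
by rewrite eE eN rmorphD !rmorphM !rmorphB rmorph1.
Qed.

Let mgfX a : \int[P]_w expR (a * X w) = \int[P]_w expR (real_kappa a * Y w).
Proof.
have := cmgfX a%:C; rewrite kappa_real !cmgf_real => E.
by case: E.
Qed.

(** For |a| <= th, the exponent [real_kappa a] is at most (1 + L) e^{(k+1) th}, where 1 + L keeps
    the argument at least 1 for the growth bound of [Y]. Raising to the power m gives K = (k + 1) m,
    and the two factors double C. *)
Let mgfX_growth : exists C K : R, 0 <= C /\ forall th, 0 <= th ->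
  (\int[P]_w expR (th * X w)) * (\int[P]_w expR (- th * X w))
    <= expR (C * expR (K * th)).
Proof.
have [C [m [C0 Y_le]]] := inverse_subordinator_mgf_growth alpha0 sD t0.
pose L := \sum_(j < k.+1) (lam j + mu j).
have L0 : 0 <= L by apply: sumr_ge0 => j _; rewrite addr_ge0 // ltW.
exists (2 * C * (1 + L) ^+ m), (k.+1%:R * m%:R); split.
  by rewrite !mulr_ge0 // exprn_ge0 // addr_ge0.
move=> th th0; pose E := expR (k.+1%:R * th).
have E1 : 1 <= E by rewrite -expR0 ler_expR mulr_ge0.
have kap_le a : `|a| <= th -> real_kappa a <= (1 + L) * E.
  move=> ath; have e_le (b : R) (j : 'I_k.+1) : `|b| <= th -> expR (b * j.+1%:R) - 1 <= E.
    move=> bth; apply: (@le_trans _ _ (expR (b * j.+1%:R))); first by rewrite gerBl.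
    rewrite ler_expR; apply: (@le_trans _ _ (th * j.+1%:R)).
      by rewrite ler_wpM2r // (le_trans (ler_norm b)).
    by rewrite mulrC ler_wpM2r // ler_nat ltn_ord.
  apply: (@le_trans _ _ (L * E)); last by rewrite ler_wpM2r ?expR_ge0 // lerDr.
  rewrite /L mulr_suml; apply: ler_sum => j _; rewrite mulrDl; apply: lerD.
    by rewrite ler_wpM2l ?(ltW (lam0 j)) // e_le.
  by rewrite ler_wpM2l ?(ltW (mu0 j)) // e_le // normrN.
have mgf_le a : `|a| <= th -> \int[P]_w expR (a * X w) <= expR (C * ((1 + L) * E) ^+ m).
  move=> ath; rewrite mgfX.
  apply: (@le_trans _ _ (\int[P]_w expR ((1 + L) * E * Y w))).
    apply: le_Rintegral => //; [exact: expY|exact: expY|].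
    by move=> w _; rewrite ler_expR ler_wpM2r // kap_le.
  by apply: Y_le; rewrite mulr_ege1 // lerDl.
have Em : E ^+ m = expR (k.+1%:R * m%:R * th).
  by rewrite /E -expRM_natr; congr expR; ring.
have mgf_ge0 a : 0 <= \int[P]_w expR (a * X w).
  by apply: Rintegral_ge0 => w _; exact: expR_ge0.
apply: (@le_trans _ _ (expR (C * ((1 + L) * E) ^+ m) * expR (C * ((1 + L) * E) ^+ m))).
  by apply: ler_pM => //; apply: mgf_le; rewrite ?normrN ger0_norm.
rewrite -expRD ler_expR exprMn Em le_eqVlt; apply/orP; left; apply/eqP; ring.
Qed.

Let L (s : R) : R := \int[P]_w expR (- s * Y w).
Let h (n : nat) : R := ln (L n%:R).

Let laplace_ge e : 0 < e ->
  exists q : R, 0 < q /\ forall s, 0 <= s -> expR (- s * e) * q <= L s.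
Proof.
move=> e0; pose A := [set w | Y w <= e].
have mA : measurable A.
  rewrite (_ : A = setT `&` Y @^-1` `]-oo, e]); last first.
    by rewrite setTI; apply/seteqP; split => w /=; rewrite in_itv.
  exact: mY.
exists (fine (P A)); split.
  rewrite fine_gt0 // (inverse_subordinator_small_prob alpha1 sD t0 e0).
  by rewrite (le_lt_trans (probability_le1 P mA)) ?ltry.
move=> s s0; have intA : P.-integrable setT (EFin \o (\1_A : T -> R)).
  exact: integrable_indic.
rewrite (_ : _ * _ = \int[P]_w (expR (- s * e) * \1_A w)); last first.
  rewrite RintegralZl //; congr (_ * fine _).
  by rewrite integral_indic // setIT.
apply: le_Rintegral => //.
- exact: (integrableZl measurableT (expR (- s * e)) intA).
- exact: expY.
move=> w _; rewrite indicE; case: (boolP (w \in A)) => [|_]; last by rewrite mulr0 expR_ge0.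
by rewrite inE mulr1 ler_expR => Ye; rewrite !mulNr lerN2 ler_wpM2l.
Qed.

Let L_gt0 s : 0 <= s -> 0 < L s.
Proof.
move=> s0; have [q [q0 Lq]] := laplace_ge ltr01.
by apply: lt_le_trans (Lq s s0); rewrite mulr_gt0 ?expR_gt0.
Qed.

Let h0 : h 0%N = 0.
Proof.
rewrite /h /L; under eq_Rintegral do rewrite oppr0 mul0r expR0.
by rewrite Rintegral_cst // mul1r [X in fine X](@probability_setT _ _ _ P) /= ln1.
Qed.

Let h_le0 n : h n <= 0.
Proof.
rewrite -h0 ler_ln ?posrE ?L_gt0 //; apply: le_Rintegral => //; [exact: expY..|].
by move=> w _; rewrite ler_expR ler_wpM2r // lerN2.
Qed.

(** [laplace_ge] at e / 2 gives - h n <= n e / 2 - ln q, and the constant - ln q is absorbed by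
    another n e / 2. *)
Let h_sublinear e : 0 < e -> exists N, forall n, (N <= n)%N -> `|h n| <= e * n%:R.
Proof.
move=> e0; have e20 : 0 < e / 2 by rewrite divr_gt0.
have [q [q0 Lq]] := laplace_ge e20.
have [N [_ NE]] := exists_nat_ge [:: - ln q / (e / 2)].
exists N => n Nn; rewrite ler0_norm //.
have /NE : - ln q / (e / 2) \in [:: - ln q / (e / 2)] by rewrite mem_head.
rewrite ler_pdivrMr // => qN.
have qn : - ln q <= n%:R * (e / 2).
  by apply: (le_trans qN); rewrite ler_wpM2r ?(ltW e20) // ler_nat.
have := Lq n%:R (ler0n _ _).
rewrite -ler_ln ?posrE ?mulr_gt0 ?expR_gt0 ?L_gt0 // lnM ?posrE ?expR_gt0 // expRK.
rewrite -/(h n) => hn.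
rewrite (_ : e * _ = n%:R * (e / 2) + n%:R * (e / 2)); last by field.
rewrite mulNr in hn; lra.
Qed.

Let m := k.+1.*2.

(* All roots [w n i] of [kappa w = - n] give the same value [h n], and only
   symmetric functions of the roots remain after summation over [i]. *)
Let h_fdiff : infinitely_divisible (pushforward P X) ->
  exists r, forall n, iter r.+1 (@fdiff R) h n = 0.
Proof.
move=> idX; have [C [K [C0 mgf_le]]] := mgfX_growth.
have [J LK] := approximate_levy_khintchine mX intX eX C0 mgf_le idX.
have [w wE] := skellam_roots mu lam0.
have B0 : ('X^(k.+1) : {poly R})`_0 = 0 by rewrite coefXn.
have A0 : (skellam_poly lam mu)`_0 != 0 by rewrite skellam_poly0 gt_eqF.
have lA := lead_coef_skellam mu lam0.
have w_neq0 := roots_neq0 B0 A0 lA wE.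
have m0 : (0 < m)%N by [].
have /choice[q qE] : forall r : int, exists q : {poly R}, forall s : R,
    \sum_i w s i ^ r = (q.[s])%:C by exact: (power_sums_polyfun m0 B0 A0 lA wE).
have /choice[zeta zetaE] (ni : nat * 'I_m) : exists z, cexp z = w ni.1%:R ni.2.
  by apply: cexp_surj; exact: w_neq0.
have h_zeta n i : ln (normc (cmgf P X (zeta (n, i)))) = h n.
  pose a : R := - n%:R; have kE : kappa (w n%:R i) = a%:C.
    have := skellam_polyE lam mu n%:R (w_neq0 n%:R i).
    rewrite wE hornerZ horner_prod (bigD1 i) //= hornerXsubC subrr mul0r mulr0.
    move=> /esym/eqP; rewrite mulf_eq0 expf_eq0 (negPf (w_neq0 _ _)) andbF /=.
    by rewrite addr_eq0 /a rmorphN => /eqP.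
  rewrite cmgfX zetaE kE cmgf_real; congr ln.
  by rewrite /normc /= expr0n /= addr0 sqrtr_sqr ger0_norm // ltW // L_gt0.
pose c := ln (normc ((-1) ^+ m * ((skellam_poly lam mu)`_0 / lead_coef (skellam_poly lam mu))%:C)).
have sum_zeta n : \sum_i Re (zeta (n, i)) = c.
  have := prod_roots B0 lA wE n%:R; rewrite /c => <-.
  under eq_bigr do rewrite -(zetaE (n, _)).
  by rewrite -cexp_sum normc_cexp expRK raddf_sum.
pose jz (j : nat) : int := j%:Z - J%:Z.
have power_zeta n (j : nat) :
    \sum_i Re (cexp (zeta (n, i) * (j%:R - J%:R)%:C)) = (q (jz j)).[n%:R].
  rewrite -raddf_sum (_ : \sum_i _ = (q (jz j)).[n%:R]%:C) // -qE.
  apply: eq_bigr => i _.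
  by rewrite (_ : j%:R - J%:R = (jz j)%:~R) ?cexpMz ?zetaE // intrB.
(* Fixed by [J] alone, hence before the error e is introduced. *)
pose r := \max_(j < J.*2.+1) size (q (jz j)).
exists r => n; apply/eqP; rewrite -normr_eq0 eq_le normr_ge0 andbT.
apply/ler_addgt0Pr => e e0; rewrite add0r.
pose e' := e / 2 ^+ r.+1.
have e'0 : 0 < e' by rewrite divr_gt0 // exprn_gt0.
(* A strip containing the logarithms of the roots for all n' in the window n, ..., n + r + 1 seen by
   the difference of order r + 1. *)
pose th0 := \sum_(n <= n' < n + r.+2) \sum_i `|Re (zeta (n', i))|.
have [r0 [p LKp]] := LK th0 _ e'0.
(* The mean over the m roots of the approximate formula, as a polynomial in n. Its coefficients
   change with e, its degree does not, so the difference of order r + 1 removes it and leaves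
   2^{r+1} e' = e. *)
pose u : {poly R} := m%:R^-1 *: ((r0 * c)%:P + \sum_(j < J.*2.+1) p j *: (q (jz j) - m%:R%:P)).
have size_u : (size u <= r.+1)%N.
  apply: (leq_trans (size_scale_leq _ _)).
  apply: (leq_trans (size_polyD _ _)); rewrite geq_max.
  rewrite (leq_trans (size_polyC_leq1 _)) //=.
  apply: (leq_trans (size_sum _ _ _)); apply/bigmax_leqP => j _.
  apply: (leq_trans (size_scale_leq _ _)).
  apply: (leq_trans (size_polyD _ _)); rewrite size_polyN geq_max.
  rewrite (leq_trans (size_polyC_leq1 _)) // andbT.
  by apply: leqW; exact: (leq_bigmax j).
have mR0 : 0 < m%:R :> R by rewrite ltr0n.
have u_near n' : (n <= n' <= n + r.+1)%N -> `|h n' - u.[n'%:R]| <= e'.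
  move=> nn'; rewrite -(ler_pM2l mR0) -{1}(gtr0_norm mR0) -normrM.
  have -> : m%:R * (h n' - u.[n'%:R]) = \sum_i (ln (normc (cmgf P X (zeta (n', i)))) -
      (r0 * Re (zeta (n', i)) + \sum_(j < J.*2.+1)
         p j * (Re (cexp (zeta (n', i) * (j%:R - J%:R)%:C)) - 1))).
    rewrite big_split sumrN big_split exchange_big /= -mulr_sumr sum_zeta.
    under eq_bigr do rewrite h_zeta.
    rewrite sumr_const card_ord -[h n' *+ _]mulr_natl mulrBr; congr (_ - _).
    rewrite /u hornerZ mulVKf ?gt_eqF // hornerD hornerC horner_sum; congr (_ + _).
    apply: eq_bigr => j _; rewrite -mulr_sumr sumrB power_zeta hornerZ hornerD hornerN hornerC.
    by rewrite sumr_const card_ord.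
  apply: (le_trans (ler_norm_sum _ _ _)).
  apply: (@le_trans _ _ (\sum_(i < m) e')); last by rewrite sumr_const card_ord mulr_natl.
  apply: ler_sum => i _; apply: LKp.
  have n'_th0 : n' \in index_iota n (n + r.+2) by rewrite mem_index_iota addnS ltnS.
  rewrite /th0 (bigD1_seq n') ?iota_uniq //= (bigD1 i) //= -addrA.
  by rewrite lerDl addr_ge0 // !sumr_ge0 // => n'' _; rewrite sumr_ge0.
have -> : iter r.+1 (@fdiff R) h n = iter r.+1 (@fdiff R) (fun i => h i - u.[i%:R]) n.
  rewrite iter_fdiffD (@eq_iter_fdiff _ _ (fun i => - u.[i%:R]) (fun i => (- u).[i%:R])).
    by rewrite iter_fdiff_poly ?addr0 // size_polyN.
  by move=> i; rewrite hornerN.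
by apply: (le_trans (iter_fdiff_norm_le u_near)); rewrite mulrC divfK // gt_eqF // exprn_gt0.
Qed.

Lemma subordinated_skellam_not_infinitely_divisible :
  ~ infinitely_divisible (pushforward P X).
Proof.
move=> /h_fdiff[r hr].
have := sublinear_fdiff_nilpotent h_sublinear hr 1%N; rewrite h0 => h1.
have /eqP[] := inverse_subordinator_laplace_neq1 alpha0 sD t0.
by rewrite -/(L 1) -(lnK (L_gt0 ler01)) -/(h 1) h1 expR0.
Qed.

End FractionalSkellam.

Theorem proposition3p5 (R : realType) (d : measure_display)
    (T : measurableType d) (P : probability T R)
    (k : nat) (hk : (1 <= k)%N) (lam mu : 'I_k -> R)
    (hlam : forall j, 0 < lam j) (hmu : forall j, 0 < mu j)
    (alpha : R) (halpha0 : 0 < alpha) (halpha1 : alpha < 1)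
    (X : R -> T -> R)
    (hX : generalized_fractional_skellam_process P lam mu alpha X)
    (t : R) (ht : 0 < t) :
  ~ infinitely_divisible (pushforward P (X t)).
Proof.
case: k hk lam mu hlam hmu hX => // k _ lam mu lam0 mu0 [S [D [gS sD indep XE]]].
rewrite (_ : X t = fun w => S (inverse_subordinator D t w) w); last first.
  by apply/funext => w; rewrite XE // ltW.
exact: (@subordinated_skellam_not_infinitely_divisible _ _ _ P k lam mu alpha t S D).
Qed.
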